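(* Let $(M,h)$ be a Hermitian manifold of complex dimension $n\ge2$, let $F=\alpha+|\beta|$ be the complex Randers solution of the generalized Zermelo navigation problem with data $(h,\|u\|_h,W)$, and let $a$ be the associated Hermitian metric. If $a$ and $F$ are projectively related, then $h$ and $F$ are projectively related if and only if $\tilde\varepsilon=\|u\|_h^2-\|W\|_h^2$ is constant. Moreover, any of these assertions implies $\overset{h}{G^i}=G^i$, $\overset{h}{\theta^{*i}}=\theta^{*i}$ and $$\mathcal{K}_F(z,\eta)=\frac{1}{F^2\sqrt{W_0W_{\bar0}}}\left[\tilde\varepsilon\,\alpha^3\,\mathcal{K}_a(z,\eta)-\frac{h^4}{F}\,\mathcal{K}_h(z,\eta)\right],$$ where in this formula $h=\sqrt{h_{i\bar j}\eta^i\bar\eta^j}$, $W_0=W_i\eta^i$ and $W_{\bar 0}=\overline{W_0}$.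
   Context: $M$ is a connected complex manifold with local coordinates $z=(z^k)$; $(z,\eta)$ are the induced coordinates on the holomorphic tangent bundle $T'M$; summation convention; $\dot\partial_k=\partial/\partial\eta^k$; barred indices denote conjugates. Complex Finsler metric: continuous $F:T'M\to\mathbb{R}_{\ge0}$, smooth off the zero section, vanishing only there, $F(z,\lambda\eta)=|\lambda|F(z,\eta)$ for $\lambda\in\mathbb{C}$, with $g_{i\bar j}=\frac{\partial^2F^2}{\partial\eta^i\partial\bar\eta^j}$ positive definite; for $F=\alpha+|\beta|$ the derived objects are taken at points where $\beta\neq0$. Associated objects: $N^i_j=g^{\bar m i}\frac{\partial g_{l\bar m}}{\partial z^j}\eta^l$, $L^i_{jk}=\dot\partial_jN^i_k$, spray coefficients $G^i=\frac12N^i_j\eta^j$, $\theta^{*i}=g^{\bar mi}g_{h\bar p}(L^{\bar p}_{\bar j\bar m}-L^{\bar p}_{\bar m\bar j})\eta^h\bar\eta^j$ (with $L^{\bar p}_{\bar j\bar m}=\overline{L^p_{jm}}$), and holomorphic curvature in direction $\eta$: $\mathcal{K}_F(z,\eta)=-\frac{4}{F^4}g_{k\bar m}\frac{\partial G^k}{\partial\bar z^h}\bar\eta^h\bar\eta^m$. A Hermitian metric $h_{i\bar j}(z)$ is regarded as the complex Finsler metric $\sqrt{h_{i\bar j}\eta^i\bar\eta^j}$; its objects are written $\overset{h}{G^i},\overset{h}{\theta^{*i}},\mathcal{K}_h$ (similarly for $a$), and unmarked objects are those of $F$. Two complex Finsler metrics $F,\tilde F$ on $M$ are projectively related if they have the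 same complex geodesics as point sets, equivalently $\tilde G^i=G^i+\frac12(\tilde\theta^{*i}-\theta^{*i})+P\eta^i$ for some smooth complex-valued function $P$. Complex Randers solution of the generalized Zermelo navigation problem: the data are a Hermitian metric $h$, a smooth section $W=W^i\frac{\partial}{\partial z^i}$ of $T'M$, and a smooth function $f=\|u\|_h$ on $M$ with $0<\|W\|_h<\|u\|_h\le1$, where $\|\eta\|_h=\sqrt{h_{i\bar j}\eta^i\bar\eta^j}$. Put $W_i=h_{i\bar j}\bar W^j$ and $\tilde\varepsilon=\|u\|_h^2-\|W\|_h^2$. The solution (case $\cos\varphi=-1$) is $F=\alpha+|\beta|$ with $\alpha=\sqrt{a_{i\bar j}\eta^i\bar\eta^j}$, $\beta=b_i\eta^i$, $$a_{i\bar j}=\frac{h_{i\bar j}}{\tilde\varepsilon}+\frac{W_i\overline{W_j}}{\tilde\varepsilon^2},\qquad b_i=\frac{W_i}{\tilde\varepsilon}.$$ The curvature formula is understood where $W_0\ne0$. *)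

(* Defs.v *)
From HB Require Import structures.
From mathcomp Require Import all_boot all_order all_algebra.
From mathcomp Require Import complex.
From mathcomp Require Import all_classical all_reals all_analysis.
Import numFieldNormedType.Exports.
Set Implicit Arguments.
Unset Strict Implicit.
Unset Printing Implicit Defensive.
Import Order.TTheory GRing.Theory Num.Theory.
Local Open Scope classical_set_scope.
Local Open Scope ring_scope.
Local Open Scope complex_scope.

(* R[i] with the topology given by its modulus. *)
HB.instance Definition _ (R : realType) :=
  NormedModule.copy R[i] (R[i])^o.

Section RealCalculus.
Variables (R : realType) (V : normedModType R[i]).

(* Derivative of a complex-valued f at x along v, for a real parameter; f is
   only required to be differentiable in the real sense. *)
Definition rderive (f : V -> R[i]) (v x : V) : R[i] :=
  derive1 (fun t : R => complex.Re (f (x + t%:C *: v)) : R^o) 0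
  +i* derive1 (fun t : R => complex.Im (f (x + t%:C *: v)) : R^o) 0.

Definition rderivable (f : V -> R[i]) (v x : V) : Prop :=
  derivable (fun t : R => complex.Re (f (x + t%:C *: v)) : R^o) 0 1 /\
  derivable (fun t : R => complex.Im (f (x + t%:C *: v)) : R^o) 0 1.

Definition rderive_iter (vs : seq V) (f : V -> R[i]) : V -> R[i] :=
  foldr (fun v g => rderive g v) f vs.

(* C^oo in the real sense, for an open set A: every iterated real directional
   derivative exists and is continuous at every point of A. *)
Definition smooth_on (A : set V) (f : V -> R[i]) : Prop :=
  forall (vs : seq V) (x : V), A x ->
    continuous_at x (rderive_iter vs f) /\
    forall v : V, rderivable (rderive_iter vs f) v x.

End RealCalculus.

Section Wirtinger.
Variables (R : realType) (n : nat).
Local Notation Cn := 'rV[R[i]]_n.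

(* d/dz^k = (d/dx^k - i d/dy^k) / 2 and d/d(conj z^k) = (d/dx^k + i d/dy^k) / 2 *)
Definition dz (k : 'I_n) (f : Cn -> R[i]) (x : Cn) : R[i] :=
  2^-1 * (rderive f (delta_mx 0 k) x - 'i * rderive f ('i *: delta_mx 0 k) x).

Definition dzbar (k : 'I_n) (f : Cn -> R[i]) (x : Cn) : R[i] :=
  2^-1 * (rderive f (delta_mx 0 k) x + 'i * rderive f ('i *: delta_mx 0 k) x).

End Wirtinger.

Record chart (R : realType) (n : nat) (M : topologicalType) := Chart {
  chart_dom : set M;
  chart_map : M -> 'rV[R[i]]_n;
  chart_inv : 'rV[R[i]]_n -> M;
  chart_dom_open : open chart_dom;
  chart_cod_open : open (chart_map @` chart_dom);
  chart_mapK : forall p, chart_dom p -> chart_inv (chart_map p) = p;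
  chart_map_continuous : forall p, chart_dom p -> continuous_at p chart_map;
  chart_inv_continuous : forall z, (chart_map @` chart_dom) z ->
    continuous_at z chart_inv
}.

(* Transition maps are differentiable over the field R[i] on the (open) images
   of the overlaps, i.e. holomorphic. *)
Record complexManifold (R : realType) (n : nat) := ComplexManifold {
  mspace :> topologicalType;
  mspace_hausdorff : hausdorff_space mspace;
  mspace_second_countable : @second_countable mspace;
  chart_index : Type;
  charts : chart_index -> chart R n mspace;
  charts_cover : forall p : mspace, exists c, chart_dom (charts c) p;
  charts_holomorphic : forall (c c' : chart_index) (z : 'rV[R[i]]_n),
    (chart_map (charts c) @`
       (chart_dom (charts c) `&` chart_dom (charts c'))) z ->
    differentiable (chart_map (charts c') \o chart_inv (charts c)) z
}.

(* Objects on M are given by their components in each chart of the atlas, as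
   functions of the coordinates z of that chart, together with the usual
   transformation rule on overlaps. *)
Section Tensors.
Variables (R : realType) (n : nat) (M : complexManifold R n).
Local Notation Cn := 'rV[R[i]]_n.
Implicit Types (c : chart_index M) (z eta : Cn).

Definition coord_dom c : set Cn :=
  chart_map (charts c) @` chart_dom (charts c).

Definition overlap c c' : set Cn :=
  chart_map (charts c) @`
    (chart_dom (charts c) `&` chart_dom (charts c')).

Definition transition c c' z : Cn :=
  chart_map (charts c') (chart_inv (charts c) z).

(* jacobian c c' z k i = d z'^i / d z^k, so that the components of a tangent
   vector (a row) change by eta' = eta *m jacobian c c' z. *)
Definition jacobian c c' z : 'M[R[i]]_n :=
  \matrix_(k, i) dz k (fun w => transition c c' w 0 i) z.

Definition smooth_function (f : M -> R) : Prop :=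
  forall c, smooth_on (coord_dom c) (fun z => (f (chart_inv (charts c) z))%:C).

Definition smooth_section (W : chart_index M -> Cn -> Cn) : Prop :=
  (forall c i, smooth_on (coord_dom c) (fun z => W c z 0 i)) /\
  (forall c c' z, overlap c c' z ->
     W c' (transition c c' z) = W c z *m jacobian c c' z).

(* H i j stands for h_{i \bar j}. *)
Definition hform (H : 'M[R[i]]_n) (eta zeta : Cn) : R[i] :=
  \sum_i \sum_j H i j * eta 0 i * (zeta 0 j)^*.

Definition hnorm (H : 'M[R[i]]_n) (eta : Cn) : R :=
  Num.sqrt (complex.Re (hform H eta eta)).

(* In R[i], 0 < x means that x is real and positive. *)
Definition hermitian_metric (h : chart_index M -> Cn -> 'M[R[i]]_n) : Prop :=
  [/\ forall c i j, smooth_on (coord_dom c) (fun z => h c z i j),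
      forall c z i j, coord_dom c z -> h c z j i = (h c z i j)^*,
      forall c z eta, coord_dom c z -> eta != 0 -> 0 < hform (h c z) eta eta
    & forall c c' z, overlap c c' z ->
        h c z = jacobian c c' z *m h c' (transition c c' z)
                *m (map_mx (@conjc R) (jacobian c c' z))^T].

End Tensors.

(* The objects attached to a complex Finsler metric, in local coordinates:
   F z eta is the value of the metric on the vector eta at z. *)
Section FinslerObjects.
Variables (R : realType) (n : nat).
Local Notation Cn := 'rV[R[i]]_n.
Variable F : Cn -> Cn -> R.
Implicit Types (z eta : Cn) (i j k : 'I_n).

(* fundamental z eta i j = g_{i \bar j} *)
Definition fundamental z eta : 'M[R[i]]_n :=
  \matrix_(i, j) dz i (dzbar j (fun zeta => (F z zeta ^+ 2)%:C)) eta.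

(* fundamental_inv z eta m i = g^{\bar m i}, with
   \sum_m g_{k \bar m} g^{\bar m i} = delta_k^i *)
Definition fundamental_inv z eta : 'M[R[i]]_n := invmx (fundamental z eta).

(* nonlinear_conn i j = N^i_j *)
Definition nonlinear_conn i j z eta : R[i] :=
  \sum_m \sum_l fundamental_inv z eta m i
    * dz j (fun w => fundamental w eta l m) z * eta 0 l.

(* linear_conn i j k = L^i_{jk} *)
Definition linear_conn i j k z eta : R[i] :=
  dz j (fun zeta => nonlinear_conn i k z zeta) eta.

Definition spray i z eta : R[i] :=
  2^-1 * \sum_j nonlinear_conn i j z eta * eta 0 j.

Definition theta_star i z eta : R[i] :=
  \sum_m \sum_l \sum_p \sum_j fundamental_inv z eta m i * fundamental z eta l p
    * ((linear_conn p j m z eta)^* - (linear_conn p m j z eta)^*)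
    * eta 0 l * (eta 0 j)^*.

Definition hol_curvature z eta : R[i] :=
  - (4 / (F z eta ^+ 4)%:C) *
  \sum_k \sum_m \sum_l fundamental z eta k m
    * dzbar l (fun w => spray k w eta) z * (eta 0 l)^* * (eta 0 m)^*.

End FinslerObjects.

Section Projective.
Variables (R : realType) (n : nat) (M : complexManifold R n).
Local Notation Cn := 'rV[R[i]]_n.

(* A complex Finsler metric in the charts of M, together with the set of points
   (z, eta) of T'M at which its derived objects are taken. *)
Record finsler := Finsler {
  fin_val : chart_index M -> Cn -> Cn -> R;
  fin_dom : chart_index M -> set (Cn * Cn)
}.

(* The family P is a smooth complex-valued function on the part of T'M where
   the objects of both metrics are defined. *)
Definition projectively_related (F F' : finsler) : Prop :=
  exists P : chart_index M -> Cn * Cn -> R[i],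
  [/\ forall c, smooth_on (fin_dom F c `&` fin_dom F' c) (P c),
      forall c c' z eta, overlap c c' z ->
        (fin_dom F c `&` fin_dom F' c) (z, eta) ->
        P c' (transition c c' z, eta *m jacobian c c' z) = P c (z, eta)
    & forall c z eta, (fin_dom F c `&` fin_dom F' c) (z, eta) -> forall i,
        spray (fin_val F' c) i z eta =
          spray (fin_val F c) i z eta
          + 2^-1 * (theta_star (fin_val F' c) i z eta
                    - theta_star (fin_val F c) i z eta)
          + P c (z, eta) * eta 0 i].

Definition hermitian_finsler (h : chart_index M -> Cn -> 'M[R[i]]_n) : finsler :=
  Finsler (fun c z eta => hnorm (h c z) eta)
          (fun c => [set x | coord_dom c x.1 /\ x.2 != 0]).

End Projective.

Section Navigation.
Variables (R : realType) (n : nat) (M : complexManifold R n).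
Local Notation Cn := 'rV[R[i]]_n.
(* The relative-velocity field u enters only through its norm f = ||u||_h. *)
Variables (h : chart_index M -> Cn -> 'M[R[i]]_n) (f : M -> R)
          (W : chart_index M -> Cn -> Cn).
Implicit Types (c : chart_index M) (z eta : Cn).

Definition norm_u c z : R := f (chart_inv (charts c) z).
Definition norm_W c z : R := hnorm (h c z) (W c z).

Definition navigation_data : Prop :=
  [/\ hermitian_metric h, smooth_section W, smooth_function f
    & forall c z, coord_dom c z ->
        [/\ 0 < norm_W c z, norm_W c z < norm_u c z & norm_u c z <= 1]].

Definition eps_tilde c z : R := norm_u c z ^+ 2 - norm_W c z ^+ 2.

(* W_i = h_{i \bar j} \bar{W^j} *)
Definition W_low c z i : R[i] := \sum_j h c z i j * (W c z 0 j)^*.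

Definition W_zero c z eta : R[i] := \sum_i W_low c z i * eta 0 i.

Definition randers_a c z : 'M[R[i]]_n :=
  \matrix_(i, j) (h c z i j / (eps_tilde c z)%:C
                  + W_low c z i * (W_low c z j)^* / (eps_tilde c z ^+ 2)%:C).

Definition randers_b c z i : R[i] := W_low c z i / (eps_tilde c z)%:C.

Definition randers_alpha c z eta : R := hnorm (randers_a c z) eta.

Definition randers_beta c z eta : R[i] := \sum_i randers_b c z i * eta 0 i.

Definition randers_finsler : finsler M :=
  Finsler (fun c z eta => randers_alpha c z eta
                          + ComplexField.Normc.normc (randers_beta c z eta))
          (fun c => [set x | coord_dom c x.1 /\ randers_beta c x.1 x.2 != 0]).

End Navigation.

(* Main.v *)
(* Write A, S for the squares of alpha, |beta|. Then F^2 = (sqrt A + sqrt S)^2,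
   where S is the degenerate Hermitian form with matrix b_i conj(b_j), and
   h = eps (A - S). All derived objects have lowered expressions in L = F^2:
     g_{i mbar} 2 G^i = eta^j d_j (d_{eta-bar m} L),
     conj (g_{i mbar} theta^i)
       = d_m L - eta^j d_j (d_{eta m} L) + 2 G^p d_{eta p} d_{eta m} L.
   Evaluating the projective relation at eta and at i eta separates the spray
   from theta, so that each of them changes by a multiple of eta. For the pair
   (a, F), contracting with a vector k in the kernel of S (there is one since
   n >= 2) gives an identity V a(eta, k) = 2 (A + sqrt A sqrt S) K with V and K
   polynomial in eta and its conjugate. Along the real line eta + u k, S is
   constant and A is a quadratic polynomial without real roots, so sqrt A is
   irrational and V = K = 0. Hence a and F have the same spray and theta, and S
   satisfies the same lowered equations as A; so does A - S, which gives
   everything for h when eps is constant. Otherwise theta of h contains the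
   extra term d_m eps (A - S), proportional to the lowering of eta for every
   eta only if d eps = 0. *)

Require Import Defs.
From HB Require Import structures.
From mathcomp Require Import all_boot all_order all_algebra.
From mathcomp Require Import complex.
From mathcomp Require Import all_classical all_reals all_analysis.
From mathcomp Require Import ring lra.
Import numFieldNormedType.Exports.
Set Implicit Arguments.
Unset Strict Implicit.
Unset Printing Implicit Defensive.
Import Order.TTheory GRing.Theory Num.Theory.
Local Open Scope classical_set_scope.
Local Open Scope complex_scope.
Local Open Scope ring_scope.

(** * Real directional derivatives *)

(** The factor of [eta] that the projective relation supplies is an arbitrary function of the point,
    and nothing is known about its variation along eta + u k. It is therefore determined by the
    contraction with [eta] or its conjugate and eliminated; what remains is polynomial, because
    spray and theta of the Hermitian metric [a] are polynomial in [eta] and its conjugate at fixed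
    [z]. Theta has to come after the spray: its lowered equation contains the spray through the
    holomorphic Hessian of L, and it splits into the data of [a] and of |beta|^2 only once the spray
    equation of |beta|^2 is known. The inverse of g is never computed. Each object is characterised
    by an equation lowered with g, and the invertibility of g, a consequence of Cauchy-Schwarz,
    leads back to the object. One calculus serves all three metrics, since a Hermitian norm is a sum
    of two equal roots. The curvature formula is then algebra: the three metrics share the conj z
    derivatives of their sprays and differ only in how they lower [eta]. *)

Section ComplexReIm.
Variable R : realType.
Local Notation Re := (@complex.Re R).
Local Notation Im := (@complex.Im R).
Implicit Types x y : R[i].

Lemma cReD x y : Re (x + y) = Re x + Re y.
Proof. by case: x; case: y. Qed.
Lemma cImD x y : Im (x + y) = Im x + Im y.
Proof. by case: x; case: y. Qed.
Lemma cReM x y : Re (x * y)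
  = Re x * Re y - Im x * Im y.
Proof. by case: x; case: y. Qed.
Lemma cImM x y : Im (x * y)
  = Re x * Im y + Im x * Re y.
Proof. by case: x; case: y. Qed.
Lemma cReMl (t : R) x : Re (t%:C * x) = t * Re x.
Proof. by rewrite cReM /= mul0r subr0. Qed.
Lemma cImMl (t : R) x : Im (t%:C * x) = t * Im x.
Proof. by rewrite cImM /= mul0r addr0. Qed.
Lemma cRe_conj x : Re x^* = Re x.
Proof. by case: x. Qed.
Lemma cIm_conj x : Im x^* = - Im x.
Proof. by case: x. Qed.
Lemma complex_ext x y :
  Re x = Re y -> Im x = Im y -> x = y.
Proof. by case: x; case: y => /= ? ? ? ? -> ->. Qed.
Lemma RRe_real0 x : Im x = 0 -> (Re x)%:C = x.
Proof. by move=> h; apply: complex_ext. Qed.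
Lemma cRe_i : Re ('i : R[i]) = 0.
Proof. by []. Qed.
Lemma cIm_i : Im ('i : R[i]) = 1.
Proof. by []. Qed.
Lemma conj_i : ('i : R[i])^* = - 'i.
Proof. exact: conjCi. Qed.
Lemma conjM x y : (x * y)^* = x^* * y^*.
Proof. exact: rmorphM. Qed.
Lemma conjD x y : (x + y)^* = x^* + y^*.
Proof. exact: rmorphD. Qed.
Lemma conjB x y : (x - y)^* = x^* - y^*.
Proof. exact: rmorphB. Qed.
Lemma conjN x : (- x)^* = - x^*.
Proof. exact: rmorphN. Qed.
Lemma conjV x : (x^-1)^* = (x^*)^-1.
Proof. exact: fmorphV. Qed.
Lemma conjX x m : (x ^+ m)^* = x^* ^+ m.
Proof. exact: rmorphXn. Qed.
Lemma conj_nat m : (m%:R : R[i])^* = m%:R.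
Proof. exact: rmorph_nat. Qed.
Lemma conj_sum (I : Type) (s : seq I) (F : I -> R[i]) :
  (\sum_(i <- s) F i)^* = \sum_(i <- s) (F i)^*.
Proof. exact: rmorph_sum. Qed.
Lemma conj_conj x : x^*^* = x.
Proof. exact: conjCK. Qed.
Lemma conj_real (r : R) : (r%:C)^* = r%:C.
Proof. exact: conjc_real. Qed.
End ComplexReIm.

Section DirectionalDerivative.
Variables (R : realType) (V : normedModType R[i]).
Local Notation Re := (@complex.Re R).
Local Notation Im := (@complex.Im R).
Implicit Types (f g : V -> R[i]) (v x : V) (d e : R[i]).

(** Existence and value are bundled, because [rderive] has a value even where the derivative does
    not exist. *)
Definition is_rd f v x d : Prop :=
  is_derive (0 : R) (1 : R) (fun t : R => Re (f (x + t%:C *: v)) : R^o)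
    (Re d) /\
  is_derive (0 : R) (1 : R) (fun t : R => Im (f (x + t%:C *: v)) : R^o)
    (Im d).

Lemma is_rd_rderive f v x d : is_rd f v x d -> rderive f v x = d.
Proof.
by case=> [[_ h1] [_ h2]]; rewrite /rderive !derive1E h1 h2; case: (d).
Qed.

Lemma is_rd_rderivable f v x d : is_rd f v x d -> rderivable f v x.
Proof. by case=> [[h1 _] [h2 _]]. Qed.

Lemma rderivable_is_rd f v x : rderivable f v x -> is_rd f v x (rderive f v x).
Proof.
by case=> h1 h2; split; rewrite /rderive /= derive1E; apply: DeriveDef.
Qed.

(** Locality on the real line through [x] along [v], which is all that a directional derivative can
    see. *)
Definition near_dir v x (P : V -> Prop) : Prop :=
  \forall t \near (0 : R), P (x + t%:C *: v).

Lemma near_dirW v x (P : V -> Prop) : (forall y, P y) -> near_dir v x P.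
Proof. by move=> h; near=> t; exact: h. Unshelve. all: by end_near. Qed.

Lemma is_rd_near f g v x d :
  near_dir v x (fun y => f y = g y) -> is_rd f v x d -> is_rd g v x d.
Proof.
move=> fg [[h1 e1] [h2 e2]]; split; split.
- by apply: near_eq_derivable h1; near=> t; congr Re; near: t.
- by rewrite -e1; apply: near_eq_derive; near=> t; congr Re; apply/esym; near: t.
- by apply: near_eq_derivable h2; near=> t; congr Im; near: t.
- by rewrite -e2; apply: near_eq_derive; near=> t; congr Im; apply/esym; near: t.
Unshelve. all: by end_near. Qed.

Lemma rderive_near f g v x :
  near_dir v x (fun y => f y = g y) -> rderive f v x = rderive g v x.
Proof.
move=> fg; rewrite /rderive !derive1E; congr (_ +i* _); apply: near_eq_derive;
  near=> t; [congr Re | congr Im]; near: t; exact: fg.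
Unshelve. all: by end_near. Qed.

Lemma is_rd_eq f v x d e : is_rd f v x d -> d = e -> is_rd f v x e.
Proof. by move=> h <-. Qed.

Lemma is_rd_cst d v x : is_rd (fun _ => d) v x 0.
Proof. by split; apply: is_derive_cst. Qed.

Lemma is_rdD f g v x d e :
  is_rd f v x d -> is_rd g v x e -> is_rd (fun y => f y + g y) v x (d + e).
Proof.
move=> [f1 f2] [g1 g2]; split.
- by rewrite cReD; under eq_fun do rewrite cReD; apply: is_deriveD.
- by rewrite cImD; under eq_fun do rewrite cImD; apply: is_deriveD.
Qed.

Lemma is_rdM f g v x d e :
  is_rd f v x d -> is_rd g v x e ->
  is_rd (fun y => f y * g y) v x (d * g x + f x * e).
Proof.
have x0 : x + (0 : R)%:C *: v = x by rewrite scale0r addr0.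
move=> [f1 f2] [g1 g2]; split.
- under eq_fun do rewrite cReM.
  apply: (is_derive_eq (is_deriveB (is_deriveM f1 g1) (is_deriveM f2 g2))).
  by rewrite !x0 cReD !cReM /GRing.scale /=; ring.
- under eq_fun do rewrite cImM.
  apply: (is_derive_eq (is_deriveD (is_deriveM f1 g2) (is_deriveM f2 g1))).
  by rewrite !x0 cImD !cImM /GRing.scale /=; ring.
Qed.

Lemma is_rd_conj f v x d : is_rd f v x d -> is_rd (fun y => (f y)^*) v x d^*.
Proof.
move=> [f1 f2]; split.
- by rewrite cRe_conj; under eq_fun do rewrite cRe_conj.
- by rewrite cIm_conj; under eq_fun do rewrite cIm_conj; apply: is_deriveN.
Qed.

Lemma is_rd_continuous f v x d : is_rd f v x d -> f x != 0 ->
  near_dir v x (fun y => f y != 0).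
Proof.
move=> [[h1 _] [h2 _]] fx0.
have x0 : x + (0 : R)%:C *: v = x by rewrite scale0r addr0.
have c1 := differentiable_continuous (iffLR (derivable1_diffP _ _) h1).
have c2 := differentiable_continuous (iffLR (derivable1_diffP _ _) h2).
have [r0|r0] := eqVneq (Re (f x)) 0.
  have i0 : Im (f x) != 0.
    by apply: contraNneq fx0 => i0; apply/eqP/complex_ext.
  have : \forall t \near (0:R), Im (f (x + t%:C *: v)) != 0.
    apply: (cvgr_neq0 (F := nbhs (0:R)) _ c2); by rewrite x0.
  by apply: filterS => t; apply: contraNneq => ->.
have : \forall t \near (0:R), Re (f (x + t%:C *: v)) != 0.
  apply: (cvgr_neq0 (F := nbhs (0:R)) _ c1); by rewrite x0.
by apply: filterS => t; apply: contraNneq => ->.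
Qed.

Lemma is_rd_sqrt f v x d : is_rd f v x d -> 0 < Re (f x) ->
  is_rd (fun y => (Num.sqrt (Re (f y)))%:C) v x
    (Re d / (2 * Num.sqrt (Re (f x))))%:C.
Proof.
have x0 : x + (0 : R)%:C *: v = x by rewrite scale0r addr0.
move=> [f1 f2] fx; split => /=; last exact: is_derive_cst.
have h := @is_derive1_sqrt R (Re (f (x + (0:R)%:C *: v))).
rewrite x0 in h; have {}h := h fx.
have h' : is_derive (Re (f (x + (0:R)%:C *: v))) 1 Num.sqrt
  (2 * Num.sqrt (Re (f x)))^-1 by rewrite x0.
apply: (is_derive_eq (is_derive1_comp h' f1)).
by rewrite /GRing.scale /= mulrC.
Qed.

Lemma is_rd_realV f v x d : is_rd f v x d -> Re (f x) != 0 ->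
  is_rd (fun y => (Re (f y))^-1%:C) v x
    (- Re d / Re (f x) ^+ 2)%:C.
Proof.
have x0 : x + (0 : R)%:C *: v = x by rewrite scale0r addr0.
move=> [f1 f2] fx; split => /=; last exact: is_derive_cst.
have := @is_deriveV R (fun t : R => Re (f (x + t%:C *: v))) 0 _ 1 _ f1.
rewrite x0 => /(_ fx) h; apply: (is_derive_eq h).
by rewrite /GRing.scale /= mulNr mulNr mulrC.
Qed.

(** Reduces complex inversion to conjugation, product and the inverse of a real function; at 0 both
    sides are 0. *)
Lemma invcE (z : R[i]) : z^-1 = z^* * (Re (z * z^*))^-1%:C.
Proof.
have -> : Re (z * z^*) = Re z ^+ 2 + Im z ^+ 2.
  by rewrite cReM cRe_conj cIm_conj; ring.
case: z => a b; apply: complex_ext; [rewrite cReM | rewrite cImM];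
  rewrite cRe_conj cIm_conj /=; ring.
Qed.

Lemma is_rdV f v x d : is_rd f v x d -> f x != 0 ->
  is_rd (fun y => (f y)^-1) v x (- d / f x ^+ 2).
Proof.
move=> fd fx0.
have N0 : Re (f x * (f x)^*) != 0.
  have : f x * (f x)^* != 0 by rewrite mulf_neq0 // conjC_eq0.
  by apply: contraNneq => h; apply/eqP/complex_ext; [rewrite h | rewrite cImM cRe_conj cIm_conj /=; ring].
have e : forall y, (f y)^-1 = (f y)^* * (Re (f y * (f y)^*))^-1%:C.
  by move=> y; exact: invcE.
under eq_fun do rewrite e.
have cfd := is_rd_conj fd.
have /is_rdM/(_ (is_rd_realV (is_rdM fd cfd) N0)) := cfd.
suff -> : d^* * (Re (f x * (f x)^*))^-1%:C +
  (f x)^* * (- Re (d * (f x)^* + f x * d^*) / Re (f x * (f x)^*) ^+ 2)%:C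
  = - d / f x ^+ 2 by [].
have rN : (Re (f x * (f x)^*))%:C = f x * (f x)^*.
  by apply: RRe_real0; rewrite cImM cRe_conj cIm_conj; ring.
have rM : (Re (d * (f x)^* + f x * d^*))%:C = d * (f x)^* + f x * d^*.
  by apply: RRe_real0; rewrite cImD !cImM !cRe_conj !cIm_conj; ring.
rewrite !rmorphM !fmorphV /= rmorphN rmorphXn /= rN rM.
have cx0 : (f x)^* != 0 by rewrite conjC_eq0.
by field; rewrite cx0 fx0.
Qed.

End DirectionalDerivative.

(** * Wirtinger derivatives *)

Section WirtingerCalculus.
Variables (R : realType) (n : nat).
Local Notation C := R[i].
Local Notation Cn := 'rV[C]_n.
Local Notation Re := (@complex.Re R).
Local Notation Im := (@complex.Im R).
Implicit Types (f g : Cn -> C) (x : Cn) (k : 'I_n) (p q : C).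

(* [f] is differentiable in the real sense along the [k]-th coordinate plane,
   with [p] and [q] its derivatives in z^k and conj z^k. *)
Definition wirt k f x p q : Prop :=
  is_rd f (delta_mx 0 k) x (p + q) /\
  is_rd f ('i *: delta_mx 0 k) x ('i * (p - q)).

Definition near_coord k x (P : Cn -> Prop) : Prop :=
  near_dir (delta_mx 0 k) x P /\ near_dir ('i *: delta_mx 0 k) x P.

(** A statement of existence only: the values match by the definitions of [dz] and [dzbar]. *)
Definition wdiff k f x : Prop := wirt k f x (dz k f x) (dzbar k f x).

Lemma near_coordW k x (P : Cn -> Prop) : (forall y, P y) -> near_coord k x P.
Proof. by move=> h; split; exact: near_dirW. Qed.

Lemma near_coord_and k x (P Q : Cn -> Prop) :
  near_coord k x P -> near_coord k x Q -> near_coord k x (fun y => P y /\ Q y).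
Proof. by move=> [p1 p2] [q1 q2]; split; apply: filterS2 p1 q1 || apply: filterS2 p2 q2. Qed.

Lemma near_coordS k x (P Q : Cn -> Prop) :
  (forall y, P y -> Q y) -> near_coord k x P -> near_coord k x Q.
Proof. by move=> h [p1 p2]; split; [apply: filterS p1 | apply: filterS p2] => t; exact: h. Qed.

Lemma mul_ii : 'i * 'i = -1 :> C.
Proof. by rewrite -expr2 sqrCi. Qed.

Lemma wirt_dz k f x p q : wirt k f x p q -> dz k f x = p.
Proof.
move=> [/is_rd_rderive h1 /is_rd_rderive h2]; rewrite /dz h1 h2 mulrA mul_ii.
by field.
Qed.

Lemma wirt_dzbar k f x p q : wirt k f x p q -> dzbar k f x = q.
Proof.
move=> [/is_rd_rderive h1 /is_rd_rderive h2]; rewrite /dzbar h1 h2 mulrA mul_ii.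
by field.
Qed.

Lemma wirt_wdiff k f x p q : wirt k f x p q -> wdiff k f x.
Proof. by move=> h; rewrite /wdiff (wirt_dz h) (wirt_dzbar h). Qed.

Lemma rderivable_wdiff k f x : (forall v, rderivable f v x) -> wdiff k f x.
Proof.
move=> h; rewrite /wdiff /dz /dzbar.
set r1 := rderive f _ x; set r2 := rderive f _ x.
split.
  by rewrite (_ : _ + _ = r1); [exact: rderivable_is_rd | field].
rewrite (_ : _ * _ = r2); first exact: rderivable_is_rd.
transitivity (- ('i * 'i) * r2); first by field.
by rewrite mul_ii; ring.
Qed.

Lemma wirt_near k f g x p q :
  near_coord k x (fun y => f y = g y) -> wirt k f x p q -> wirt k g x p q.
Proof. by move=> [n1 n2] [h1 h2]; split; [exact: is_rd_near n1 h1|exact: is_rd_near n2 h2]. Qed.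

Lemma wirt_ext k f g x p q : f =1 g -> wirt k f x p q -> wirt k g x p q.
Proof. by move=> fg; apply: wirt_near; exact: near_coordW. Qed.

Lemma dz_near k f g x : near_coord k x (fun y => f y = g y) -> dz k f x = dz k g x.
Proof. by move=> [n1 n2]; rewrite /dz (rderive_near n1) (rderive_near n2). Qed.

Lemma dzbar_near k f g x :
  near_coord k x (fun y => f y = g y) -> dzbar k f x = dzbar k g x.
Proof. by move=> [n1 n2]; rewrite /dzbar (rderive_near n1) (rderive_near n2). Qed.

Lemma wirt_eq k f x p q p' q' :
  wirt k f x p q -> p = p' -> q = q' -> wirt k f x p' q'.
Proof. by move=> h <- <-. Qed.

Lemma wirt_cst k x p : wirt k (fun _ => p) x 0 0.
Proof. by split; rewrite ?subr0 ?addr0 ?mulr0; exact: is_rd_cst. Qed.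

Lemma wirtD k f g x p q p' q' : wirt k f x p q -> wirt k g x p' q' ->
  wirt k (fun y => f y + g y) x (p + p') (q + q').
Proof.
move=> [f1 f2] [g1 g2]; split.
  by rewrite addrACA; exact: is_rdD.
by rewrite opprD addrACA mulrDr; exact: is_rdD.
Qed.

Lemma wirtM k f g x p q p' q' : wirt k f x p q -> wirt k g x p' q' ->
  wirt k (fun y => f y * g y) x (p * g x + f x * p') (q * g x + f x * q').
Proof.
move=> [f1 f2] [g1 g2]; split.
  by apply: is_rd_eq (is_rdM f1 g1) _; ring.
by apply: is_rd_eq (is_rdM f2 g2) _; ring.
Qed.

Lemma wirtZ k f x c p q : wirt k f x p q ->
  wirt k (fun y => c * f y) x (c * p) (c * q).
Proof.
move=> h; apply: wirt_eq (wirtM (wirt_cst k x c) h) _ _; by rewrite mul0r add0r.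
Qed.

Lemma wirtZr k f x c p q : wirt k f x p q ->
  wirt k (fun y => f y * c) x (p * c) (q * c).
Proof.
move=> h; apply: wirt_eq (wirtM h (wirt_cst k x c)) _ _; by rewrite mulr0 addr0.
Qed.

Lemma wirtN k f x p q : wirt k f x p q ->
  wirt k (fun y => - f y) x (- p) (- q).
Proof.
move=> /(wirtZ (-1)); rewrite !mulN1r; apply: wirt_ext => y; exact: mulN1r.
Qed.

Lemma wirt_conj k f x p q : wirt k f x p q ->
  wirt k (fun y => (f y)^*) x q^* p^*.
Proof.
move=> [f1 f2]; split.
  by rewrite -rmorphD addrC; exact: is_rd_conj.
by apply: is_rd_eq (is_rd_conj f2) _; rewrite conjM conjB conj_i; ring.
Qed.

Lemma wirt_sum (I : Type) (s : seq I) k (f : I -> Cn -> C) x (p q : I -> C) :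
  (forall i, wirt k (f i) x (p i) (q i)) ->
  wirt k (fun y => \sum_(i <- s) f i y) x (\sum_(i <- s) p i) (\sum_(i <- s) q i).
Proof.
move=> h; elim: s => [|i s IH].
  by rewrite !big_nil; apply: wirt_ext (wirt_cst k x 0) => y; rewrite big_nil.
by rewrite !big_cons; apply: wirt_ext (wirtD (h i) IH) => y; rewrite big_cons.
Qed.

Lemma wirtV k f x p q : wirt k f x p q -> f x != 0 ->
  wirt k (fun y => (f y)^-1) x (- p / f x ^+ 2) (- q / f x ^+ 2).
Proof.
move=> [f1 f2] f0; split.
  by apply: is_rd_eq (is_rdV f1 f0) _; field.
by apply: is_rd_eq (is_rdV f2 f0) _; field.
Qed.

Lemma wirt_coord k x j : wirt k (fun y => y 0 j) x (k == j)%:R 0.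
Proof.
have ent v (t : R) : (x + t%:C *: v) 0 j = x 0 j + t%:C * v 0 j :> C.
  by rewrite !mxE.
have affine (a b : R) : is_derive (0 : R) (1 : R) (fun t : R => a + t * b : R^o) b.
  have h := is_deriveD (is_derive_cst (a : R^o) (0 : R) (1 : R))
    (is_deriveM (is_derive_id (0 : R) (1 : R)) (is_derive_cst (b : R^o) (0 : R) (1 : R))).
  by apply: (is_derive_eq h); rewrite /GRing.scale /= mulr0 mulr1 !add0r.
have lin v : is_rd (fun y : Cn => y 0 j) v x (v 0 j).
  split.
    have -> : (fun t : R => Re ((x + t%:C *: v) 0 j)) =
        (fun t : R => Re (x 0 j) + t * Re (v 0 j)).
      by apply/funext => t; rewrite ent cReD cReMl.
    exact: affine.
  have -> : (fun t : R => Im ((x + t%:C *: v) 0 j)) =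
      (fun t : R => Im (x 0 j) + t * Im (v 0 j)).
    by apply/funext => t; rewrite ent cImD cImMl.
  exact: affine.
split.
  have := lin (delta_mx 0 k); by rewrite mxE eqxx addr0 eq_sym.
have := lin ('i *: delta_mx 0 k); by rewrite !mxE eqxx subr0 eq_sym.
Qed.

Lemma wdiff_neq0 k f x : wdiff k f x -> f x != 0 ->
  near_coord k x (fun y => f y != 0).
Proof.
by move=> [h1 h2] f0; split; [exact: is_rd_continuous h1 f0|exact: is_rd_continuous h2 f0].
Qed.

(* The square root of a positive real number, seen in [R[i]]. *)
Definition rsqrt (z : C) : C := (Num.sqrt (Re z))%:C.

Lemma wirt_rsqrt k f x p q : wirt k f x p q ->
  near_coord k x (fun y => Im (f y) = 0) -> 0 < f x ->
  wirt k (fun y => rsqrt (f y)) x (p / (2 * rsqrt (f x))) (q / (2 * rsqrt (f x))).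
Proof.
move=> [f1 f2] [n1 n2]; rewrite ltcE /= => /andP[_ fx].
(* [rsqrt] only sees the real part of [f]; since [f] is real along the line, its derivative there is
   real, so nothing is lost. *)
have real v d : is_rd f v x d -> near_dir v x (fun y => Im (f y) = 0) ->
    (Re d)%:C = d.
  move=> fd nv; apply: RRe_real0.
  case: (fd) => _ [_ <-].
  rewrite (@near_eq_derive _ _ _ _ (cst 0)); last by near=> t; near: t.
  exact: derive_cst.
have r1 := real _ _ f1 n1; have r2 := real _ _ f2 n2.
have e (d : C) : (Re d)%:C = d ->
  (Re d / (2 * Num.sqrt (Re (f x))))%:C = d / (2 * rsqrt (f x)).
  by move=> dr; rewrite -[in RHS]dr !rmorphM fmorphV !rmorphM /= rmorph_nat.
split.
  by rewrite -mulrDl -e //; exact: is_rd_sqrt.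
by rewrite -mulrBl mulrA -e //; exact: is_rd_sqrt.
Unshelve. all: by end_near. Qed.

End WirtingerCalculus.

(** * Square norms of the form (sqrt A + sqrt S)^2 *)

Section DifferentiabilityClosure.
Variables (R : realType) (n : nat).
Local Notation C := R[i].
Local Notation Cn := 'rV[C]_n.
Implicit Types (f g : Cn -> C) (x : Cn) (k : 'I_n).

Lemma wdiff_cst k x (e : C) : wdiff k (fun _ => e) x.
Proof. exact: wirt_wdiff (wirt_cst _ _ _). Qed.

Lemma wdiffD k f g x : wdiff k f x -> wdiff k g x -> wdiff k (fun y => f y + g y) x.
Proof. by move=> hf hg; exact: wirt_wdiff (wirtD hf hg). Qed.

Lemma wdiffM k f g x : wdiff k f x -> wdiff k g x -> wdiff k (fun y => f y * g y) x.
Proof. by move=> hf hg; exact: wirt_wdiff (wirtM hf hg). Qed.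

Lemma wdiffN k f x : wdiff k f x -> wdiff k (fun y => - f y) x.
Proof. by move=> hf; exact: wirt_wdiff (wirtN hf). Qed.

Lemma wdiff_conj k f x : wdiff k f x -> wdiff k (fun y => (f y)^*) x.
Proof. by move=> hf; exact: wirt_wdiff (wirt_conj hf). Qed.

Lemma wdiffV k f x : wdiff k f x -> f x != 0 -> wdiff k (fun y => (f y)^-1) x.
Proof. by move=> hf f0; exact: wirt_wdiff (wirtV hf f0). Qed.

Lemma wdiffX k f x m : wdiff k f x -> wdiff k (fun y => f y ^+ m) x.
Proof.
move=> hf; elim: m => [|m IH]; first exact: wdiff_cst.
by under eq_fun do rewrite exprS; exact: wdiffM.
Qed.

Lemma wdiff_sum (I : Type) (s : seq I) k (f : I -> Cn -> C) x :
  (forall i, wdiff k (f i) x) -> wdiff k (fun y => \sum_(i <- s) f i y) x.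
Proof.
by move=> h; apply: wirt_wdiff (wirt_sum s (p := fun i => dz k (f i) x)
  (q := fun i => dzbar k (f i) x) h).
Qed.

Lemma wdiff_prod (I : Type) (s : seq I) k (f : I -> Cn -> C) x :
  (forall i, wdiff k (f i) x) -> wdiff k (fun y => \prod_(i <- s) f i y) x.
Proof.
move=> h; elim: s => [|i s IH].
  by under eq_fun do rewrite big_nil; exact: wdiff_cst.
by under eq_fun do rewrite big_cons; exact: wdiffM.
Qed.

Lemma wdiff_near k f g x :
  near_coord k x (fun y => f y = g y) -> wdiff k f x -> wdiff k g x.
Proof. by move=> nfg hf; exact: wirt_wdiff (wirt_near nfg hf). Qed.

Lemma wdiff_det m k (B : Cn -> 'M[C]_m) x :
  (forall i j, wdiff k (fun y => B y i j) x) -> wdiff k (fun y => \det (B y)) x.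
Proof.
move=> h; apply: wdiff_sum => s; apply: wdiffM; first exact: wdiff_cst.
by apply: wdiff_prod => i; exact: h.
Qed.

(** Cramer's rule near [x], where the determinant stays nonzero; on singular matrices [invmx]
    returns its argument, so the formula is used locally. *)
Lemma wdiff_invmx m k (B : Cn -> 'M[C]_m) x :
  (forall i j, wdiff k (fun y => B y i j) x) -> B x \in unitmx ->
  forall i j, wdiff k (fun y => invmx (B y) i j) x.
Proof.
move=> h; rewrite unitmxE unitfE => u i j.
apply: (@wdiff_near k (fun y => (\det (B y))^-1 * cofactor (B y) j i)).
  apply: near_coordS (wdiff_neq0 (wdiff_det h) u) => y d0.
  by rewrite /invmx unitmxE unitfE d0 !mxE.
apply: wdiffM; first exact: wdiffV (wdiff_det h) u.
apply: wdiffM; first exact: wdiff_cst.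
apply: wdiff_det => i' j'.
rewrite (_ : (fun y => _) = fun y => B y (lift j i') (lift i j')); first exact: h.
by apply/funext => y; rewrite !mxE.
Qed.

End DifferentiabilityClosure.

(** * First and second derivatives of (sqrt A + sqrt S)^2 *)

Section SumOfRoots.
Variable R : realType.
Local Notation C := R[i].
Local Notation Re := (@complex.Re R).
Local Notation Im := (@complex.Im R).
Implicit Types A S l m : C.

Lemma rsqrt_gt0 A : 0 < A -> 0 < rsqrt A.
Proof. by rewrite ltcE /= => /andP[_ A0]; rewrite ltcR sqrtr_gt0. Qed.

Lemma rsqrt_neq0 A : 0 < A -> rsqrt A != 0.
Proof. by move=> /rsqrt_gt0; exact: lt0r_neq0. Qed.

Lemma rsqrt_sqr A : 0 <= A -> rsqrt A ^+ 2 = A.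
Proof.
rewrite lecE => /= /andP[/eqP iA A0].
by rewrite -rmorphXn /= sqr_sqrtr //; apply: RRe_real0.
Qed.

Lemma conj_rsqrt A : (rsqrt A)^* = rsqrt A.
Proof. exact: conj_real. Qed.

(* If [l] and [m] are the derivatives of [A] and [S] along some direction, [gl]
   is that of (sqrt A + sqrt S)^2; [dgl] is the derivative of [gl] when its
   arguments have derivatives [A1], [S1], [l1], [m1]. *)
Definition gl A S l m : C := (rsqrt A + rsqrt S) * (l / rsqrt A + m / rsqrt S).

Definition dgl A S l m A1 S1 l1 m1 : C :=
  (A1 / (2 * rsqrt A) + S1 / (2 * rsqrt S)) * (l / rsqrt A + m / rsqrt S)
  + (rsqrt A + rsqrt S) * (l1 / rsqrt A - l * A1 / (2 * rsqrt A ^+ 3)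
                        + (m1 / rsqrt S - m * S1 / (2 * rsqrt S ^+ 3))).

Lemma glD A S l m l' m' : gl A S (l + l') (m + m') = gl A S l m + gl A S l' m'.
Proof. by rewrite /gl; ring. Qed.
Lemma glZ A S l m e : gl A S (e * l) (e * m) = e * gl A S l m.
Proof. by rewrite /gl; ring. Qed.
Lemma gl0 A S : gl A S 0 0 = 0.
Proof. by rewrite /gl; ring. Qed.

Lemma conj_gl A S l m : (gl A S l m)^* = gl A S l^* m^*.
Proof. by rewrite conjM !conjD !conjM !conjV !conj_rsqrt. Qed.

Lemma conj_dgl A S l m A1 S1 l1 m1 :
  (dgl A S l m A1 S1 l1 m1)^* = dgl A S l^* m^* A1^* S1^* l1^* m1^*.
Proof.
by rewrite /dgl !(conjM, conjD, conjB, conjV, conj_rsqrt, conjN, conjX, conj_nat).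
Qed.

Lemma gl_sum (I : Type) (r : seq I) A S (e l m : I -> C) :
  \sum_(i <- r) e i * gl A S (l i) (m i) =
  gl A S (\sum_(i <- r) e i * l i) (\sum_(i <- r) e i * m i).
Proof.
elim: r => [|i r IH]; first by rewrite !big_nil gl0.
by rewrite !big_cons IH -glZ -glD.
Qed.

Lemma dgl_sum (I : Type) (r : seq I) A S l m (e A1 S1 l1 m1 : I -> C) :
  \sum_(i <- r) e i * dgl A S l m (A1 i) (S1 i) (l1 i) (m1 i) =
  dgl A S l m (\sum_(i <- r) e i * A1 i) (\sum_(i <- r) e i * S1 i)
    (\sum_(i <- r) e i * l1 i) (\sum_(i <- r) e i * m1 i).
Proof.
elim: r => [|i r IH]; first by rewrite !big_nil /dgl; ring.
by rewrite !big_cons IH /dgl; ring.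
Qed.

Lemma dgl_suml (I : Type) (r : seq I) A S A1 S1 (e l m l1 m1 : I -> C) :
  \sum_(i <- r) e i * dgl A S (l i) (m i) A1 S1 (l1 i) (m1 i) =
  dgl A S (\sum_(i <- r) e i * l i) (\sum_(i <- r) e i * m i) A1 S1
    (\sum_(i <- r) e i * l1 i) (\sum_(i <- r) e i * m1 i).
Proof.
elim: r => [|i r IH]; first by rewrite !big_nil /dgl; ring.
by rewrite !big_cons IH /dgl; ring.
Qed.

(** Symmetry of second derivatives. *)
Lemma dgl_sym A S l m A1 S1 l1 m1 :
  dgl A S l m A1 S1 l1 m1 = dgl A S A1 S1 l m l1 m1.
Proof. by rewrite /dgl !invfM; ring. Qed.

Section Positive.
Variables A S : C.
Hypotheses (A0 : 0 < A) (S0 : 0 < S).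

Let al0 := rsqrt_neq0 A0.
Let s0 := rsqrt_neq0 S0.
Let alK : A = rsqrt A ^+ 2. Proof. by rewrite rsqrt_sqr // ltW. Qed.
Let sK : S = rsqrt S ^+ 2. Proof. by rewrite rsqrt_sqr // ltW. Qed.

Lemma gl_euler : gl A S A S = (rsqrt A + rsqrt S) ^+ 2.
Proof.
rewrite /gl {2}alK {2}sK; move: al0 s0; set x := rsqrt A; set y := rsqrt S => x0 y0.
by field; rewrite x0 y0.
Qed.

(** Euler's relations for L = (sqrt A + sqrt S)^2, of bidegree (1, 1): the derivative of L in conj
    eta has degree 1 in [eta]. In [dgl_euler_anti] the derivative in [eta] has degree 0 in [eta],
    and [dgl_euler_form] is [gl_euler] differentiated. *)
Lemma dgl_euler_hol l m : dgl A S l m A S l m = gl A S l m.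
Proof.
rewrite /gl /dgl; move: al0 s0 alK sK; move: (rsqrt A) (rsqrt S) => x y x0 y0 -> ->.
by field; rewrite x0 y0.
Qed.

Lemma dgl_euler_anti l m : dgl A S l m A S 0 0 = 0.
Proof.
rewrite /dgl; move: al0 s0 alK sK; move: (rsqrt A) (rsqrt S) => x y x0 y0 -> ->.
by field; rewrite x0 y0.
Qed.

Lemma dgl_euler_form l1 m1 : dgl A S A S l1 m1 l1 m1 = gl A S l1 m1.
Proof.
rewrite /gl /dgl; move: al0 s0 alK sK; move: (rsqrt A) (rsqrt S) => x y x0 y0 -> ->.
by field; rewrite x0 y0.
Qed.

End Positive.

Variable n : nat.
Local Notation Cn := 'rV[C]_n.

Section Derivative.
Variables (k : 'I_n) (x : Cn) (f g : Cn -> C) (p q p' q' : C).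
Hypotheses (fd : wirt k f x p q) (gd : wirt k g x p' q').
Hypotheses (f_real : near_coord k x (fun y => Im (f y) = 0))
           (g_real : near_coord k x (fun y => Im (g y) = 0)).
Hypotheses (f0 : 0 < f x) (g0 : 0 < g x).

Let wf := wirt_rsqrt fd f_real f0.
Let wg := wirt_rsqrt gd g_real g0.
Let al0 := rsqrt_neq0 f0.
Let s0 := rsqrt_neq0 g0.

Lemma wirt_sum_rsqrt_sqr :
  wirt k (fun y => (rsqrt (f y) + rsqrt (g y)) ^+ 2) x
    (gl (f x) (g x) p p') (gl (f x) (g x) q q').
Proof.
apply: wirt_eq (wirtM (wirtD wf wg) (wirtD wf wg)) _ _;
  move: al0 s0; rewrite /gl; set u := rsqrt (f x); set v := rsqrt (g x) => u0 v0;
  by field; rewrite u0 v0.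
Qed.

Lemma wirt_gl (l m : Cn -> C) l1 l2 m1 m2 :
  wirt k l x l1 l2 -> wirt k m x m1 m2 ->
  wirt k (fun y => gl (f y) (g y) (l y) (m y)) x
    (dgl (f x) (g x) (l x) (m x) p p' l1 m1)
    (dgl (f x) (g x) (l x) (m x) q q' l2 m2).
Proof.
move=> ld md.
apply: wirt_eq (wirtM (wirtD wf wg) (wirtD (wirtM ld (wirtV wf al0))
  (wirtM md (wirtV wg s0)))) _ _;
  move: al0 s0; rewrite /dgl; set u := rsqrt (f x); set v := rsqrt (g x) => u0 v0;
  by field; rewrite u0 v0.
Qed.

Lemma wdiff_dgl (l m A1 S1 l1 m1 : Cn -> C) :
  wdiff k l x -> wdiff k m x -> wdiff k A1 x -> wdiff k S1 x ->
  wdiff k l1 x -> wdiff k m1 x ->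
  wdiff k (fun y => dgl (f y) (g y) (l y) (m y) (A1 y) (S1 y) (l1 y) (m1 y)) x.
Proof.
move=> hl hm hA hS hl1 hm1.
have hf := wirt_wdiff wf; have hg := wirt_wdiff wg.
have two : (2 : C) != 0 by rewrite pnatr_eq0.
have ia := wdiffV hf al0; have is_ := wdiffV hg s0.
have V2 (h : Cn -> C) : wdiff k h x -> h x != 0 -> wdiff k (fun y => (2 * h y)^-1) x.
  move=> hh h0; apply: (wdiffV (wdiffM (wdiff_cst k x 2) hh)).
  by rewrite mulf_neq0.
have i2a := V2 _ hf al0; have i2s := V2 _ hg s0.
have i3a := V2 _ (wdiffX 3 hf) (expf_neq0 3 al0).
have i3s := V2 _ (wdiffX 3 hg) (expf_neq0 3 s0).
exact: (wdiffD (wdiffM (wdiffD (wdiffM hA i2a) (wdiffM hS i2s))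
                 (wdiffD (wdiffM hl ia) (wdiffM hm is_)))
         (wdiffM (wdiffD hf hg)
           (wdiffD (wdiffD (wdiffM hl1 ia) (wdiffN (wdiffM (wdiffM hl hA) i3a)))
             (wdiffD (wdiffM hm1 is_) (wdiffN (wdiffM (wdiffM hm hS) i3s)))))).
Qed.

End Derivative.

End SumOfRoots.

(** * Hermitian forms *)

Section Forms.
Variables (R : realType) (n : nat).
Local Notation C := R[i].
Local Notation Cn := 'rV[C]_n.
Local Notation Re := (@complex.Re R).
Local Notation Im := (@complex.Im R).
Implicit Types (H : 'M[C]_n) (eta zeta x z : Cn) (i j k : 'I_n).

(** The derivative of the form at [eta] in [eta^i]; [lowr] is the one in the conjugate
    coordinate. *)
Definition lowl H eta i : C := \sum_j H i j * (eta 0 j)^*.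
Definition lowr H eta j : C := \sum_i H i j * eta 0 i.

Lemma hform_lowl H eta zeta : hform H eta zeta = \sum_i eta 0 i * lowl H zeta i.
Proof.
by apply: eq_bigr => i _; rewrite mulr_sumr; apply: eq_bigr => j _; ring.
Qed.

Lemma hform_lowr H eta zeta :
  hform H eta zeta = \sum_j (zeta 0 j)^* * lowr H eta j.
Proof.
rewrite /hform exchange_big; apply: eq_bigr => j _; rewrite mulr_sumr.
by apply: eq_bigr => i _; ring.
Qed.

Lemma hformDl H eta eta' zeta :
  hform H (eta + eta') zeta = hform H eta zeta + hform H eta' zeta.
Proof.
by rewrite !hform_lowl -big_split /=; apply: eq_bigr => i _; rewrite mxE; ring.
Qed.

Lemma hformZl H e eta zeta : hform H (e *: eta) zeta = e * hform H eta zeta.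
Proof.
by rewrite !hform_lowl mulr_sumr; apply: eq_bigr => i _; rewrite mxE; ring.
Qed.

Lemma hformDr H eta zeta zeta' :
  hform H eta (zeta + zeta') = hform H eta zeta + hform H eta zeta'.
Proof.
by rewrite !hform_lowr -big_split /=; apply: eq_bigr => i _; rewrite mxE conjD; ring.
Qed.

Lemma hformZr H e eta zeta : hform H eta (e *: zeta) = e^* * hform H eta zeta.
Proof.
by rewrite !hform_lowr mulr_sumr; apply: eq_bigr => i _; rewrite mxE conjM; ring.
Qed.

Lemma hformDm H H' eta zeta :
  hform (H + H') eta zeta = hform H eta zeta + hform H' eta zeta.
Proof.
rewrite /hform -big_split /=; apply: eq_bigr => i _; rewrite -big_split /=.
by apply: eq_bigr => j _; rewrite mxE; ring.
Qed.

Lemma hformZm H e eta zeta : hform (e *: H) eta zeta = e * hform H eta zeta.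
Proof.
rewrite /hform mulr_sumr; apply: eq_bigr => i _; rewrite mulr_sumr.
by apply: eq_bigr => j _; rewrite mxE; ring.
Qed.

Lemma lowlZm H e eta i : lowl (e *: H) eta i = e * lowl H eta i.
Proof. by rewrite /lowl mulr_sumr; apply: eq_bigr => j _; rewrite mxE; ring. Qed.
Lemma lowrZm H e eta i : lowr (e *: H) eta i = e * lowr H eta i.
Proof. by rewrite /lowr mulr_sumr; apply: eq_bigr => j _; rewrite mxE; ring. Qed.
Lemma lowlDm H H' eta i : lowl (H + H') eta i = lowl H eta i + lowl H' eta i.
Proof. by rewrite /lowl -big_split /=; apply: eq_bigr => j _; rewrite mxE; ring. Qed.
Lemma lowrDm H H' eta i : lowr (H + H') eta i = lowr H eta i + lowr H' eta i.
Proof. by rewrite /lowr -big_split /=; apply: eq_bigr => j _; rewrite mxE; ring. Qed.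
Lemma lowlD H eta zeta i : lowl H (eta + zeta) i = lowl H eta i + lowl H zeta i.
Proof. by rewrite /lowl -big_split /=; apply: eq_bigr => j _; rewrite mxE conjD; ring. Qed.
Lemma lowrD H eta zeta i : lowr H (eta + zeta) i = lowr H eta i + lowr H zeta i.
Proof. by rewrite /lowr -big_split /=; apply: eq_bigr => j _; rewrite mxE; ring. Qed.
Lemma lowlZ H e eta i : lowl H (e *: eta) i = e^* * lowl H eta i.
Proof. by rewrite /lowl mulr_sumr; apply: eq_bigr => j _; rewrite mxE conjM; ring. Qed.
Lemma lowrZ H e eta i : lowr H (e *: eta) i = e * lowr H eta i.
Proof. by rewrite /lowr mulr_sumr; apply: eq_bigr => j _; rewrite mxE; ring. Qed.

Definition selfadj H : Prop := forall i j, H j i = (H i j)^*.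

Lemma conj_lowl H eta i : selfadj H -> (lowl H eta i)^* = lowr H eta i.
Proof.
by move=> h; rewrite conj_sum; apply: eq_bigr => j _; rewrite conjM conj_conj -h.
Qed.

Lemma conj_lowr H eta i : selfadj H -> (lowr H eta i)^* = lowl H eta i.
Proof. by move=> h; rewrite -conj_lowl // conj_conj. Qed.

Lemma conj_hform H eta zeta : selfadj H -> (hform H eta zeta)^* = hform H zeta eta.
Proof.
move=> h; rewrite hform_lowl hform_lowr conj_sum; apply: eq_bigr => i _.
by rewrite conjM conj_lowl.
Qed.

Lemma Im_hform H eta : selfadj H -> Im (hform H eta eta) = 0.
Proof. by move=> /(conj_hform eta eta) /(congr1 Im); rewrite cIm_conj; lra. Qed.

Lemma wirt_lowl_eta H k i x : wirt k (fun eta => lowl H eta i) x 0 (H i k).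
Proof.
apply: wirt_eq (wirt_sum (index_enum _)
  (fun j => wirtZ (H i j) (wirt_conj (wirt_coord k x j)))) _ _.
  by apply: big1 => j _; rewrite conjC0 mulr0.
rewrite (bigD1 k) //= big1 ?addr0 ?eqxx ?conj_nat ?mulr1 // => j.
by rewrite eq_sym => /negPf ->; rewrite conjC0 mulr0.
Qed.

Lemma wirt_lowr_eta H k j x : wirt k (fun eta => lowr H eta j) x (H k j) 0.
Proof.
apply: wirt_eq (wirt_sum (index_enum _)
  (fun i => wirtZ (H i j) (wirt_coord k x i))) _ _.
  rewrite (bigD1 k) //= big1 ?addr0 ?eqxx ?mulr1 // => i.
  by rewrite eq_sym => /negPf ->; rewrite mulr0.
by apply: big1 => i _; rewrite mulr0.
Qed.

Lemma wirt_hform_eta H k x :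
  wirt k (fun eta => hform H eta eta) x (lowl H x k) (lowr H x k).
Proof.
apply: (@wirt_ext _ _ k (fun eta => \sum_i eta 0 i * lowl H eta i)).
  by move=> y; rewrite hform_lowl.
apply: wirt_eq (wirt_sum (index_enum _)
  (fun i => wirtM (wirt_coord k x i) (wirt_lowl_eta H k i x))) _ _.
  rewrite (bigD1 k) //= big1 ?addr0 ?eqxx ?mul1r ?mulr0 ?addr0 // => i.
  by rewrite eq_sym => /negPf ->; rewrite mul0r mulr0 addr0.
by apply: eq_bigr => i _; rewrite mul0r add0r mulrC.
Qed.

Definition dzM k (H : Cn -> 'M[C]_n) z : 'M[C]_n :=
  \matrix_(i, j) dz k (fun w => H w i j) z.
Definition dzbarM k (H : Cn -> 'M[C]_n) z : 'M[C]_n :=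
  \matrix_(i, j) dzbar k (fun w => H w i j) z.

Section BaseDerivative.
Variables (H : Cn -> 'M[C]_n) (k : 'I_n) (z : Cn).
Hypothesis Hd : forall i j, wdiff k (fun w => H w i j) z.

Let Hd' i j : wirt k (fun w => H w i j) z (dzM k H z i j) (dzbarM k H z i j).
Proof. by rewrite !mxE; exact: Hd. Qed.

Lemma wirt_lowl eta i : wirt k (fun w => lowl (H w) eta i) z
  (lowl (dzM k H z) eta i) (lowl (dzbarM k H z) eta i).
Proof. exact: (wirt_sum (index_enum _) (fun j => wirtZr _ (Hd' i j))). Qed.

Lemma wirt_lowr eta j : wirt k (fun w => lowr (H w) eta j) z
  (lowr (dzM k H z) eta j) (lowr (dzbarM k H z) eta j).
Proof. exact: (wirt_sum (index_enum _) (fun i => wirtZr _ (Hd' i j))). Qed.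

Lemma wirt_hform eta zeta : wirt k (fun w => hform (H w) eta zeta) z
  (hform (dzM k H z) eta zeta) (hform (dzbarM k H z) eta zeta).
Proof.
exact: (wirt_sum (index_enum _) (fun i => wirt_sum (index_enum _)
  (fun j => wirtZr _ (wirtZr _ (Hd' i j))))).
Qed.

End BaseDerivative.

(** Positivity at A times the component of [zeta] orthogonal to [eta]. The form is only
    semidefinite, so that the lemma applies to |beta|^2. *)
Lemma hform_CS H eta zeta : selfadj H -> (forall x, 0 <= hform H x x) ->
  0 < hform H eta eta ->
  hform H zeta eta * hform H eta zeta <= hform H zeta zeta * hform H eta eta.
Proof.
move=> hH pH; set A := hform H eta eta => A0.
have Ar : A^* = A by rewrite conj_hform.
have := pH (A *: zeta - hform H zeta eta *: eta).
rewrite -scaleNr hformDl !hformDr !hformZl !hformZr conjN Ar conj_hform // -/A.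
set e := (X in 0 <= X) => e0.
have {e0} : 0 <= A * (hform H zeta zeta * A - hform H zeta eta * hform H eta zeta).
  by move: e0; rewrite /e; congr (0 <= _); ring.
by rewrite pmulr_rge0 // subr_ge0.
Qed.

Section EulerIdentities.
Variables (H1 H2 K1 K2 : 'M[C]_n) (eta : Cn).
Local Notation A := (hform H1 eta eta).
Local Notation S := (hform H2 eta eta).
Hypotheses (A0 : 0 < A) (S0 : 0 < S).

Lemma dgl_lowr_contract :
  \sum_m (eta 0 m)^* * dgl A S (lowr H1 eta m) (lowr H2 eta m)
    (hform K1 eta eta) (hform K2 eta eta) (lowr K1 eta m) (lowr K2 eta m)
  = gl A S (hform K1 eta eta) (hform K2 eta eta).
Proof. by rewrite dgl_suml -!hform_lowr dgl_euler_form. Qed.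

Lemma dgl_lowl_contract :
  \sum_m eta 0 m * dgl A S (lowl H1 eta m) (lowl H2 eta m)
    (hform K1 eta eta) (hform K2 eta eta) (lowl K1 eta m) (lowl K2 eta m)
  = gl A S (hform K1 eta eta) (hform K2 eta eta).
Proof. by rewrite dgl_suml -!hform_lowl dgl_euler_form. Qed.

Lemma dgl_hess_contract l m :
  \sum_j eta 0 j * dgl A S l m (lowl H1 eta j) (lowl H2 eta j) 0 0 = 0.
Proof.
rewrite dgl_sum -!hform_lowl big1 ?dgl_euler_anti // => j _.
by rewrite mulr0.
Qed.

End EulerIdentities.

End Forms.

(** * Fundamental tensor *)

Section SumOfRootsMetric.
Variables (R : realType) (n : nat).
Local Notation C := R[i].
Local Notation Cn := 'rV[C]_n.
Local Notation Re := (@complex.Re R).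
Local Notation Im := (@complex.Im R).
Variables (a c : Cn -> 'M[C]_n) (D : Cn -> Prop).
Implicit Types (eta zeta x z : Cn) (i j k m p : 'I_n).

Definition sum_roots z eta : R :=
  Num.sqrt (Re (hform (a z) eta eta)) + Num.sqrt (Re (hform (c z) eta eta)).

(** The first form plays the role of alpha^2, the second, only semidefinite, that of |beta|^2;
    [fp_near] is openness of [D] as far as partial derivatives can see it. *)
Record form_pair : Prop := FormPair {
  fp_near : forall k z, D z -> near_coord k z D;
  fp_da : forall k z i j, D z -> wdiff k (fun w => a w i j) z;
  fp_dc : forall k z i j, D z -> wdiff k (fun w => c w i j) z;
  fp_ha : forall z, D z -> selfadj (a z);
  fp_hc : forall z, D z -> selfadj (c z);
  fp_a0 : forall z eta, D z -> eta != 0 -> 0 < hform (a z) eta eta;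
  fp_c0 : forall z eta, D z -> 0 <= hform (c z) eta eta }.

Hypothesis fp : form_pair.

Local Notation F := sum_roots.
Local Notation A z eta := (hform (a z) eta eta).
Local Notation S z eta := (hform (c z) eta eta).

(** Where S vanishes its root need not be differentiable; for the Randers metric these are the
    points with beta = 0. *)
Definition regular z eta : Prop := D z /\ S z eta != 0.

Lemma regular_c z eta : regular z eta -> 0 < S z eta.
Proof. by case=> Dz S0; rewrite lt0r S0 fp_c0. Qed.

Lemma hform0l (H : 'M[C]_n) x : hform H 0 x = 0.
Proof. by rewrite hform_lowl big1 // => i _; rewrite mxE mul0r. Qed.

Lemma regular_neq0 z eta : regular z eta -> eta != 0.
Proof. by case=> _; apply: contraNneq => ->; rewrite hform0l. Qed.

Lemma regular_a z eta : regular z eta -> 0 < A z eta.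
Proof. by move=> r; apply: (fp_a0 fp); [case: r | exact: regular_neq0 r]. Qed.

Lemma sum_rootsE z eta : (F z eta)%:C = rsqrt (A z eta) + rsqrt (S z eta).
Proof. exact: rmorphD. Qed.

Lemma near_regular_eta k z eta : regular z eta -> near_coord k eta (regular z).
Proof.
move=> [Dz S0]; apply: near_coordS (wdiff_neq0 (wirt_wdiff (wirt_hform_eta (c z) k eta)) S0).
by move=> y Sy; split.
Qed.

Lemma near_regular_z k z eta : regular z eta -> near_coord k z (regular^~ eta).
Proof.
move=> [Dz S0].
have dc i j := fp_dc fp k i j Dz.
apply: near_coordS (near_coord_and (fp_near fp k Dz)
  (wdiff_neq0 (wirt_wdiff (wirt_hform dc eta eta)) S0)).
by move=> y [Dy Sy]; split.
Qed.

Let a_real_eta k z eta : D z -> near_coord k eta (fun y => Im (A z y) = 0).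
Proof. by move=> Dz; apply: near_coordW => y; apply/Im_hform/(fp_ha fp). Qed.
Let c_real_eta k z eta : D z -> near_coord k eta (fun y => Im (S z y) = 0).
Proof. by move=> Dz; apply: near_coordW => y; apply/Im_hform/(fp_hc fp). Qed.
Let a_real_z k z eta : D z -> near_coord k z (fun w => Im (A w eta) = 0).
Proof.
by move=> /(fp_near fp k); apply: near_coordS => w Dw; apply/Im_hform/(fp_ha fp).
Qed.
Let c_real_z k z eta : D z -> near_coord k z (fun w => Im (S w eta) = 0).
Proof.
by move=> /(fp_near fp k); apply: near_coordS => w Dw; apply/Im_hform/(fp_hc fp).
Qed.

Local Notation dA k z eta := (hform (dzM k a z) eta eta).
Local Notation dS k z eta := (hform (dzM k c z) eta eta).

Definition lfin z eta i : C :=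
  gl (A z eta) (S z eta) (lowl (a z) eta i) (lowl (c z) eta i).
Definition lbar z eta j : C :=
  gl (A z eta) (S z eta) (lowr (a z) eta j) (lowr (c z) eta j).
Definition gfin z eta i j : C :=
  dgl (A z eta) (S z eta) (lowr (a z) eta j) (lowr (c z) eta j)
    (lowl (a z) eta i) (lowl (c z) eta i) (a z i j) (c z i j).

Lemma conj_lbar z eta j : D z -> (lbar z eta j)^* = lfin z eta j.
Proof.
move=> Dz; have ha := fp_ha fp Dz; have hc := fp_hc fp Dz.
by rewrite conj_gl !conj_lowr.
Qed.

Lemma sum_roots_sqrE z eta :
  (F z eta ^+ 2)%:C = (rsqrt (A z eta) + rsqrt (S z eta)) ^+ 2.
Proof. by rewrite -sum_rootsE rmorphXn. Qed.

Lemma dzbar_sum_roots_sqr z eta j : regular z eta ->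
  dzbar j (fun zeta => (F z zeta ^+ 2)%:C) eta = lbar z eta j.
Proof.
move=> r; have Dz := proj1 r.
under eq_fun do rewrite sum_roots_sqrE.
exact: wirt_dzbar (wirt_sum_rsqrt_sqr (wirt_hform_eta (a z) j eta)
  (wirt_hform_eta (c z) j eta) (a_real_eta j eta Dz) (c_real_eta j eta Dz)
  (regular_a r) (regular_c r)).
Qed.

Lemma fundamentalE z eta : regular z eta ->
  fundamental F z eta = \matrix_(i, j) gfin z eta i j.
Proof.
move=> r; have Dz := proj1 r; apply/matrixP => i j; rewrite !mxE.
rewrite (@dz_near _ _ i _ (fun y => lbar z y j)); last first.
  apply: near_coordS (near_regular_eta i r) => y; exact: dzbar_sum_roots_sqr.
exact: wirt_dz (wirt_gl (wirt_hform_eta (a z) i eta)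
  (wirt_hform_eta (c z) i eta) (a_real_eta i eta Dz) (c_real_eta i eta Dz)
  (regular_a r) (regular_c r) (wirt_lowr_eta (a z) i j eta) (wirt_lowr_eta (c z) i j eta)).
Qed.

Lemma gfin_euler z eta j : regular z eta ->
  \sum_i eta 0 i * gfin z eta i j = lbar z eta j.
Proof.
move=> r; rewrite dgl_sum -!hform_lowl.
have lowrE (H : 'M[C]_n) : \sum_i eta 0 i * H i j = lowr H eta j.
  by apply: eq_bigr => i _; rewrite mulrC.
by rewrite !lowrE dgl_euler_hol //; [exact: regular_a | exact: regular_c].
Qed.

Lemma gfin_euler_conj z eta i : regular z eta ->
  \sum_j (eta 0 j)^* * gfin z eta i j = lfin z eta i.
Proof.
move=> r; rewrite dgl_suml -!hform_lowr.
have lowlE (H : 'M[C]_n) : \sum_j (eta 0 j)^* * H i j = lowl H eta i.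
  by apply: eq_bigr => j _; rewrite mulrC.
by rewrite !lowlE dgl_euler_form //; [exact: regular_a | exact: regular_c].
Qed.

Lemma conj_gfin z eta i j : D z -> (gfin z eta i j)^* = 
  dgl (A z eta) (S z eta) (lowl (a z) eta j) (lowl (c z) eta j)
    (lowr (a z) eta i) (lowr (c z) eta i) (a z j i) (c z j i).
Proof.
move=> Dz; have ha := fp_ha fp Dz; have hc := fp_hc fp Dz.
by rewrite conj_dgl !conj_lowr // !conj_lowl // -ha -hc.
Qed.

(** The Hermitian form of g vanishes at a vector of the kernel, whereas Cauchy-Schwarz for both
    forms makes it positive at every nonzero vector. *)
Lemma gfin_unit z eta : regular z eta -> (\matrix_(i, j) gfin z eta i j) \in unitmx.
Proof.
move=> r; have Dz := proj1 r; have ha := fp_ha fp Dz; have hc := fp_hc fp Dz.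
have A0 := regular_a r; have S0 := regular_c r.
rewrite -row_free_unit -kermx_eq0; apply/rowV0P => v /sub_kermxP vg.
have : \sum_j (v 0 j)^* * \sum_i v 0 i * gfin z eta i j = 0.
  rewrite big1 // => j _; move/matrixP/(_ 0 j): vg; rewrite !mxE => e.
  by rewrite (_ : \sum_i _ = 0) ?mulr0 // -[RHS]e; apply: eq_bigr => i _; rewrite mxE.
have lowrE (H : 'M[C]_n) j : \sum_i v 0 i * H i j = lowr H v j.
  by apply: eq_bigr => i _; rewrite mulrC.
under eq_bigr do rewrite dgl_sum -!hform_lowl !lowrE.
rewrite dgl_suml -!hform_lowr.
have csa : hform (a z) v eta * hform (a z) eta v <= hform (a z) v v * A z eta.
  apply: hform_CS => // x; have [->|x0] := eqVneq x 0; first by rewrite hform0l.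
  exact/ltW/(fp_a0 fp).
have csc : hform (c z) v eta * hform (c z) eta v <= hform (c z) v v * S z eta.
  by apply: hform_CS => // x; exact: fp_c0.
have pa : hform (a z) eta v = (hform (a z) v eta)^* by rewrite conj_hform.
have pc : hform (c z) eta v = (hform (c z) v eta)^* by rewrite conj_hform.
have [//|v0] := eqVneq v 0.
have av := fp_a0 fp Dz v0.
move: A0 S0 csa csc av (rsqrt_gt0 A0) (rsqrt_gt0 S0) (rsqrt_sqr (ltW A0)) (rsqrt_sqr (ltW S0)).
rewrite /dgl pa pc.
move: (A z eta) (S z eta) (hform (a z) v eta) (hform (c z) v eta) (hform (a z) v v) (hform (c z) v v).
move=> P Q al sl av cv; move: (rsqrt P) (rsqrt Q) => x y P0 Q0 csa csc av0 x0 y0 xA yS.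
have xn := lt0r_neq0 x0; have yn := lt0r_neq0 y0.
have tt : 0 <= (al / x + sl / y) * (al / x + sl / y)^* by rewrite mul_conjC_ge0.
have xr : x^* = x by apply/CrealP/gtr0_real.
have yr : y^* = y by apply/CrealP/gtr0_real.
(* Half a square modulus, plus two terms whose numerators are each a multiple of the value at [v]
   plus a Cauchy-Schwarz defect; the one from the definite form is strictly positive. *)
rewrite (_ : _ + _ = 2^-1 * ((al / x + sl / y) * (al / x + sl / y)^*) +
  (x + y) * ((2 * av * x ^+ 2 - al * al^*) / (2 * x ^+ 3) +
             (2 * cv * y ^+ 2 - sl * sl^*) / (2 * y ^+ 3))); last first.
  by rewrite conjD !conjM !conjV xr yr; field; rewrite xn yn.
move=> e; exfalso; move/eqP: e; apply/negP; rewrite lt0r_neq0 //.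
have cv0 : 0 <= cv * y ^+ 2 - sl * sl^* by rewrite subr_ge0 yS.
have cv1 : 0 <= cv.
  have : 0 <= cv * Q by apply: le_trans csc; exact: mul_conjC_ge0.
  by rewrite pmulr_lge0.
apply: ltr_wpDl; first by rewrite mulr_ge0 // invr_ge0 ler0n.
apply: mulr_gt0; first exact: addr_gt0.
apply: ltr_wpDr.
  rewrite divr_ge0 // ?mulr_ge0 ?ler0n ?exprn_ge0 ?(ltW y0) //.
  rewrite (_ : _ - _ = cv * y ^+ 2 + (cv * y ^+ 2 - sl * sl^*)); last by ring.
  by rewrite addr_ge0 // mulr_ge0 ?exprn_ge0 ?(ltW y0).
rewrite divr_gt0 // ?mulr_gt0 ?ltr0n ?exprn_gt0 //.
rewrite (_ : _ - _ = av * x ^+ 2 + (av * x ^+ 2 - al * al^*)); last by ring.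
by rewrite ltr_wpDr ?mulr_gt0 ?exprn_gt0 // subr_ge0 xA.
Qed.

End SumOfRootsMetric.

(** * Nonlinear connection, spray and theta *)

Section FinslerObjectsOfSumOfRoots.
Variables (R : realType) (n : nat).
Local Notation C := R[i].
Local Notation Cn := 'rV[C]_n.
Local Notation Re := (@complex.Re R).
Local Notation Im := (@complex.Im R).
Variables (a c : Cn -> 'M[C]_n) (D : Cn -> Prop).
Implicit Types (eta zeta x z : Cn) (i j k m p : 'I_n).
Hypothesis fp : form_pair a c D.

Local Notation F := (sum_roots a c).
Local Notation A z eta := (hform (a z) eta eta).
Local Notation S z eta := (hform (c z) eta eta).
Local Notation regular := (regular c D).
Local Notation lfin := (lfin a c).
Local Notation lbar := (lbar a c).
Local Notation gfin := (gfin a c).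
Local Notation dA k z eta := (hform (dzM k a z) eta eta).
Local Notation dS k z eta := (hform (dzM k c z) eta eta).

Let a_real_eta k z eta : D z -> near_coord k eta (fun y => Im (A z y) = 0).
Proof. by move=> Dz; apply: near_coordW => y; apply/Im_hform/(fp_ha fp). Qed.
Let c_real_eta k z eta : D z -> near_coord k eta (fun y => Im (S z y) = 0).
Proof. by move=> Dz; apply: near_coordW => y; apply/Im_hform/(fp_hc fp). Qed.
Let a_real_z k z eta : D z -> near_coord k z (fun w => Im (A w eta) = 0).
Proof.
by move=> /(fp_near fp k); apply: near_coordS => w Dw; apply/Im_hform/(fp_ha fp).
Qed.
Let c_real_z k z eta : D z -> near_coord k z (fun w => Im (S w eta) = 0).
Proof.
by move=> /(fp_near fp k); apply: near_coordS => w Dw; apply/Im_hform/(fp_hc fp).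
Qed.
Let da k z i j (Dz : D z) := fp_da fp k i j Dz.
Let dc k z i j (Dz : D z) := fp_dc fp k i j Dz.

Definition gmx z eta : 'M[C]_n := \matrix_(i, j) gfin z eta i j.

(* In terms of L = F^2: [dlbar m j] is d_{z j} d_{conj eta m} L, [dlfin i j] is
   d_{z j} d_{eta i} L, [hess p j] is d_{eta p} d_{eta j} L and [dsqr k] is
   d_{z k} L. *)
Definition dlbar z eta m j : C :=
  dgl (A z eta) (S z eta) (lowr (a z) eta m) (lowr (c z) eta m)
    (dA j z eta) (dS j z eta) (lowr (dzM j a z) eta m) (lowr (dzM j c z) eta m).

Definition dlfin z eta i j : C :=
  dgl (A z eta) (S z eta) (lowl (a z) eta i) (lowl (c z) eta i)
    (dA j z eta) (dS j z eta) (lowl (dzM j a z) eta i) (lowl (dzM j c z) eta i).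

Definition hess z eta p j : C :=
  dgl (A z eta) (S z eta) (lowl (a z) eta p) (lowl (c z) eta p)
    (lowl (a z) eta j) (lowl (c z) eta j) 0 0.

Definition dsqr z eta k : C := gl (A z eta) (S z eta) (dA k z eta) (dS k z eta).

Lemma dz_lbar z eta m j : regular z eta ->
  dz j (fun w => lbar w eta m) z = dlbar z eta m j.
Proof.
move=> r; have Dz := proj1 r.
have wa := wirt_hform (fun i j' => da j i j' Dz); have wc := wirt_hform (fun i j' => dc j i j' Dz).
have la := wirt_lowr (fun i j' => da j i j' Dz); have lc := wirt_lowr (fun i j' => dc j i j' Dz).
exact: wirt_dz (wirt_gl (wa eta eta) (wc eta eta) (a_real_z j eta Dz) (c_real_z j eta Dz)
  (regular_a fp r) (regular_c fp r) (la eta m) (lc eta m)).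
Qed.

Lemma wdiff_gfin_z k z eta i j : regular z eta ->
  wdiff k (fun w => gfin w eta i j) z.
Proof.
move=> r; have Dz := proj1 r.
have wa := wirt_hform (fun i j' => da k i j' Dz); have wc := wirt_hform (fun i j' => dc k i j' Dz).
have ra := wirt_lowr (fun i j' => da k i j' Dz); have rc := wirt_lowr (fun i j' => dc k i j' Dz).
have la := wirt_lowl (fun i j' => da k i j' Dz); have lc := wirt_lowl (fun i j' => dc k i j' Dz).
exact: (wdiff_dgl (wa eta eta) (wc eta eta) (a_real_z k eta Dz) (c_real_z k eta Dz)
  (regular_a fp r) (regular_c fp r) (wirt_wdiff (ra eta j)) (wirt_wdiff (rc eta j))
  (wirt_wdiff (la eta i)) (wirt_wdiff (lc eta i)) (da k i j Dz) (dc k i j Dz)).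
Qed.

Lemma wdiff_gfin_eta k z eta i j : regular z eta ->
  wdiff k (fun y => gfin z y i j) eta.
Proof.
move=> r; have Dz := proj1 r.
have w H := wirt_hform_eta H k eta.
have ra H := wirt_wdiff (wirt_lowr_eta H k j eta).
have la H := wirt_wdiff (wirt_lowl_eta H k i eta).
exact: (wdiff_dgl (w (a z)) (w (c z)) (a_real_eta k eta Dz) (c_real_eta k eta Dz)
  (regular_a fp r) (regular_c fp r) (ra _) (ra _) (la _) (la _)
  (wdiff_cst k eta _) (wdiff_cst k eta _)).
Qed.

Lemma wdiff_dlbar_eta k z eta m j : regular z eta ->
  wdiff k (fun y => dlbar z y m j) eta.
Proof.
move=> r; have Dz := proj1 r.
have w H := wirt_hform_eta H k eta.
have ra H := wirt_wdiff (wirt_lowr_eta H k m eta).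
exact: (wdiff_dgl (w (a z)) (w (c z)) (a_real_eta k eta Dz) (c_real_eta k eta Dz)
  (regular_a fp r) (regular_c fp r) (ra _) (ra _) (wirt_wdiff (w _)) (wirt_wdiff (w _))
  (ra _) (ra _)).
Qed.

(** As [eta] does not depend on [z], its contraction with g passes under [dz j], where Euler's
    relation replaces g by the first derivative [lbar]. *)
Lemma nonlinear_connE i j z eta : regular z eta ->
  nonlinear_conn F i j z eta = \sum_m invmx (gmx z eta) m i * dlbar z eta m j.
Proof.
move=> r; rewrite /nonlinear_conn; apply: eq_bigr => m _.
rewrite /fundamental_inv (fundamentalE fp r) -/(gmx z eta).
under eq_bigr do rewrite -mulrA.
rewrite -mulr_sumr; congr (_ * _).
rewrite -dz_lbar // (@dz_near _ _ j _ (fun w => \sum_l gfin w eta l m * eta 0 l)).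
  rewrite (wirt_dz (wirt_sum (index_enum _)
    (fun l => wirtZr (eta 0 l) (wdiff_gfin_z j l m r)))).
  apply: eq_bigr => l _; rewrite (@dz_near _ _ j _ (fun w => gfin w eta l m)) //.
  by apply: near_coordS (near_regular_z fp j r) => w rw; rewrite (fundamentalE fp rw) mxE.
apply: near_coordS (near_regular_z fp j r) => w rw.
by rewrite -(gfin_euler fp) //; apply: eq_bigr => l _; rewrite mulrC.
Qed.

Lemma inv_gmx z eta : regular z eta -> invmx (gmx z eta) *m gmx z eta = 1%:M.
Proof. by move=> r; rewrite mulVmx // (gfin_unit fp r). Qed.

Lemma lfin_inv z eta m : regular z eta ->
  \sum_i invmx (gmx z eta) m i * lfin z eta i = (eta 0 m)^*.
Proof.
move=> r; under eq_bigr do rewrite -(gfin_euler_conj fp) // mulr_sumr.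
rewrite exchange_big /=.
have /matrixP e := inv_gmx r.
transitivity (\sum_j (eta 0 j)^* * (1%:M : 'M[C]_n) m j).
  apply: eq_bigr => j _; rewrite -e mxE mulr_sumr; apply: eq_bigr => i _.
  by rewrite [gmx z eta i j]mxE; ring.
rewrite (bigD1 m) //= big1 ?addr0 ?mxE ?eqxx ?mulr1 // => j jm.
by rewrite mxE eq_sym (negPf jm) mulr0.
Qed.

(** The classical fact that the horizontal derivative of L vanishes. The inverse of g has cancelled,
    so this can be differentiated in [eta] without a formula for the derivative of an inverse. *)
Lemma lfin_nonlinear_conn z eta k : regular z eta ->
  \sum_i lfin z eta i * nonlinear_conn F i k z eta = dsqr z eta k.
Proof.
move=> r; under eq_bigr do rewrite nonlinear_connE // mulr_sumr.
rewrite exchange_big /=.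
transitivity (\sum_m (eta 0 m)^* * dlbar z eta m k).
  apply: eq_bigr => m _; rewrite -(lfin_inv m r) mulr_suml; apply: eq_bigr => i _; ring.
exact: (dgl_lowr_contract _ _ (regular_a fp r) (regular_c fp r)).
Qed.

Lemma sprayE i z eta : regular z eta ->
  2 * spray F i z eta =
  \sum_m invmx (gmx z eta) m i * \sum_j eta 0 j * dlbar z eta m j.
Proof.
move=> r; rewrite /spray mulrA mulfV ?pnatr_eq0 // mul1r.
under eq_bigr do rewrite nonlinear_connE // mulr_suml.
rewrite exchange_big /=; apply: eq_bigr => m _; rewrite mulr_sumr.
by apply: eq_bigr => j _; ring.
Qed.

Lemma wdiff_nonlinear_conn k i j z eta : regular z eta ->
  wdiff k (fun y => nonlinear_conn F i j z y) eta.
Proof.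
move=> r; apply: (@wdiff_near _ _ k
    (fun y => \sum_m invmx (gmx z y) m i * dlbar z y m j)).
  by apply: near_coordS (near_regular_eta k r) => y ry; rewrite nonlinear_connE.
apply: wdiff_sum => m; apply: wdiffM (wdiff_dlbar_eta k m j r).
apply: wdiff_invmx; last exact: (gfin_unit fp r).
move=> i' j'; rewrite (_ : (fun y => _) = (fun y => gfin z y i' j')).
  exact: wdiff_gfin_eta.
by apply/funext => y; rewrite mxE.
Qed.

(* Differentiate [lfin_nonlinear_conn] in eta^j. *)
Lemma lfin_linear_conn z eta j k : regular z eta ->
  \sum_i lfin z eta i * linear_conn F i j k z eta =
  dlfin z eta j k - \sum_i hess z eta i j * nonlinear_conn F i k z eta.
Proof.
move=> r; have Dz := proj1 r.
have A0 := regular_a fp r; have S0 := regular_c fp r.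
have w H := wirt_hform_eta H j eta.
have wl i : wirt j (fun y => lfin z y i) eta (hess z eta i j) _ :=
  wirt_gl (w (a z)) (w (c z)) (a_real_eta j eta Dz) (c_real_eta j eta Dz)
    A0 S0 (wirt_lowl_eta (a z) j i eta) (wirt_lowl_eta (c z) j i eta).
have wd := wirt_gl (w (a z)) (w (c z)) (a_real_eta j eta Dz) (c_real_eta j eta Dz)
    A0 S0 (w (dzM k a z)) (w (dzM k c z)).
have wN i := wdiff_nonlinear_conn j i k r.
have := wirt_dz (wirt_sum (index_enum _) (fun i => wirtM (wl i) (wN i))).
rewrite (@dz_near _ _ j _ (fun y => dsqr z y k)); last first.
  by apply: near_coordS (near_regular_eta j r) => y ry; rewrite lfin_nonlinear_conn.
rewrite (wirt_dz wd) big_split /= => e.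
rewrite [X in X - _](_ : _ = \sum_i hess z eta i j * nonlinear_conn F i k z eta +
   \sum_i lfin z eta i * linear_conn F i j k z eta); first by ring.
by rewrite -e dgl_sym.
Qed.

Definition theta_low z eta m : C :=
  dsqr z eta m - \sum_j eta 0 j * dlfin z eta m j
  + \sum_p hess z eta p m * (2 * spray F p z eta).

Lemma theta_starE i z eta : regular z eta ->
  (theta_star F i z eta)^* =
  \sum_m (invmx (gmx z eta) m i)^* * theta_low z eta m.
Proof.
move=> r; have Dz := proj1 r.
have A0 := regular_a fp r; have S0 := regular_c fp r.
rewrite /theta_star conj_sum; apply: eq_bigr => m _.
rewrite /fundamental_inv (fundamentalE fp r) -/(gmx z eta).
rewrite conj_sum.
transitivity ((invmx (gmx z eta) m i)^* * \sum_j eta 0 j *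
  \sum_p lfin z eta p * (linear_conn F p j m z eta - linear_conn F p m j z eta)).
  rewrite mulr_sumr.
  under [RHS]eq_bigr do rewrite !mulr_sumr.
  under [LHS]eq_bigr do rewrite conj_sum.
  rewrite exchange_big [RHS]exchange_big /=; apply: eq_bigr => p _.
  under [LHS]eq_bigr do rewrite conj_sum.
  rewrite exchange_big /=; apply: eq_bigr => j _.
  rewrite -(conj_lbar fp) // -(gfin_euler fp) // conj_sum mulr_suml !mulr_sumr.
  apply: eq_bigr => l _; rewrite (_ : gmx z eta l p = gfin z eta l p); last by rewrite mxE.
  move: (linear_conn F p j m z eta) (linear_conn F p m j z eta) => u v.
  move: (invmx (gmx z eta) m i) (gfin z eta l p) (eta 0 l) (eta 0 j) => e f g h.
  by rewrite !conjM conjB !conj_conj; ring.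
congr (_ * _).
have split_conn j : \sum_p lfin z eta p *
    (linear_conn F p j m z eta - linear_conn F p m j z eta) =
  (dlfin z eta j m - \sum_p hess z eta p j * nonlinear_conn F p m z eta) -
  (dlfin z eta m j - \sum_p hess z eta p m * nonlinear_conn F p j z eta).
  transitivity (\sum_p lfin z eta p * linear_conn F p j m z eta -
                \sum_p lfin z eta p * linear_conn F p m j z eta).
    by rewrite -sumrB; apply: eq_bigr => p _; rewrite mulrBr.
  by congr (_ - _); exact: lfin_linear_conn.
under eq_bigr => j _ do rewrite split_conn.
rewrite (_ : \sum_j _ = \sum_j eta 0 j * (dlfin z eta j m - dlfin z eta m j)
  - \sum_j eta 0 j * (\sum_p hess z eta p j * nonlinear_conn F p m z eta)
  + \sum_j eta 0 j * (\sum_p hess z eta p m * nonlinear_conn F p j z eta)); last first.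
  rewrite -sumrB -big_split; apply: eq_bigr => j _ /=.
  have dist (e u v s t : C) : e * ((u - s) - (v - t)) = e * (u - v) - e * s + e * t.
    by ring.
  exact: dist.
(* The derivative of L in [eta^p] has degree 0 in [eta], so the holomorphic Hessian annihilates
   [eta]. *)
have Z : \sum_j eta 0 j * (\sum_p hess z eta p j * nonlinear_conn F p m z eta) = 0.
  under eq_bigr do rewrite mulr_sumr.
  rewrite exchange_big big1 //= => p _.
  under eq_bigr do rewrite mulrA.
  rewrite -mulr_suml.
  have -> : \sum_j eta 0 j * hess z eta p j = 0 by exact: (dgl_hess_contract A0 S0).
  by rewrite mul0r.
have T1 : \sum_j eta 0 j * (dlfin z eta j m - dlfin z eta m j) =
    dsqr z eta m - \sum_j eta 0 j * dlfin z eta m j.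
  under eq_bigr do rewrite mulrBr.
  by rewrite sumrB; congr (_ - _); exact: (dgl_lowl_contract _ _ A0 S0).
have T3 : \sum_j eta 0 j * (\sum_p hess z eta p m * nonlinear_conn F p j z eta) =
    \sum_p hess z eta p m * (2 * spray F p z eta).
  under eq_bigr do rewrite mulr_sumr.
  rewrite exchange_big; apply: eq_bigr => p _ /=.
  have two (e : C) : 2 * (2^-1 * e) = e by rewrite mulrA mulfV ?mul1r ?pnatr_eq0.
  rewrite two mulr_sumr.
  by apply: eq_bigr => j _; rewrite mulrCA; congr (_ * _); exact: mulrC.
have comb (s1 s2 s3 t1 t3 : C) : s1 = t1 -> s2 = 0 -> s3 = t3 -> s1 - s2 + s3 = t1 + t3.
  by move=> -> -> ->; rewrite subr0.
exact: (comb _ _ _ _ _ T1 Z T3).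
Qed.

End FinslerObjectsOfSumOfRoots.

(** * The irrationality argument *)

Section Crux.
Variable R : realType.
Local Notation C := R[i].
Local Notation Re := (@complex.Re R).

Section Contraction.
Variables (I : finType) (A S L V : C) (l c K : I -> C).
Hypotheses (A0 : 0 < A) (S0 : 0 < S).
Hypothesis balance : forall m, L * gl A S (l m) (c m) = dgl A S (l m) (c m) 0 V 0 (K m).

Let x0 := rsqrt_neq0 A0.
Let y0 := rsqrt_neq0 S0.
Let xA : rsqrt A ^+ 2 = A. Proof. exact: rsqrt_sqr (ltW A0). Qed.
Let yS : rsqrt S ^+ 2 = S. Proof. exact: rsqrt_sqr (ltW S0). Qed.
Let xy0 : rsqrt A + rsqrt S != 0.
Proof. by apply: lt0r_neq0; rewrite addr_gt0 ?rsqrt_gt0. Qed.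

Variable e : I -> C.
Hypotheses (el : \sum_m e m * l m = A) (ec : \sum_m e m * c m = S)
  (eK : \sum_m e m * K m = V).

Lemma balance_sum (v : I -> C) :
  L * gl A S (\sum_m v m * l m) (\sum_m v m * c m) =
  dgl A S (\sum_m v m * l m) (\sum_m v m * c m) 0 V 0 (\sum_m v m * K m).
Proof.
rewrite -gl_sum mulr_sumr.
under eq_bigr do rewrite mulrCA balance.
rewrite dgl_suml; congr (dgl _ _ _ _ _ _ _ _).
by apply: big1 => i _; rewrite mulr0.
Qed.

(** The contraction with [e], which stands for [eta] or its conjugate, ties the unknown factor [L]
    to the scalar defect [V]. *)
Lemma balance_factor : L * ((rsqrt A + rsqrt S) * rsqrt S) = V.
Proof.
have := balance_sum e; rewrite el ec eK gl_euler // /dgl.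
move: xA yS x0 y0 xy0; move: (rsqrt A) (rsqrt S) => x y ex ey nx ny nxy.
rewrite -ex -ey => h.
have {}h : L * (x + y) ^+ 2 = (x + y) * (V / y) by rewrite h; field; rewrite nx ny.
have {}h : L * (x + y) = V / y by apply: (mulfI nxy); rewrite -h; ring.
by rewrite mulrA h divfK.
Qed.

(** Contraction with a vector of the kernel of S; [balance_factor] then eliminates [L], and sqrt A
    is left as the only irrationality. *)
Lemma balance_kernel (v : I -> C) : \sum_m v m * c m = 0 ->
  V * \sum_m v m * l m = 2 * (A + rsqrt A * rsqrt S) * \sum_m v m * K m.
Proof.
move=> vc; have := balance_sum v; rewrite vc /gl /dgl.
move: (\sum_m v m * l m) (\sum_m v m * K m) => q k; rewrite -balance_factor.
move: xA x0 y0 xy0; move: (rsqrt A) (rsqrt S) => x y ex nx ny nxy h.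
rewrite -ex {ex}.
apply: (mulfI (mulf_neq0 nxy (invr_neq0 (mulf_neq0 nx ny)))).
have {}h : L * (x + y) * (q / x) = 2 * (x + y) * (k / y).
  transitivity (2 * (L * ((x + y) * (q / x + 0 / y))) - L * (x + y) * (q / x)); first by field; rewrite nx ny.
  by rewrite h; field; rewrite nx ny.
transitivity ((x + y) * (L * (x + y) * (q / x))); first by field; rewrite nx ny.
by rewrite h; field; rewrite nx ny.
Qed.

Lemma balance_trivial : V = 0 -> L = 0 /\ forall m, K m = 0.
Proof.
move=> V0; have L0 : L = 0.
  by move: balance_factor => /eqP; rewrite V0 !mulf_eq0 (negPf xy0) (negPf y0) !orbF => /eqP.
split=> // m; have := balance m; rewrite L0 V0 mul0r /dgl => h.
have {}h : (rsqrt A + rsqrt S) * K m / rsqrt S = 0 by rewrite [RHS]h; field; rewrite x0 y0.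
by apply/eqP; move/eqP: h; rewrite !mulf_eq0 invr_eq0 (negPf xy0) (negPf y0) !orbF.
Qed.

End Contraction.

(** The parameter is real so that the conjugate of a polynomial expression is again one. *)
Definition polyfun (f : R -> C) := exists p : {poly C}, forall u, f u = p.[u%:C].

Lemma polyfun_cst e : polyfun (fun _ => e).
Proof. by exists e%:P => u; rewrite hornerC. Qed.
Lemma polyfun_id : polyfun (fun u => u%:C).
Proof. by exists 'X => u; rewrite hornerX. Qed.
Lemma polyfunD f g : polyfun f -> polyfun g -> polyfun (fun u => f u + g u).
Proof. by move=> [p hp] [q hq]; exists (p + q) => u; rewrite hornerD hp hq. Qed.
Lemma polyfunM f g : polyfun f -> polyfun g -> polyfun (fun u => f u * g u).
Proof. by move=> [p hp] [q hq]; exists (p * q) => u; rewrite hornerM hp hq. Qed.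
Lemma polyfunN f : polyfun f -> polyfun (fun u => - f u).
Proof. by move=> [p hp]; exists (- p) => u; rewrite hornerN hp. Qed.
Lemma polyfun_sum (I : Type) (r : seq I) (f : I -> R -> C) :
  (forall i, polyfun (f i)) -> polyfun (fun u => \sum_(i <- r) f i u).
Proof.
move=> h; elim: r => [|i r IH].
  by have [p hp] := polyfun_cst 0; exists p => u; rewrite big_nil; exact: hp.
by have [p hp] := polyfunD (h i) IH; exists p => u; rewrite big_cons hp.
Qed.

Lemma real_roots_poly0 (p : {poly C}) : (forall u : R, p.[u%:C] = 0) -> p = 0.
Proof.
move=> h; apply: (roots_geq_poly_eq0 (rs := [seq (m%:R : R)%:C | m <- iota 0 (size p)])).
- by apply/allP => _ /mapP[m _ ->]; rewrite /root h.
- rewrite map_inj_uniq ?iota_uniq // => m m' /complexI /eqP.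
  by rewrite eqr_nat => /eqP.
- by rewrite size_map size_iota.
Qed.

(* The square root of a positive quadratic polynomial with nonreal (hence
   simple) roots is not a rational function. *)
Lemma sqrt_quadratic_irrational (a0 b w : R) (s : C) (V Q K : {poly C}) :
  let A := fun u : R => (a0 + b * u + w * u ^+ 2)%:C in
  0 < w -> (forall u, 0 < A u) -> s != 0 -> Q != 0 ->
  (forall u : R, V.[u%:C] * Q.[u%:C] = 2 * (A u + rsqrt (A u) * s) * K.[u%:C]) ->
  V = 0.
Proof.
move=> A w0 A0 s0 Q0 h.
pose pA : {poly C} := a0%:C%:P + b%:C *: 'X + w%:C *: 'X^2.
have pAE (t : C) : pA.[t] = a0%:C + b%:C * t + w%:C * t ^+ 2.
  by rewrite /pA !hornerE.
have pAR (u : R) : pA.[u%:C] = A u by rewrite pAE /A expr2 !rmorphD !rmorphM -expr2.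
have wC : w%:C != 0 :> C by rewrite (inj_eq (@complexI R)) lt0r_neq0.
have szA : size pA = 3.
  rewrite /pA addrC size_polyDl size_scale ?size_polyXn //.
  apply: leq_ltn_trans (size_polyD _ _) _; rewrite gtn_max.
  rewrite (leq_ltn_trans (size_polyC_leq1 _)) //=.
  by rewrite (leq_ltn_trans (size_scale_leq _ _)) // size_polyX.
have /closed_rootP [rho] : size pA != 1 by rewrite szA.
rewrite /root => /eqP r0.
have rc0 : pA.[rho^*] = 0.
  by rewrite -[RHS]conjC0 -r0 !pAE !expr2 !conjD !conjM !conj_real.
(* A real root would contradict the positivity of [A] on the real line. *)
have nreal : rho^* != rho.
  apply/eqP => rr; have := A0 (Re rho).
  have -> : A (Re rho) = 0.
    rewrite -pAR -[RHS]r0; congr (_.[_]); apply: RRe_real0.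
    by move/(congr1 (@complex.Im R)): rr; rewrite cIm_conj; lra.
  by rewrite ltxx.
have b1 : b%:C = - w%:C * (rho + rho^*).
  have : (b%:C + w%:C * (rho + rho^*)) * (rho^* - rho) = 0.
    transitivity (pA.[rho^*] - pA.[rho]); first by rewrite !pAE; ring.
    by rewrite r0 rc0 subrr.
  move/eqP; rewrite mulf_eq0 subr_eq0 (negPf nreal) orbF addr_eq0 => /eqP ->.
  by rewrite mulNr.
have c1 : a0%:C = w%:C * (rho * rho^*).
  have : pA.[rho] = 0 by [].
  rewrite pAE b1 => /eqP; rewrite -addrA addr_eq0 => /eqP ->; ring.
have fA : pA = w%:C *: (('X - rho%:P) * ('X - rho^*%:P)).
  rewrite /pA b1 c1 -!mul_polyC !(polyCM, polyCD, polyCN); ring.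
clearbody pA.
(* Isolating the square root and squaring gives a polynomial identity, valid at all real points and
   hence everywhere. *)
have sq : (V * Q - 2%:P * pA * K) ^+ 2 = (4 * s ^+ 2)%:P * (pA * K ^+ 2).
  apply/eqP; rewrite -subr_eq0; apply/eqP/real_roots_poly0 => u.
  rewrite !(hornerD, hornerN, hornerM, horner_exp, hornerC) pAR h.
  have := rsqrt_sqr (ltW (A0 u)); move: (rsqrt (A u)) => y <-; ring.
have K0 : K = 0.
  apply/eqP/negPn/negP => K0.
  have n4 : (4 * s ^+ 2)%:P != 0 :> {poly C}.
    by rewrite polyC_eq0 mulf_neq0 ?expf_neq0 ?pnatr_eq0.
  have pA0 : pA != 0 by rewrite -size_poly_eq0 szA.
  have X0 (t : C) : 'X - t%:P != 0 by rewrite polyXsubC_eq0.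
  have L0 : V * Q - 2%:P * pA * K != 0.
    have : (V * Q - 2%:P * pA * K) ^+ 2 != 0 by rewrite sq !mulf_neq0 ?expf_neq0.
    by rewrite expf_eq0.
  have mA : mup rho pA = 1%N.
    rewrite fA -mul_polyC mupMr ?rootC // mupM //.
    by rewrite (mup_XsubCX 1) eqxx (mup_XsubCX 1) (negPf nreal).
  have m2 p : p != 0 -> mup rho (p ^+ 2) = (mup rho p).*2.
    by move=> p0; rewrite expr2 mupM // addnn.
  (* The multiplicity of [rho] is even on the left and odd on the right, where the simple root of
     [pA] adds 1. *)
  have : mup rho ((V * Q - 2%:P * pA * K) ^+ 2) = mup rho ((4 * s ^+ 2)%:P * (pA * K ^+ 2)).
    by rewrite sq.
  rewrite m2 // mupMr ?rootC; last by rewrite polyC_eq0 in n4.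
  rewrite mupM ?expf_neq0 // mA m2 // => /(congr1 odd).
  by rewrite odd_double /= odd_double.
have : V * Q = 0 by apply: real_roots_poly0 => u; rewrite hornerM h K0 horner0 mulr0.
by move/eqP; rewrite mulf_eq0 (negPf Q0) orbF => /eqP.
Qed.

End Crux.

(** * Hermitian metrics *)

Section SolveLinear.
Variables (R : realType) (n : nat).
Local Notation C := R[i].
Variables (G : 'M[C]_n) (v : 'rV[C]_n) (r : 'I_n -> C).
Hypothesis Gu : G \in unitmx.

Lemma sum_delta (f : 'I_n -> C) m : \sum_j (1%:M : 'M[C]_n) j m * f j = f m.
Proof.
rewrite (bigD1 m) //= big1 ?addr0 ?mxE ?eqxx ?mul1r // => j jm.
by rewrite mxE (negPf jm) mul0r.
Qed.

(** Returns from the solved form, written with the inverse of g, to the lowered equation. *)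
Lemma solve_row : (forall i, v 0 i = \sum_m invmx G m i * r m) ->
  forall m, \sum_i v 0 i * G i m = r m.
Proof.
move=> h m; under eq_bigr do rewrite h mulr_suml.
rewrite exchange_big /= -[RHS](sum_delta r); apply: eq_bigr => j _.
have /matrixP/(_ j m) <- := mulVmx Gu.
by rewrite mxE mulr_suml; apply: eq_bigr => i _; ring.
Qed.

Lemma solve_row_conj : (forall i, (v 0 i)^* = \sum_m (invmx G m i)^* * r m) ->
  forall m, \sum_i (v 0 i)^* * (G i m)^* = r m.
Proof.
move=> h m; under eq_bigr do rewrite h mulr_suml.
rewrite exchange_big /= -[RHS](sum_delta r); apply: eq_bigr => j _.
have -> : (1%:M : 'M[C]_n) j m = ((1%:M : 'M[C]_n) j m)^*.
  by rewrite mxE conj_nat.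
have /matrixP/(_ j m) <- := mulVmx Gu.
by rewrite mxE conj_sum mulr_suml; apply: eq_bigr => i _; rewrite conjM; ring.
Qed.

End SolveLinear.

Section DglDiagonal.
Variable R : realType.
Local Notation C := R[i].
Implicit Types A l : C.

(** The factor comes from (sqrt A + sqrt A)^2 = 4 A; the quarter in [Q] below compensates for it. *)
Lemma dgl_diag A l A1 l1 : 0 < A -> dgl A A l l A1 A1 l1 l1 = 4 * l1.
Proof.
move=> A0; have := rsqrt_neq0 A0; rewrite /dgl; move: (rsqrt A) => x x0.
by field.
Qed.

Lemma gl_diag A l : 0 < A -> gl A A l l = 4 * l.
Proof.
move=> A0; have := rsqrt_neq0 A0; rewrite /gl; move: (rsqrt A) => x x0.
by field.
Qed.

End DglDiagonal.

Section HermitianMetric.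
Variables (R : realType) (n : nat).
Local Notation C := R[i].
Local Notation Cn := 'rV[C]_n.
Local Notation Re := (@complex.Re R).
Local Notation Im := (@complex.Im R).
Variables (H : Cn -> 'M[C]_n) (D : Cn -> Prop).
Implicit Types (eta z : Cn) (i j k m : 'I_n).

Record herm_field : Prop := HermField {
  hf_near : forall k z, D z -> near_coord k z D;
  hf_diff : forall k z i j, D z -> wdiff k (fun w => H w i j) z;
  hf_selfadj : forall z, D z -> selfadj (H z);
  hf_pos : forall z eta, D z -> eta != 0 -> 0 < hform (H z) eta eta }.

Hypothesis hf : herm_field.

Definition herm_fin z eta : R := hnorm (H z) eta.

(* Halving both roots makes the square norm of [H] an instance of the
   sum-of-roots metrics. *)
Let Q z : 'M[C]_n := 4^-1 *: H z.

Lemma herm_fin_sum_roots : herm_fin = sum_roots Q Q.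
Proof.
apply/funext => z; apply/funext => eta; rewrite /herm_fin /hnorm /sum_roots hformZm.
set h := hform _ _ _.
have -> : Re (4^-1 * h) = 2^-1 ^+ 2 * Re h.
  have -> : 4^-1 = (2^-1 ^+ 2)%:C :> C.
    by rewrite rmorphXn fmorphV rmorph_nat; field.
  exact: cReMl.
rewrite sqrtrM ?sqr_ge0 // sqrtr_sqr ger0_norm ?invr_ge0 ?ler0n //.
by field.
Qed.

Let q0 : 4^-1 != 0 :> C. Proof. by rewrite invr_neq0 ?pnatr_eq0. Qed.
Let qpos : 0 < 4^-1 :> C. Proof. by rewrite invr_gt0 ltr0n. Qed.
Let four (x : C) : 4 * (4^-1 * x) = x.
Proof. by rewrite mulrA mulfV ?mul1r ?pnatr_eq0. Qed.

Lemma wdiff_quarter k z i j : D z -> wdiff k (fun w => Q w i j) z.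
Proof.
move=> Dz; rewrite (_ : (fun w => _) = (fun w => 4^-1 * H w i j)).
  by apply: wdiffM; [exact: wdiff_cst | exact: hf_diff].
by apply/funext => w; rewrite mxE.
Qed.

Lemma dzM_quarter k z : D z -> dzM k Q z = 4^-1 *: dzM k H z.
Proof.
move=> Dz; apply/matrixP => i j; rewrite !mxE.
rewrite (_ : (fun w => _) = (fun w => 4^-1 * H w i j)).
  exact: wirt_dz (wirtZ _ (hf_diff hf k i j Dz)).
by apply/funext => w; rewrite mxE.
Qed.

Lemma herm_form_pair : form_pair Q Q D.
Proof.
have sa z : D z -> selfadj (Q z).
  move=> Dz i j; rewrite !mxE conjM conjV conj_nat.
  by rewrite (hf_selfadj hf Dz i j).
have pos z eta : D z -> eta != 0 -> 0 < hform (Q z) eta eta.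
  by move=> Dz e0; rewrite hformZm pmulr_rgt0 ?(hf_pos hf).
split => //; first exact: (hf_near hf).
- by move=> *; exact: wdiff_quarter.
- by move=> *; exact: wdiff_quarter.
- move=> z eta Dz; have [->|e0] := eqVneq eta 0; first by rewrite hform0l.
  exact/ltW/pos.
Qed.

Section AtPoint.
Variables (z eta : Cn).
Hypotheses (Dz : D z) (e0 : eta != 0).

Lemma herm_regular : regular Q D z eta.
Proof. by split=> //; rewrite hformZm mulf_neq0 // lt0r_neq0 // (hf_pos hf). Qed.

Let A0 : 0 < hform (Q z) eta eta.
Proof. by rewrite hformZm pmulr_rgt0 ?(hf_pos hf). Qed.

Lemma herm_gmx : gmx Q Q z eta = H z.
Proof. by apply/matrixP => i j; rewrite mxE /gfin dgl_diag // mxE four. Qed.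

Lemma herm_fundamental : fundamental herm_fin z eta = H z.
Proof.
by rewrite herm_fin_sum_roots (fundamentalE herm_form_pair herm_regular) -/(gmx _ _ _ _) herm_gmx.
Qed.

Lemma herm_unit : H z \in unitmx.
Proof. by rewrite -herm_gmx; exact: (gfin_unit herm_form_pair herm_regular). Qed.

Lemma herm_sprayE i : 2 * spray herm_fin i z eta =
  \sum_m invmx (H z) m i * \sum_j eta 0 j * lowr (dzM j H z) eta m.
Proof.
rewrite herm_fin_sum_roots (sprayE herm_form_pair _ herm_regular) herm_gmx.
apply: eq_bigr => m _; congr (_ * _); apply: eq_bigr => j _; congr (_ * _).
by rewrite /dlbar dgl_diag // dzM_quarter // lowrZm four.
Qed.

Definition theta_herm_low z' eta' m : C :=
  hform (dzM m H z') eta' eta' - \sum_j eta' 0 j * lowl (dzM j H z') eta' m.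

Lemma herm_theta_starE i : (theta_star herm_fin i z eta)^* =
  \sum_m (invmx (H z) m i)^* * theta_herm_low z eta m.
Proof.
rewrite herm_fin_sum_roots (theta_starE herm_form_pair _ herm_regular) herm_gmx.
apply: eq_bigr => m _; congr (_ * _); rewrite /theta_low.
(* The holomorphic Hessian of a Hermitian form vanishes, so the spray drops out of theta. *)
rewrite [X in _ + X]big1 ?addr0; last first.
  by move=> p _; rewrite /hess dgl_diag // mulr0 mul0r.
rewrite /dsqr gl_diag // dzM_quarter // hformZm four; congr (_ - _).
apply: eq_bigr => j _; congr (_ * _).
by rewrite /dlfin dgl_diag // dzM_quarter // lowlZm four.
Qed.

(** The vector N^i_j eta^j; doubling the spray clears the halves from the lowered equations. *)
Definition spray2 (F : Cn -> Cn -> R) z' eta' : Cn := \row_i (2 * spray F i z' eta').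
Definition theta_row (F : Cn -> Cn -> R) z' eta' : Cn := \row_i theta_star F i z' eta'.

Lemma lowr_herm_spray m :
  lowr (H z) (spray2 herm_fin z eta) m = \sum_j eta 0 j * lowr (dzM j H z) eta m.
Proof.
rewrite -[RHS](solve_row (v := spray2 herm_fin z eta)
  (r := fun m => \sum_j eta 0 j * lowr (dzM j H z) eta m) herm_unit).
  by apply: eq_bigr => i _; rewrite mulrC.
by move=> i; rewrite mxE; exact: herm_sprayE.
Qed.

Lemma lowl_herm_theta m :
  lowl (H z) (theta_row herm_fin z eta) m = theta_herm_low z eta m.
Proof.
rewrite -[RHS](solve_row_conj (v := theta_row herm_fin z eta)
  (r := theta_herm_low z eta) herm_unit).
  by apply: eq_bigr => i _; rewrite mulrC -(hf_selfadj hf Dz).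
by move=> i; rewrite mxE; exact: herm_theta_starE.
Qed.

End AtPoint.

End HermitianMetric.

(** * Pointwise consequences of the projective relation *)

Section PointwiseBalance.
Variables (R : realType) (n : nat).
Local Notation C := R[i].
Local Notation Cn := 'rV[C]_n.
Variables (a c : 'M[C]_n) (da dc : 'I_n -> 'M[C]_n) (eta : Cn).
Local Notation A := (hform a eta eta).
Local Notation S := (hform c eta eta).
Hypotheses (A0 : 0 < A) (S0 : 0 < S).
Hypotheses (ha : selfadj a) (hc : selfadj c).
Implicit Types (m i j : 'I_n).

(** [dgl] is linear in its last four arguments, so the contributions of the first form cancel. *)
Lemma dgl_balance (x y l m P1 P2 P3 P4 Q1 Q2 Q3 Q4 L : C) :
  dgl x y l m P1 P2 P3 P4 + L * gl x y l m = dgl x y l m Q1 Q2 Q3 Q4 ->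
  P1 = Q1 -> P3 = Q3 ->
  L * gl x y l m = dgl x y l m 0 (Q2 - P2) 0 (Q4 - P4).
Proof.
move=> h e1 e3; have -> : L * gl x y l m =
  dgl x y l m Q1 Q2 Q3 Q4 - dgl x y l m P1 P2 P3 P4 by rewrite -h; ring.
by rewrite e1 e3 /dgl; ring.
Qed.

Lemma sum_lowl_mx (H : 'M[C]_n) (v : Cn) m : \sum_i v 0 i * H i m = lowr H v m.
Proof. by apply: eq_bigr => i _; rewrite mulrC. Qed.

Lemma sum_lowr_mx (H : 'M[C]_n) (v : Cn) m : \sum_i (v 0 i)^* * H m i = lowl H v m.
Proof. by apply: eq_bigr => i _; rewrite mulrC. Qed.

Lemma sum_lowr_exchange (d : 'I_n -> 'M[C]_n) (v : Cn) :
  \sum_m (v 0 m)^* * (\sum_j eta 0 j * lowr (d j) eta m)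
  = \sum_j eta 0 j * hform (d j) eta v.
Proof.
under eq_bigr do rewrite mulr_sumr.
rewrite exchange_big /=; apply: eq_bigr => j _; rewrite hform_lowr mulr_sumr.
by apply: eq_bigr => m _; ring.
Qed.

Lemma sum_lowl_exchange (d : 'I_n -> 'M[C]_n) (v : Cn) :
  \sum_m v 0 m * (\sum_j eta 0 j * lowl (d j) eta m)
  = \sum_j eta 0 j * hform (d j) v eta.
Proof.
under eq_bigr do rewrite mulr_sumr.
rewrite exchange_big /=; apply: eq_bigr => j _; rewrite hform_lowl mulr_sumr.
by apply: eq_bigr => m _; ring.
Qed.

Section Spray.
Variables (G : Cn) (L : C).
Hypothesis Ga : forall m, lowr a G m = \sum_j eta 0 j * lowr (da j) eta m.

(** How far the doubled spray of [a] is from satisfying the lowered spray equation of [c];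
    [spray_defect_sum] is the contraction with conj eta. *)
Definition spray_defect m : C := \sum_j eta 0 j * lowr (dc j) eta m - lowr c G m.
Definition spray_defect_sum : C :=
  \sum_j eta 0 j * hform (dc j) eta eta - hform c G eta.

Lemma spray_defectE (v : Cn) : \sum_m (v 0 m)^* * spray_defect m =
  \sum_j eta 0 j * hform (dc j) eta v - hform c G v.
Proof.
rewrite -sum_lowr_exchange hform_lowr -sumrB; apply: eq_bigr => m _.
by rewrite mulrBr.
Qed.

Hypothesis sprayF : forall m, \sum_i (G + L *: eta) 0 i *
    dgl A S (lowr a eta m) (lowr c eta m) (lowl a eta i) (lowl c eta i) (a i m) (c i m)
  = \sum_j eta 0 j * dgl A S (lowr a eta m) (lowr c eta m)
     (hform (da j) eta eta) (hform (dc j) eta eta)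
     (lowr (da j) eta m) (lowr (dc j) eta m).

(** In the lowered spray equation of F, the multiple [L *: eta] contributes [L * gl] by Euler's
    relation, and the parts from [a] cancel since [G] is the doubled spray of [a]. *)
Lemma balance_spray m : L * gl A S (lowr a eta m) (lowr c eta m) =
  dgl A S (lowr a eta m) (lowr c eta m) 0 spray_defect_sum 0 (spray_defect m).
Proof.
have := sprayF m; rewrite !dgl_sum !sum_lowl_mx -!hform_lowl.
rewrite !hformDl !hformZl !lowrD !lowrZ.
have e : hform a G eta = \sum_j eta 0 j * hform (da j) eta eta.
  by rewrite -sum_lowr_exchange hform_lowr; apply: eq_bigr => i _; rewrite Ga.
move=> h; apply: dgl_balance; [|exact: e|exact: Ga].
rewrite -h -(dgl_euler_hol A0 S0 (lowr a eta m) (lowr c eta m)) /dgl; ring.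
Qed.

Lemma spray_defect_kernel (k : Cn) : (forall j, lowr c k j = 0) ->
  spray_defect_sum * hform a eta k =
  2 * (A + rsqrt A * rsqrt S) * (\sum_m (k 0 m)^* * spray_defect m).
Proof.
move=> ck; rewrite (hform_lowr a).
apply: (balance_kernel A0 S0 balance_spray (e := fun m => (eta 0 m)^*)); rewrite -?hform_lowr //.
  by rewrite spray_defectE.
rewrite -conj_hform // hform_lowr big1 ?conjC0 // => j _.
by rewrite ck mulr0.
Qed.

Lemma spray_defect_trivial : spray_defect_sum = 0 ->
  L = 0 /\ forall m, spray_defect m = 0.
Proof.
apply: (balance_trivial A0 S0 balance_spray (e := fun m => (eta 0 m)^*)); rewrite -?hform_lowr //.
by rewrite spray_defectE.
Qed.

End Spray.

Section Theta.
Variables (G T : Cn) (L : C).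
Hypothesis Ga : forall m, lowr a G m = \sum_j eta 0 j * lowr (da j) eta m.
Hypothesis Gc : forall m, lowr c G m = \sum_j eta 0 j * lowr (dc j) eta m.

(** The right side of the lowered theta equation of a Hermitian form with z derivatives [d]; it
    agrees with [theta_herm_low]. *)
Definition tlow (d : 'I_n -> 'M[C]_n) m : C :=
  hform (d m) eta eta - \sum_j eta 0 j * lowl (d j) eta m.

Hypothesis Ta : forall m, lowl a T m = tlow da m.

Definition theta_defect m : C := lowl c T m - tlow dc m.

Lemma tlow_eta d : \sum_m eta 0 m * tlow d m = 0.
Proof.
under eq_bigr do rewrite mulrBr.
by rewrite sumrB sum_lowl_exchange subrr.
Qed.

(** Because [G] satisfies the lowered spray equations of both forms, the terms with derivatives of A
    and S in the second slot cancel, and the lowered theta of F becomes the [gl] combination of the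
    two Hermitian ones. *)
Lemma theta_lowE m :
  gl A S (hform (da m) eta eta) (hform (dc m) eta eta)
  - \sum_j eta 0 j * dgl A S (lowl a eta m) (lowl c eta m)
       (hform (da j) eta eta) (hform (dc j) eta eta)
       (lowl (da j) eta m) (lowl (dc j) eta m)
  + \sum_p dgl A S (lowl a eta p) (lowl c eta p) (lowl a eta m) (lowl c eta m) 0 0 * G 0 p
  = gl A S (tlow da m) (tlow dc m).
Proof.
under [X in _ + X]eq_bigr do rewrite mulrC dgl_sym.
rewrite !dgl_sum -!hform_lowl.
have ea : hform a G eta = \sum_j eta 0 j * hform (da j) eta eta.
  by rewrite -sum_lowr_exchange hform_lowr; apply: eq_bigr => i _; rewrite Ga.
have ec : hform c G eta = \sum_j eta 0 j * hform (dc j) eta eta.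
  by rewrite -sum_lowr_exchange hform_lowr; apply: eq_bigr => i _; rewrite Gc.
have z0 : \sum_i G 0 i * 0 = 0 by apply: big1 => i _; exact: mulr0.
rewrite ea ec !z0 /tlow /gl /dgl; ring.
Qed.

Hypothesis thetaF : forall m, \sum_i ((T + L *: eta) 0 i)^* *
    dgl A S (lowl a eta m) (lowl c eta m) (lowr a eta i) (lowr c eta i) (a m i) (c m i)
  = gl A S (tlow da m) (tlow dc m).

(** Counterpart of [balance_spray]. Theta enters conjugated, and the defect has the opposite sign.
    Since [tlow] annihilates [eta], the slot of [a] is empty and that of [c] is [hform c eta T]. *)
Lemma balance_theta m : - L^* * gl A S (lowl a eta m) (lowl c eta m) =
  dgl A S (lowl a eta m) (lowl c eta m) 0 (hform c eta T) 0 (theta_defect m).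
Proof.
have := thetaF m; rewrite dgl_sum -!hform_lowr !sum_lowr_mx.
rewrite !hformDr !hformZr !lowlD !lowlZ Ta.
have -> : hform a eta T = 0.
  by rewrite hform_lowl -[RHS](tlow_eta da); apply: eq_bigr => i _; rewrite Ta.
move=> h; rewrite /theta_defect.
have -> : - L^* * gl A S (lowl a eta m) (lowl c eta m) =
   - dgl A S (lowl a eta m) (lowl c eta m) (L^* * A) (L^* * S)
     (L^* * lowl a eta m) (L^* * lowl c eta m).
  by rewrite -(dgl_euler_hol A0 S0 (lowl a eta m) (lowl c eta m)) /dgl; ring.
transitivity (dgl A S (lowl a eta m) (lowl c eta m) (0 + L^* * A)
      (hform c eta T + L^* * S) (tlow da m + L^* * lowl a eta m)
      (lowl c T m + L^* * lowl c eta m) - gl A S (tlow da m) (tlow dc m)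
   - dgl A S (lowl a eta m) (lowl c eta m) (L^* * A) (L^* * S)
     (L^* * lowl a eta m) (L^* * lowl c eta m)).
  by rewrite h; ring.
by rewrite /dgl /gl; ring.
Qed.

Let eT : \sum_m eta 0 m * theta_defect m = hform c eta T.
Proof.
under eq_bigr do rewrite mulrBr.
by rewrite sumrB tlow_eta subr0 -hform_lowl.
Qed.

Lemma theta_defect_kernel (k : Cn) : (forall j, lowr c k j = 0) ->
  hform c eta T * hform a k eta =
  2 * (A + rsqrt A * rsqrt S) * (\sum_m k 0 m * theta_defect m).
Proof.
move=> ck; rewrite (hform_lowl a).
apply: (balance_kernel A0 S0 balance_theta (e := fun m => eta 0 m)); rewrite -?hform_lowl //.
by rewrite hform_lowr big1 // => j _; rewrite ck mulr0.
Qed.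

Lemma theta_defect_trivial : hform c eta T = 0 ->
  L = 0 /\ forall m, lowl c T m = tlow dc m.
Proof.
have el : \sum_m eta 0 m * lowl a eta m = A by rewrite -hform_lowl.
have ec : \sum_m eta 0 m * lowl c eta m = S by rewrite -hform_lowl.
move=> h0; have [/eqP L0 h] := balance_trivial A0 S0 balance_theta el ec eT h0.
split; first by apply/eqP; rewrite -(conjC_eq0 L) -oppr_eq0.
by move=> m; apply/eqP; rewrite -subr_eq0; apply/eqP/h.
Qed.

End Theta.

End PointwiseBalance.

(** * Restriction to a real line *)

Section LineArgument.
Variables (R : realType) (n : nat).
Local Notation C := R[i].
Local Notation Cn := 'rV[C]_n.
Local Notation Re := (@complex.Re R).
Local Notation Im := (@complex.Im R).
Variables (a : 'M[C]_n) (eta k : Cn).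
Hypotheses (ha : selfadj a) (pa : forall x, x != 0 -> 0 < hform a x x).
Hypotheses (k0 : k != 0) (ek0 : forall u : R, eta + u%:C *: k != 0).

Local Notation line u := (eta + u%:C *: k).

Lemma hform_line (u : R) : hform a (line u) (line u) =
  (Re (hform a eta eta) + 2 * Re (hform a eta k) * u + Re (hform a k k) * u ^+ 2)%:C.
Proof.
rewrite !(hformDl, hformDr, hformZl, hformZr) conj_real -(conj_hform eta k ha).
have ea := RRe_real0 (Im_hform eta ha); have ek := RRe_real0 (Im_hform k ha).
have e2 : hform a eta k + (hform a eta k)^* = (2 * Re (hform a eta k))%:C.
  rewrite rmorphM rmorph_nat; apply: complex_ext.
    by rewrite cReD cRe_conj mulrC cReMl [Re 2]/=; lra.
  by rewrite cImD cIm_conj mulrC cImMl [Im 2]/=; lra.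
transitivity (hform a eta eta + (hform a eta k + (hform a eta k)^*) * u%:C
  + hform a k k * (u%:C * u%:C)); first by ring.
by rewrite e2 -[in LHS]ea -[in LHS]ek -!rmorphM -!rmorphD expr2.
Qed.

(** Distinct values at 0 and 1 certify that [Qf] is not the zero polynomial; in the applications it
    is affine in [u] with slope [hform a k k]. *)
Lemma line_argument (s : C) (Vf Kf Qf : R -> C) : s != 0 ->
  polyfun Vf -> polyfun Kf -> polyfun Qf -> Qf 1 != Qf 0 ->
  (forall u, Vf u * Qf u =
     2 * (hform a (line u) (line u) + rsqrt (hform a (line u) (line u)) * s) * Kf u) ->
  forall u, Vf u = 0.
Proof.
move=> s0 [V hV] [K hK] [Q hQ] q10 h.
have w0 : 0 < Re (hform a k k) by have := pa k0; rewrite ltcE => /andP[].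
suff V0 : V = 0 by move=> u; rewrite hV V0 horner0.
apply: (@sqrt_quadratic_irrational R (Re (hform a eta eta))
  (2 * Re (hform a eta k)) _ s V Q K w0) => //.
- by move=> u; rewrite -hform_line pa.
- by apply: contraNneq q10 => Q0; rewrite !hQ Q0 !horner0.
- by move=> u; rewrite -hform_line -hV -hQ -hK.
Qed.

Lemma polyfun_line j : polyfun (fun u => (line u) 0 j).
Proof.
have [p hp] := polyfunD (polyfun_cst (eta 0 j)) (polyfunM (polyfun_id R) (polyfun_cst (k 0 j))).
by exists p => u; rewrite -hp !mxE.
Qed.

Lemma polyfun_line_conj j : polyfun (fun u => ((line u) 0 j)^*).
Proof.
have [p hp] := polyfunD (polyfun_cst (eta 0 j)^*) (polyfunM (polyfun_id R) (polyfun_cst (k 0 j)^*)).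
by exists p => u; rewrite -hp !mxE conjD conjM conj_real.
Qed.

Lemma polyfun_lowl (H : 'M[C]_n) i : polyfun (fun u => lowl H (line u) i).
Proof.
by apply: polyfun_sum => j; apply: polyfunM (polyfun_cst _) (polyfun_line_conj j).
Qed.

Lemma polyfun_lowr (H : 'M[C]_n) j : polyfun (fun u => lowr H (line u) j).
Proof.
by apply: polyfun_sum => i; apply: polyfunM (polyfun_cst _) (polyfun_line i).
Qed.

Lemma polyfun_hform (H : 'M[C]_n) : polyfun (fun u => hform H (line u) (line u)).
Proof.
apply: polyfun_sum => i; apply: polyfun_sum => j.
exact: polyfunM (polyfunM (polyfun_cst _) (polyfun_line i)) (polyfun_line_conj j).
Qed.

End LineArgument.

(** * From proportional differences to equality of sprays and of thetas *)

Section ProjectiveConsequences.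
Variables (R : realType) (n : nat).
Local Notation C := R[i].
Local Notation Cn := 'rV[C]_n.
Variables (a c : Cn -> 'M[C]_n) (D : Cn -> Prop).
Implicit Types (eta z : Cn) (i j k m : 'I_n).
Hypothesis fp : form_pair a c D.
Hypothesis ker : forall z, D z -> exists2 k : Cn, k != 0 & forall j, lowr (c z) k j = 0.

Local Notation F := (sum_roots a c).
Local Notation Fa := (herm_fin a).

Lemma form_pair_herm : herm_field a D.
Proof.
split; [exact: (fp_near fp)|exact: (fp_da fp)|exact: (fp_ha fp)|exact: (fp_a0 fp)].
Qed.

Let hf := form_pair_herm.

Section Line.
Variables (z eta k : Cn).
Hypotheses (r : regular c D z eta) (k0 : k != 0) (ck : forall j, lowr (c z) k j = 0).
Local Notation line u := (eta + u%:C *: k).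

Let Dz := proj1 r.

Lemma hform_kernel_line (u : R) : hform (c z) (line u) (line u) = hform (c z) eta eta.
Proof.
have ckx x : hform (c z) k x = 0.
  by rewrite hform_lowr big1 // => j _; rewrite ck mulr0.
have xck x : hform (c z) x k = 0 by rewrite -(conj_hform _ _ (fp_hc fp Dz)) ckx conjC0.
by rewrite !(hformDl, hformDr, hformZl, hformZr) !ckx !xck !mulr0 !addr0.
Qed.

Lemma regular_line u : regular c D z (line u).
Proof. by split; [exact: Dz | rewrite hform_kernel_line; case: r]. Qed.

End Line.

Lemma gfin_spray z eta m : regular c D z eta ->
  \sum_i (spray2 F z eta) 0 i * gfin a c z eta i m =
  \sum_j eta 0 j * dlbar a c z eta m j.
Proof.
move=> r.
have := solve_row (v := spray2 F z eta)
  (r := fun m => \sum_j eta 0 j * dlbar a c z eta m j) (gfin_unit fp r) _ m.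
move=> <-; first by apply: eq_bigr => i _; rewrite [in RHS]mxE.
by move=> i; rewrite mxE; exact: (sprayE fp i r).
Qed.

Lemma gfin_theta z eta m : regular c D z eta ->
  \sum_i ((theta_row F z eta) 0 i)^* * (gfin a c z eta i m)^* = theta_low a c z eta m.
Proof.
move=> r.
have := solve_row_conj (v := theta_row F z eta)
  (r := theta_low a c z eta) (gfin_unit fp r) _ m.
move=> <-; first by apply: eq_bigr => i _; rewrite [in RHS]mxE.
by move=> i; rewrite mxE; exact: (theta_starE fp i r).
Qed.

Hypothesis spray_rel : forall z eta, regular c D z eta ->
  exists L : C, spray2 F z eta = spray2 Fa z eta + L *: eta.

Lemma spray_defect_zero z eta : regular c D z eta ->
  spray2 F z eta = spray2 Fa z eta /\
  forall m, lowr (c z) (spray2 Fa z eta) m = \sum_j eta 0 j * lowr (dzM j c z) eta m.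
Proof.
move=> r; have Dz := proj1 r; have [k k0 ck] := ker Dz.
have ha := fp_ha fp Dz; have hc := fp_hc fp Dz.
have Gaf x : x != 0 -> forall m, lowr (a z) (spray2 Fa z x) m =
    \sum_j x 0 j * lowr (dzM j a z) x m.
  by move=> x0 m; exact: (lowr_herm_spray hf Dz x0).
have bal x L : regular c D z x -> spray2 F z x = spray2 Fa z x + L *: x ->
    forall m, \sum_i (spray2 Fa z x + L *: x) 0 i * dgl (hform (a z) x x) (hform (c z) x x)
      (lowr (a z) x m) (lowr (c z) x m) (lowl (a z) x i) (lowl (c z) x i) (a z i m) (c z i m)
    = \sum_j x 0 j * dgl (hform (a z) x x) (hform (c z) x x) (lowr (a z) x m) (lowr (c z) x m)
     (hform (dzM j a z) x x) (hform (dzM j c z) x x)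
     (lowr (dzM j a z) x m) (lowr (dzM j c z) x m).
  by move=> rx e m; rewrite -e; exact: gfin_spray.
pose V u := spray_defect_sum (c z) (fun j => dzM j c z) (eta + u%:C *: k)
   (spray2 Fa z (eta + u%:C *: k)).
have V0 : forall u, V u = 0.
  pose Kf u := \sum_m (k 0 m)^* * spray_defect (c z) (fun j => dzM j c z)
     (eta + u%:C *: k) (spray2 Fa z (eta + u%:C *: k)) m.
  (* The inverse of [a z] is constant along the line, so the spray of [a] is polynomial in [u]. *)
  have pG i : polyfun (fun u : R => spray2 Fa z (eta + u%:C *: k) 0 i).
    have [p hp] : polyfun (fun u : R => \sum_m invmx (a z) m i *
       \sum_j (eta + u%:C *: k) 0 j * lowr (dzM j a z) (eta + u%:C *: k) m).
      apply: polyfun_sum => m; apply: polyfunM (polyfun_cst _) _.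
      by apply: polyfun_sum => j; apply: polyfunM (polyfun_line _ _ _) (polyfun_lowr _ _ _ _).
    exists p => u; rewrite -hp mxE.
    exact: (herm_sprayE hf Dz (regular_neq0 (regular_line r ck u))).
  apply: (@line_argument R n (a z) eta k ha _ k0 _ (rsqrt (hform (c z) eta eta)) V Kf
    (fun u => hform (a z) (eta + u%:C *: k) k)).
  - by move=> x x0; exact: (fp_a0 fp Dz x0).
  - by move=> u; exact: regular_neq0 (regular_line r ck u).
  - exact: rsqrt_neq0 (regular_c fp r).
  - apply: polyfunD.
      by apply: polyfun_sum => j; apply: polyfunM (polyfun_line _ _ _) (polyfun_hform _ _ _).
    apply: polyfunN; apply: polyfun_sum => i; apply: polyfun_sum => j.
    by apply: polyfunM (polyfunM (polyfun_cst _) (pG i)) (polyfun_line_conj _ _ _).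
  - apply: polyfun_sum => m; apply: polyfunM (polyfun_cst _) _; apply: polyfunD.
      by apply: polyfun_sum => j; apply: polyfunM (polyfun_line _ _ _) (polyfun_lowr _ _ _ _).
    apply: polyfunN; apply: polyfun_sum => i.
    by apply: polyfunM (polyfun_cst _) (pG i).
  - apply: polyfun_sum => i; apply: polyfun_sum => j.
    by apply: polyfunM (polyfunM (polyfun_cst _) (polyfun_line _ _ _)) (polyfun_cst _).
  - rewrite !hformDl !hformZl (inj_eq (addrI _)) mul0r mul1r.
    exact: lt0r_neq0 (fp_a0 fp Dz k0).
  - move=> u; have ru := regular_line r ck u.
    have [L hL] := spray_rel ru.
    rewrite -(hform_kernel_line r ck u).
    exact: (spray_defect_kernel (regular_a fp ru) (regular_c fp ru) hc
      (Gaf _ (regular_neq0 ru)) (bal _ _ ru hL) ck).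
have [L hL] := spray_rel r.
have V00 : spray_defect_sum (c z) (fun j => dzM j c z) eta (spray2 Fa z eta) = 0.
  by have := V0 0; rewrite /V scale0r addr0.
have [L0 Z] := spray_defect_trivial (regular_a fp r) (regular_c fp r)
      (Gaf _ (regular_neq0 r)) (bal _ _ r hL) V00.
split; first by rewrite hL L0 scale0r addr0.
by move=> m; apply/esym/eqP; rewrite -subr_eq0; apply/eqP/Z.
Qed.

Hypothesis theta_rel : forall z eta, regular c D z eta ->
  exists L : C, theta_row F z eta = theta_row Fa z eta + L *: eta.

Lemma theta_defect_zero z eta : regular c D z eta ->
  theta_row F z eta = theta_row Fa z eta /\
  forall m, lowl (c z) (theta_row Fa z eta) m = tlow eta (fun j => dzM j c z) m.
Proof.
move=> r; have Dz := proj1 r; have [k k0 ck] := ker Dz.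
have ha := fp_ha fp Dz; have hc := fp_hc fp Dz.
have Taf x : x != 0 -> forall m, lowl (a z) (theta_row Fa z x) m =
    tlow x (fun j => dzM j a z) m.
  by move=> x0 m; exact: (lowl_herm_theta hf Dz x0).
have bal x L : regular c D z x -> theta_row F z x = theta_row Fa z x + L *: x ->
    forall m, \sum_i ((theta_row Fa z x + L *: x) 0 i)^* *
    dgl (hform (a z) x x) (hform (c z) x x) (lowl (a z) x m) (lowl (c z) x m)
      (lowr (a z) x i) (lowr (c z) x i) (a z m i) (c z m i)
    = gl (hform (a z) x x) (hform (c z) x x)
        (tlow x (fun j => dzM j a z) m) (tlow x (fun j => dzM j c z) m).
  move=> rx e m; rewrite -e.
  (* The spray result at [x] gives the lowered spray equation of [c] that [theta_lowE] requires. *)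
  have [sF cG] := spray_defect_zero rx.
  have aG := lowr_herm_spray hf Dz (regular_neq0 rx).
  rewrite -(theta_lowE (da := fun j => dzM j a z) (dc := fun j => dzM j c z) aG cG).
  transitivity (theta_low a c z x m).
    rewrite -(gfin_theta m rx); apply: eq_bigr => i _; congr (_ * _).
    exact/esym/(conj_gfin fp).
  rewrite /theta_low; congr (_ + _); apply: eq_bigr => p _; congr (_ * _).
  by rewrite -sF mxE.
pose V u := hform (c z) (eta + u%:C *: k) (theta_row Fa z (eta + u%:C *: k)).
have V0 : forall u, V u = 0.
  pose Kf u := \sum_m k 0 m * theta_defect (c z) (fun j => dzM j c z)
     (eta + u%:C *: k) (theta_row Fa z (eta + u%:C *: k)) m.
  have plow (d : 'I_n -> 'M[C]_n) m : polyfun (fun u : R => tlow (eta + u%:C *: k) d m).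
    apply: polyfunD (polyfun_hform _ _ _) _; apply: polyfunN.
    by apply: polyfun_sum => j; apply: polyfunM (polyfun_line _ _ _) (polyfun_lowl _ _ _ _).
  have pT i : polyfun (fun u : R => (theta_row Fa z (eta + u%:C *: k) 0 i)^*).
    have [p hp] : polyfun (fun u : R => \sum_m (invmx (a z) m i)^* *
       tlow (eta + u%:C *: k) (fun j => dzM j a z) m).
      by apply: polyfun_sum => m; apply: polyfunM (polyfun_cst _) (plow _ _).
    exists p => u; rewrite -hp mxE.
    exact: (herm_theta_starE hf Dz (regular_neq0 (regular_line r ck u))).
  apply: (@line_argument R n (a z) eta k ha _ k0 _ (rsqrt (hform (c z) eta eta)) V Kf
    (fun u => hform (a z) k (eta + u%:C *: k))).
  - by move=> x x0; exact: (fp_a0 fp Dz x0).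
  - by move=> u; exact: regular_neq0 (regular_line r ck u).
  - exact: rsqrt_neq0 (regular_c fp r).
  - apply: polyfun_sum => i; apply: polyfun_sum => j.
    by apply: polyfunM (polyfunM (polyfun_cst _) (polyfun_line _ _ _)) (pT j).
  - apply: polyfun_sum => m; apply: polyfunM (polyfun_cst _) _; apply: polyfunD.
      by apply: polyfun_sum => j; apply: polyfunM (polyfun_cst _) (pT j).
    exact: polyfunN (plow _ _).
  - apply: polyfun_sum => i; apply: polyfun_sum => j.
    by apply: polyfunM (polyfun_cst _) (polyfun_line_conj _ _ _).
  - rewrite !hformDr !hformZr (inj_eq (addrI _)) !conj_real mul0r mul1r.
    exact: lt0r_neq0 (fp_a0 fp Dz k0).
  - move=> u; have ru := regular_line r ck u.
    have [L hL] := theta_rel ru.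
    rewrite -(hform_kernel_line r ck u).
    exact: (theta_defect_kernel (regular_a fp ru) (regular_c fp ru)
      (Taf _ (regular_neq0 ru)) (bal _ _ ru hL) ck).
have [L hL] := theta_rel r.
have V00 : hform (c z) eta (theta_row Fa z eta) = 0.
  by have := V0 0; rewrite /V scale0r addr0.
have [L0 Z] := theta_defect_trivial (regular_a fp r) (regular_c fp r)
      (Taf _ (regular_neq0 r)) (bal _ _ r hL) V00.
by split; first by rewrite hL L0 scale0r addr0.
Qed.

End ProjectiveConsequences.

(** * Homogeneity, curvature and conformal change *)

Section Homogeneity.
Variables (R : realType) (n : nat).
Local Notation C := R[i].
Local Notation Cn := 'rV[C]_n.
Variables (a c : Cn -> 'M[C]_n) (D : Cn -> Prop).
Implicit Types (eta z : Cn) (i j k m : 'I_n) (H : 'M[C]_n).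
Hypothesis fp : form_pair a c D.
Local Notation F := (sum_roots a c).

Lemma hform_i H eta : hform H ('i *: eta) ('i *: eta) = hform H eta eta.
Proof. by rewrite hformZl hformZr conj_i mulrA mulrN mul_ii opprK mul1r. Qed.

Lemma regular_i z eta : regular c D z eta -> regular c D z ('i *: eta).
Proof. by case=> Dz S0; split=> //; rewrite hform_i. Qed.

Lemma dgl_scale (x y l m A1 S1 l1 m1 e : C) :
  dgl x y (e * l) (e * m) A1 S1 (e * l1) (e * m1) = e * dgl x y l m A1 S1 l1 m1.
Proof. by rewrite /dgl; ring. Qed.

(** Applied with ['i] and [- 'i], the factors that the derivatives in conj eta and in [eta] acquire
    at ['i *: eta]: each term of g contains either one derivative of each kind or a mixed second
    derivative. *)
Lemma dgl_twist (x y l m A1 S1 l1 m1 e f : C) : e * f = 1 ->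
  dgl x y (e * l) (e * m) (f * A1) (f * S1) l1 m1 = dgl x y l m A1 S1 l1 m1.
Proof.
move=> ef; transitivity (e * f * (dgl x y l m A1 S1 l1 m1 - dgl x y l m 0 0 l1 m1)
  + dgl x y l m 0 0 l1 m1); first by rewrite /dgl; ring.
by rewrite ef mul1r subrK.
Qed.

Lemma gmx_i z eta : gmx a c z ('i *: eta) = gmx a c z eta.
Proof.
apply/matrixP => i j; rewrite !mxE /gfin !hform_i !lowrZ !lowlZ conj_i.
by apply: dgl_twist; rewrite mulrN mul_ii opprK.
Qed.

Lemma dgl_lowr_i (H1 H2 K1 K2 : 'M[C]_n) eta m :
  dgl (hform H1 ('i *: eta) ('i *: eta)) (hform H2 ('i *: eta) ('i *: eta))
    (lowr H1 ('i *: eta) m) (lowr H2 ('i *: eta) m)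
    (hform K1 ('i *: eta) ('i *: eta)) (hform K2 ('i *: eta) ('i *: eta))
    (lowr K1 ('i *: eta) m) (lowr K2 ('i *: eta) m) =
  'i * dgl (hform H1 eta eta) (hform H2 eta eta) (lowr H1 eta m) (lowr H2 eta m)
    (hform K1 eta eta) (hform K2 eta eta) (lowr K1 eta m) (lowr K2 eta m).
Proof. by rewrite 4!hform_i 4!lowrZ dgl_scale. Qed.

Lemma dgl_lowl_i (H1 H2 K1 K2 : 'M[C]_n) eta m :
  dgl (hform H1 ('i *: eta) ('i *: eta)) (hform H2 ('i *: eta) ('i *: eta))
    (lowl H1 ('i *: eta) m) (lowl H2 ('i *: eta) m)
    (hform K1 ('i *: eta) ('i *: eta)) (hform K2 ('i *: eta) ('i *: eta))
    (lowl K1 ('i *: eta) m) (lowl K2 ('i *: eta) m) =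
  - 'i * dgl (hform H1 eta eta) (hform H2 eta eta) (lowl H1 eta m) (lowl H2 eta m)
    (hform K1 eta eta) (hform K2 eta eta) (lowl K1 eta m) (lowl K2 eta m).
Proof. by rewrite 4!hform_i 4!lowlZ conj_i dgl_scale. Qed.

Lemma dlbar_i z eta m j : dlbar a c z ('i *: eta) m j = 'i * dlbar a c z eta m j.
Proof. exact: (dgl_lowr_i (a z) (c z) (dzM j a z) (dzM j c z)). Qed.

Lemma dlfin_i z eta m j : dlfin a c z ('i *: eta) m j = - 'i * dlfin a c z eta m j.
Proof. exact: (dgl_lowl_i (a z) (c z) (dzM j a z) (dzM j c z)). Qed.

Lemma gl_i (H1 H2 K1 K2 : 'M[C]_n) eta :
  gl (hform H1 ('i *: eta) ('i *: eta)) (hform H2 ('i *: eta) ('i *: eta))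
    (hform K1 ('i *: eta) ('i *: eta)) (hform K2 ('i *: eta) ('i *: eta)) =
  gl (hform H1 eta eta) (hform H2 eta eta) (hform K1 eta eta) (hform K2 eta eta).
Proof. by rewrite 4!hform_i. Qed.

Lemma dsqr_i z eta m : dsqr a c z ('i *: eta) m = dsqr a c z eta m.
Proof. exact: (gl_i (a z) (c z) (dzM m a z) (dzM m c z)). Qed.

Lemma hess_i z eta p j : hess a c z ('i *: eta) p j = - hess a c z eta p j.
Proof.
rewrite /hess (hform_i (a z)) (hform_i (c z)) !lowlZ conj_i -[RHS]mulN1r -mul_ii.
rewrite -[in LHS](mulr0 (- 'i : C)) dgl_scale dgl_sym.
rewrite -[in LHS](mulr0 (- 'i : C)) dgl_scale dgl_sym.
by rewrite mulrA mulrNN.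
Qed.

Lemma spray2_i z eta : regular c D z eta ->
  spray2 F z ('i *: eta) = - spray2 F z eta.
Proof.
move=> r; apply/rowP => i; rewrite !mxE (sprayE fp i (regular_i r)) (sprayE fp i r) gmx_i.
rewrite -sumrN; apply: eq_bigr => m _; rewrite -mulrN; congr (_ * _).
rewrite -sumrN; apply: eq_bigr => j _; rewrite dlbar_i mxE.
by rewrite mulrACA mul_ii mulN1r.
Qed.

Lemma theta_row_i z eta : regular c D z eta ->
  theta_row F z ('i *: eta) = theta_row F z eta.
Proof.
move=> r; apply/rowP => i; rewrite !mxE; apply: (can_inj (@conj_conj R)).
rewrite (theta_starE fp i (regular_i r)) (theta_starE fp i r) gmx_i.
apply: eq_bigr => m _; congr (_ * _); rewrite /theta_low dsqr_i; congr (_ - _ + _).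
  apply: eq_bigr => j _; rewrite dlfin_i mxE mulrACA mulrN mul_ii opprK mul1r //.
apply: eq_bigr => p _; rewrite hess_i; have /rowP/(_ p) := spray2_i r.
by rewrite !mxE => ->; rewrite mulrNN.
Qed.

End Homogeneity.

Section ProjectiveSplitting.
Variables (R : realType) (n : nat).
Local Notation C := R[i].
Local Notation Cn := 'rV[C]_n.

(* The two relations are the projective relation at [eta] and at ['i *: eta]:
   sprays are homogeneous of bidegree (2, 0) and theta of bidegree (1, 1). *)
Lemma projective_split (G G' T T' eta : Cn) (P Q : C) :
  G' = G + (T' - T) + (2 * P) *: eta ->
  - G' = - G + (T' - T) + (2 * Q) *: ('i *: eta) ->
  (exists L, G' = G + L *: eta) /\ (exists L, T' = T + L *: eta).
Proof.
move=> /rowP e1 /rowP e2.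
have two : (2 : C) != 0 by rewrite pnatr_eq0.
split; [exists (P - Q * 'i) | exists (- (P + Q * 'i))]; apply/rowP => i;
  have := e1 i; have := e2 i; rewrite !mxE => h2 h1; apply: (mulfI two).
- transitivity (G' 0 i - - G' 0 i); first by ring.
  by rewrite [in X in _ - X]h2 [in LHS]h1; ring.
- transitivity (2 * T 0 i + (2 * (T' 0 i - T 0 i) )); first by ring.
  transitivity (2 * T 0 i + ((G' 0 i - G 0 i - 2 * P * eta 0 i)
    + (- G' 0 i + G 0 i - 2 * Q * ('i * eta 0 i)))); last by ring.
  by rewrite [in RHS]h2 [in RHS]h1; ring.
Qed.

End ProjectiveSplitting.

(** * Holomorphic curvature in terms of the spray *)

Section Curvature.
Variables (R : realType) (n : nat).
Local Notation C := R[i].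
Local Notation Cn := 'rV[C]_n.

(** The part of the curvature determined by the spray alone, hence common to metrics whose sprays
    agree near [z]. *)
Definition spray_bar (F : Cn -> Cn -> R) z (eta : Cn) k : C :=
  \sum_l (eta 0 l)^* * dzbar l (fun w => spray F k w eta) z.

Lemma spray_bar_near (F F' : Cn -> Cn -> R) z eta k :
  (forall l, near_coord l z (fun w => spray F k w eta = spray F' k w eta)) ->
  spray_bar F z eta k = spray_bar F' z eta k.
Proof.
move=> h; rewrite /spray_bar; apply: eq_bigr => l _.
apply: (congr1 ( *%R _)).
exact: (dzbar_near (h l)).
Qed.

Lemma hol_curvatureE (F : Cn -> Cn -> R) z eta :
  hol_curvature F z eta = - (4 / (F z eta ^+ 4)%:C) *
  \sum_k (\sum_m (eta 0 m)^* * fundamental F z eta k m) * spray_bar F z eta k.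
Proof.
rewrite /hol_curvature; congr (_ * _); apply: eq_bigr => k _.
rewrite mulr_suml; apply: eq_bigr => m _; rewrite mulr_sumr.
apply: eq_bigr => l _.
by move: (fundamental _ _ _ _ _) (dzbar _ _ _) => u v; ring.
Qed.

Lemma hol_curvature_lowl (F : Cn -> Cn -> R) z eta (g : 'M[C]_n) (s : 'I_n -> C) :
  fundamental F z eta = g -> (forall k, spray_bar F z eta k = s k) ->
  hol_curvature F z eta = - (4 / (F z eta ^+ 4)%:C) * \sum_k lowl g eta k * s k.
Proof.
move=> gE sE; rewrite hol_curvatureE gE; congr (_ * _); apply: eq_bigr => k _.
rewrite sE; congr (_ * _); apply: eq_bigr => m _; exact: mulrC.
Qed.

End Curvature.

(** * Rescaling of a - c by a function *)

Section ConformalFactor.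
Variables (R : realType) (n : nat).
Local Notation C := R[i].
Local Notation Cn := 'rV[C]_n.
Implicit Types (eta z : Cn) (i j k m : 'I_n).
Variables (a c : 'M[C]_n) (E : C) (dE : 'I_n -> C) (da dc dh : 'I_n -> 'M[C]_n).
Variables (h : 'M[C]_n) (eta : Cn).
Hypotheses (hE : h = E *: (a - c)) (E0 : E != 0).
Hypothesis dhE : forall j, dh j = dE j *: (a - c) + E *: (da j - dc j).
Hypothesis hpos : forall x, x != 0 -> hform h x x != 0.

Lemma lowrBm (H K : 'M[C]_n) x i : lowr (H - K) x i = lowr H x i - lowr K x i.
Proof. by rewrite lowrDm -scaleN1r lowrZm mulN1r. Qed.
Lemma lowlBm (H K : 'M[C]_n) x i : lowl (H - K) x i = lowl H x i - lowl K x i.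
Proof. by rewrite lowlDm -scaleN1r lowlZm mulN1r. Qed.
Lemma hformBm (H K : 'M[C]_n) x y : hform (H - K) x y = hform H x y - hform K x y.
Proof. by rewrite hformDm -scaleN1r hformZm mulN1r. Qed.

Lemma lowr_inj x y : (forall m, lowr h x m = lowr h y m) -> x = y.
Proof.
move=> e1; apply/eqP; rewrite -subr_eq0; apply/negPn/negP => /hpos/eqP; apply.
rewrite hform_lowr big1 // => m _.
by rewrite lowrD -scaleN1r lowrZ mulN1r e1 subrr mulr0.
Qed.

Lemma lowl_inj x y : (forall m, lowl h x m = lowl h y m) -> x = y.
Proof.
move=> e1; apply/eqP; rewrite -subr_eq0; apply/negPn/negP => /hpos/eqP; apply.
rewrite hform_lowl big1 // => m _.
by rewrite lowlD -scaleN1r lowlZ conjN conjC1 mulN1r e1 subrr mulr0.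
Qed.

Variables (G T Gh Th : Cn).
Hypothesis Ga : forall m, lowr a G m = \sum_j eta 0 j * lowr (da j) eta m.
Hypothesis Gc : forall m, lowr c G m = \sum_j eta 0 j * lowr (dc j) eta m.
Hypothesis Ta : forall m, lowl a T m = tlow eta da m.
Hypothesis Tc : forall m, lowl c T m = tlow eta dc m.
Hypothesis Ghh : forall m, lowr h Gh m = \sum_j eta 0 j * lowr (dh j) eta m.
Hypothesis Thh : forall m, lowl h Th m = tlow eta dh m.

Lemma conformal_spray : (forall j, dE j = 0) -> Gh = G.
Proof.
move=> dE0; apply: lowr_inj => m; rewrite Ghh hE lowrZm lowrBm Ga Gc -sumrB mulr_sumr.
apply: eq_bigr => j _; rewrite dhE dE0 scale0r add0r lowrZm lowrBm.
by rewrite -mulrBr; ring.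
Qed.

(** By the product rule for h = E (a - c), the gradient of E contributes one term along itself and
    one along the lowering of [eta]; only the first can leave the span of that lowering. *)
Lemma conformal_tlow m : tlow eta dh m =
  dE m * hform (a - c) eta eta - (\sum_j eta 0 j * dE j) * lowl (a - c) eta m
  + lowl h T m.
Proof.
rewrite /tlow dhE (hformDm (dE m *: _)) (hformZm _ (dE m)) (hformZm _ E) (hformBm (da m)).
have -> : \sum_j eta 0 j * lowl (dh j) eta m =
    (\sum_j eta 0 j * dE j) * lowl (a - c) eta m
    + E * (\sum_j eta 0 j * lowl (da j) eta m - \sum_j eta 0 j * lowl (dc j) eta m).
  rewrite -sumrB [E * _]mulr_sumr mulr_suml -big_split; apply: eq_bigr => j _ /=.
  by rewrite dhE (lowlDm (dE j *: _)) (lowlZm _ (dE j)) (lowlZm _ E) (lowlBm (da j)); ring.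
rewrite hE lowlZm (lowlBm a c T) Ta Tc /tlow; ring.
Qed.

Lemma conformal_theta : (forall j, dE j = 0) -> Th = T.
Proof.
move=> dE0; apply: lowl_inj => m; rewrite Thh conformal_tlow dE0 mul0r.
by rewrite big1 ?mul0r ?subrr ?add0r // => j _; rewrite dE0 mulr0.
Qed.

Lemma conformal_gradient L : eta != 0 -> T = Th + L *: eta ->
  exists mu, forall m, dE m = mu * lowl h eta m.
Proof.
move=> eta0 e1.
have h0 := hpos eta0; rewrite hE hformZm mulf_eq0 negb_or in h0; case/andP: h0 => _ h0.
(* Obtained by solving for [dE m]; the last division turns the lowering by [a - c] into the lowering
   by [h]. *)
exists ((\sum_j eta 0 j * dE j - L^* * E) / hform (a - c) eta eta / E) => m.
have := Thh m; rewrite conformal_tlow e1 lowlD lowlZ hE !lowlZm => h1.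
have {}h1 : dE m * hform (a - c) eta eta =
  (\sum_j eta 0 j * dE j - L^* * E) * lowl (a - c) eta m.
  move: h1; set q := (\sum_j _); set t := lowl (a - c) Th m.
  set u := lowl _ _ _; set v := hform _ _ _ => h1.
  transitivity (dE m * v - q * u + (E * t + L^* * (E * u)) - E * t + (q * u - L^* * E * u)).
    by ring.
  by rewrite -h1; ring.
apply: (mulIf h0); rewrite h1; field; by rewrite h0 E0.
Qed.

End ConformalFactor.

Section GradientZero.
Variables (R : realType) (n : nat).
Local Notation C := R[i].
Local Notation Cn := 'rV[C]_n.

(** Lowering by [h] is injective, so one covector would come from multiples of both [eta] and
    [eta + k]. These are independent: [c] annihilates [k] but not [eta]. *)
Lemma gradient_zero (h c : 'M[C]_n) (dE : 'I_n -> C) (eta k : Cn) mu mu' :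
  (forall x, x != 0 -> hform h x x != 0) ->
  hform c eta eta != 0 -> k != 0 -> (forall j, lowr c k j = 0) ->
  (forall m, dE m = mu * lowl h eta m) ->
  (forall m, dE m = mu' * lowl h (eta + k) m) -> forall m, dE m = 0.
Proof.
move=> hpos S0 k0 ck e1 e2.
have e : mu^* *: eta = mu'^* *: (eta + k).
  by apply: (lowl_inj hpos) => m; rewrite !lowlZ !conj_conj -e1 e2.
have hk : hform c k eta = 0 by rewrite hform_lowr big1 // => j _; rewrite ck mulr0.
have mm : mu^* = mu'^*.
  move/(congr1 (fun x => hform c x eta)): e; rewrite !hformZl hformDl hk addr0.
  exact: mulIf.
move/eqP: e; rewrite mm scalerDr -[X in X == _]addr0 (inj_eq (addrI _)) eq_sym scaler_eq0 (negPf k0) orbF.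
rewrite conjC_eq0 => /eqP mu0 m.
by rewrite e2 mu0 mul0r.
Qed.

End GradientZero.

(** * Functions with zero gradient *)

Section LocallyConstant.
Variables (R : realType) (n : nat).
Local Notation C := R[i].
Local Notation Cn := 'rV[C]_n.
Local Notation Re := (@complex.Re R).
Local Notation Im := (@complex.Im R).

Lemma open_box (U : set Cn) z : open U -> U z ->
  exists2 e : R, 0 < e &
    forall y : Cn, (forall j, `|z 0 j - y 0 j| < e%:C) -> U y.
Proof.
move=> oU Uz; have /nbhs_ballP [e /= e0 eU] := open_nbhs_nbhs (conj oU Uz).
have ee : e = (Re e)%:C by apply/esym/RRe_real0; move: e0; rewrite ltcE => /andP[/eqP].
exists (Re e); first by move: e0; rewrite ltcE => /andP[].
move=> y h; apply: eU; split=> // i j; rewrite (ord1 i) ee.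
exact: h.
Qed.

Lemma nbhs_box (z : Cn) (e : R) : 0 < e ->
  nbhs z [set y : Cn | forall j, `|z 0 j - y 0 j| < e%:C].
Proof.
move=> e0; apply/nbhs_ballP; exists e%:C; first by rewrite /= ltcR.
by move=> y [_ h] j; exact: h.
Qed.

Lemma normc_real (r : R) : `|r%:C| = `|r|%:C :> C.
Proof. by rewrite normc_def /= expr0n /= addr0 sqrtr_sqr. Qed.

Lemma near_dir_open (U : set Cn) z v : open U -> U z -> near_dir v z U.
Proof.
move=> oU Uz; have [e e0 eU] := open_box oU Uz.
pose B := \sum_j Re `|v 0 j| + 1.
have vB j : `|v 0 j| <= (Re `|v 0 j|)%:C.
  by rewrite RRe_real0 //; apply: ger0_Im.
have v0 j : 0 <= Re `|v 0 j| by have := normr_ge0 (v 0 j); rewrite lecE => /andP[].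
have B0 : 0 < B by rewrite ltr_wpDl // sumr_ge0.
have d0 : 0 < e / B by rewrite divr_gt0.
have : \forall t \near (0 : R), `|t| < e / B.
  apply/nbhs_ballP; exists (e / B) => //= t.
  by rewrite -ball_normE /= sub0r normrN.
apply: filterS => t tB; apply: eU => j.
rewrite !mxE opprD addrA subrr add0r normrN normrM normc_real.
apply: (@le_lt_trans _ _ (`|t|%:C * (Re `|v 0 j|)%:C)).
  by rewrite ler_wpM2l ?lecR // ler0c.
rewrite -rmorphM ltcR; apply: (@le_lt_trans _ _ (`|t| * B)).
  rewrite ler_wpM2l // /B (bigD1 j) //= -addrA lerDl addr_ge0 //.
  by apply: sumr_ge0 => i _; exact: v0.
by rewrite -ltr_pdivlMr.
Qed.

Lemma near_coord_open (U : set Cn) z k : open U -> U z -> near_coord k z U.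
Proof. by move=> oU Uz; split; exact: near_dir_open. Qed.

Variables (U : set Cn) (g : Cn -> R).
Hypothesis gd : forall z k, U z -> wdiff k (fun w => (g w)%:C) z.
Hypothesis g0 : forall z k, U z -> dz k (fun w => (g w)%:C) z = 0.

(** With [dz] equal to 0 the two real derivatives are q and -i q, where q is the derivative in conj
    z^k. As [g] is real, both are real, so q = 0. *)
Lemma directional_zero z k : U z ->
  is_derive (0 : R) (1 : R) (fun t : R => g (z + t%:C *: delta_mx 0 k) : R^o) 0 /\
  is_derive (0 : R) (1 : R) (fun t : R => g (z + t%:C *: ('i *: delta_mx 0 k)) : R^o) 0.
Proof.
move=> Uz; have [[a1 a2] [b1 b2]] := gd k Uz.
move: a1 a2 b1 b2; rewrite (g0 k Uz) add0r sub0r => a1 a2 b1 b2.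
have real0 r (v : Cn) : is_derive (0 : R) (1 : R) (fun t : R => Im (g (z + t%:C *: v))%:C : R^o) r -> r = 0.
  by case=> _ <-; exact: derive_cst.
have i1 := real0 _ _ a2; have i2 := real0 _ _ b2.
move: a1 b1 i1 i2; set q := dzbar _ _ _ => a1 b1 i1 i2.
have eN : Im (- q) = - Im q /\ Re (- q) = - Re q by case: (q).
have i3 : Re ('i * - q) = 0 by rewrite cReM cRe_i cIm_i eN.1 i1; ring.
have i4 : Re q = 0.
  by have := i2; rewrite cImM cRe_i cIm_i eN.2 mul0r mul1r add0r => /eqP; rewrite oppr_eq0 => /eqP.
by rewrite i3 in b1; rewrite i4 in a1.
Qed.

Lemma constant_on_segment (v z : Cn) (s : R) :
  (forall y, U y -> is_derive (0 : R) (1 : R) (fun t : R => g (y + t%:C *: v) : R^o) 0) ->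
  (forall t : R, 0 <= t <= 1 -> U (z + (t * s)%:C *: v)) ->
  g (z + s%:C *: v) = g z.
Proof.
move=> dv Us.
pose phi (t : R) := g (z + (t * s)%:C *: v).
have dphi (t : R) : 0 <= t <= 1 -> is_derive t (1 : R) phi 0.
  move=> t01; have := dv _ (Us t t01) => h.
  have l : is_derive t (1 : R) (fun r : R => (r - t) * s) s.
    have h1 := is_deriveM (is_deriveB (is_derive_id t (1 : R)) (is_derive_cst (t : R^o) t (1 : R)))
      (is_derive_cst (s : R^o) t (1 : R)).
    by apply: (is_derive_eq h1); rewrite /GRing.scale /= mulr0 add0r subr0 mulr1.
  have h' : is_derive ((fun r : R => (r - t) * s) t) (1 : R)
      (fun r : R => g (z + (t * s)%:C *: v + r%:C *: v)) 0.
    by rewrite /= subrr mul0r.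
  have := @is_derive1_comp R _ (fun r : R => (r - t) * s) t _ _ h' l; rewrite mul0r.
  have -> // : (fun r : R => g (z + (t * s)%:C *: v + r%:C *: v)) \o (fun r : R => (r - t) * s) = phi.
  apply/funext => r /=.
  by rewrite /phi -addrA -scalerDl -rmorphD; congr (g (_ + _%:C *: _)); ring.
have [r _] : exists2 r : R, r \in `[0, 1] & phi 1 - phi 0 = 0 * (1 - 0).
  apply: (@MVT_segment R phi (fun=> 0) 0 1) => //.
    by move=> x /andP[x0 x1]; apply: dphi; rewrite !bnd_simp in x0 x1; rewrite !ltW.
  apply: derivable_within_continuous => x; rewrite in_itv /= => /dphi h.
  by case: h.
by rewrite mul0r /phi mul1r mul0r scale0r addr0 => /eqP; rewrite subr_eq0 => /eqP.
Qed.

(** Keeps inside the box a path that moves first the real and then the imaginary part of a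
    coordinate. *)
Lemma norm_coord_le (d : C) (t s : R) : 0 <= t <= 1 -> 0 <= s <= 1 ->
  `|(t * Re d)%:C + (s * Im d)%:C * 'i| <= `|d|.
Proof.
move=> /andP[t0 t1] /andP[s0 s1]; rewrite !normc_def lecR; apply: ler_wsqrtr.
rewrite cReD cImD cReMl cImMl cRe_i cIm_i /= mulr0 mulr1 addr0 add0r.
rewrite lerD // exprMn ler_piMl ?sqr_ge0 // expr_le1 //.
Qed.

Lemma locally_constant z : open U -> U z ->
  exists2 e : R, 0 < e & forall y : Cn, (forall j, `|z 0 j - y 0 j| < e%:C) ->
    g y = g z.
Proof.
move=> oU Uz; have [e e0 eU] := open_box oU Uz; exists e => // y yz.
(* Consecutive points differ in a single coordinate and are joined by two segments, along which the
   derivative of [g] is zero. *)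
pose w m : Cn := \row_j (if (j < m)%N then y 0 j else z 0 j).
have w0 : w 0%N = z by apply/rowP => j; rewrite mxE.
have wn : w n = y by apply/rowP => j; rewrite mxE ltn_ord.
suff step m : (m <= n)%N -> g (w m) = g (w 0%N) by rewrite -wn -[in RHS]w0 step.
elim: m => [//|m IH] mn; rewrite -(IH (ltnW mn)).
pose k := Ordinal mn; pose d := y 0 k - z 0 k.
have box (t s : R) : 0 <= t <= 1 -> 0 <= s <= 1 ->
   U (w m + (t * Re d)%:C *: delta_mx 0 k + (s * Im d)%:C *: ('i *: delta_mx 0 k)).
  move=> t1 s1; apply: eU => j; rewrite !mxE /=.
  have [->|jk] := eqVneq j k.
    rewrite ltnn mulr1n !mulr1 -addrA opprD addrA subrr add0r normrN.
    apply: le_lt_trans (norm_coord_le d t1 s1) _.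
    by rewrite /d -normrN opprB yz.
  rewrite !mulr0 !addr0; case: ifP => _; first exact: yz.
  by rewrite subrr normr0 ltcR.
have -> : w m.+1 = w m + (Re d)%:C *: delta_mx 0 k + (Im d)%:C *: ('i *: delta_mx 0 k).
  apply/rowP => j; rewrite !mxE /= ltnS leq_eqVlt.
  have [->|jk] := eqVneq j k.
    rewrite eqxx ltnn mulr1n !mulr1 -addrA [_%:C * 'i]mulrC -complexE.
    by rewrite addrCA subrr addr0.
  by rewrite !mulr0 !addr0 -[_ == m]/(j == k) (negPf jk).
have one01 : 0 <= (1 : R) <= 1 by rewrite lexx ler01.
have zero01 : 0 <= (0 : R) <= 1 by rewrite lexx ler01.
rewrite (constant_on_segment (fun x Ux => proj2 (directional_zero k Ux))); last first.
  by move=> t t1; have := box 1 t one01 t1; rewrite mul1r.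
apply: (constant_on_segment (fun x Ux => proj1 (directional_zero k Ux))).
by move=> t t1; have := box t 0 t1 zero01; rewrite mul0r scale0r addr0.
Qed.

End LocallyConstant.

(** * The navigation problem *)

Section NavigationFields.
Variables (R : realType) (n : nat) (M : complexManifold R n).
Local Notation C := R[i].
Local Notation Cn := 'rV[C]_n.
Local Notation Re := (@complex.Re R).
Local Notation Im := (@complex.Im R).
Variables (h : chart_index M -> Cn -> 'M[C]_n) (f : M -> R)
          (W : chart_index M -> Cn -> Cn).
Hypothesis n2 : (2 <= n)%N.
Hypothesis data : navigation_data h f W.
Implicit Types (cc : chart_index M) (z eta : Cn) (i j k m : 'I_n).

Local Notation E cc z := ((eps_tilde h f W cc z)%:C).
Local Notation a := (randers_a h f W).
Local Notation b := (randers_b h f W).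

(* |beta|^2 is the degenerate Hermitian form with this matrix. *)
Definition randers_c cc z : 'M[C]_n := \matrix_(i, j) (b cc z i * (b cc z j)^*).
Local Notation c := randers_c.
Local Notation D cc := (coord_dom cc).

Lemma coord_dom_open cc : open (D cc).
Proof. exact: chart_cod_open. Qed.

Lemma smooth_wdiff cc (g : Cn -> C) k z : smooth_on (D cc) g -> D cc z -> wdiff k g z.
Proof. by move=> sg Dz; apply: rderivable_wdiff => v; exact: (sg [::] z Dz).2. Qed.

Lemma h_herm_field cc : herm_field (h cc) (D cc).
Proof.
have [[hs hsa hp _] _ _ _] := data; split.
- by move=> k z; apply: near_coord_open; exact: coord_dom_open.
- by move=> k z i j; apply: smooth_wdiff; exact: hs.
- by move=> z Dz i j; exact: hsa.
- by move=> z eta; exact: hp.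
Qed.

Lemma eps_gt0 cc z : D cc z -> 0 < eps_tilde h f W cc z.
Proof.
have [_ _ _ nav] := data => /nav[w0 wu _].
by rewrite subr_gt0 ltr_sqr // ?nnegrE ltW // (lt_trans w0).
Qed.

Lemma E_neq0 cc z : D cc z -> E cc z != 0.
Proof. by move=> Dz; rewrite lt0r_neq0 // ltcR eps_gt0. Qed.

Lemma norm_W_sqr cc z : D cc z ->
  (norm_W h W cc z ^+ 2)%:C = hform (h cc z) (W cc z) (W cc z).
Proof.
move=> Dz; have hf := h_herm_field cc.
have h0 : 0 <= hform (h cc z) (W cc z) (W cc z).
  have [->|w0] := eqVneq (W cc z) 0; first by rewrite hform0l.
  exact/ltW/(hf_pos hf).
rewrite /norm_W /hnorm sqr_sqrtr; last by move: h0; rewrite lecE => /andP[].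
exact/RRe_real0/Im_hform/(hf_selfadj hf).
Qed.

Lemma wdiff_E k cc z : D cc z -> wdiff k (fun w => E cc w) z.
Proof.
move=> Dz; have [[hs _ _ _] [Ws _] fs _] := data.
(* [norm_W] is a root, but its square is the Hermitian form itself, and [eps_tilde] only contains
   the square. *)
apply: (@wdiff_near _ _ k (fun w => (norm_u f cc w)%:C ^+ 2
    - hform (h cc w) (W cc w) (W cc w))).
  apply: near_coordS (near_coord_open k (@coord_dom_open cc) Dz) => w Dw.
  by rewrite -norm_W_sqr // -rmorphXn -rmorphB.
have dW i : wdiff k (fun w => W cc w 0 i) z := smooth_wdiff k (Ws cc i) Dz.
apply: wdiffD; first by apply: wdiffX; exact: smooth_wdiff (fs cc) Dz.
apply: wdiffN; apply: wdiff_sum => i; apply: wdiff_sum => j.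
exact: wdiffM (wdiffM (smooth_wdiff k (hs cc i j) Dz) (dW i)) (wdiff_conj (dW j)).
Qed.

Lemma wdiff_b k cc z i : D cc z -> wdiff k (fun w => b cc w i) z.
Proof.
move=> Dz; have [[hs _ _ _] [Ws _] _ _] := data.
apply: wdiffM; last exact: wdiffV (wdiff_E k Dz) (E_neq0 Dz).
apply: wdiff_sum => j; apply: wdiffM (smooth_wdiff k (hs cc i j) Dz) _.
exact: wdiff_conj (smooth_wdiff k (Ws cc j) Dz).
Qed.

Lemma randers_aE cc z : a cc z = (E cc z)^-1 *: h cc z + c cc z.
Proof.
apply/matrixP => i j; rewrite !mxE; congr (_ + _); first by rewrite mulrC.
rewrite /randers_b conjM conjV conj_real expr2 rmorphM invfM.
by move: (W_low _ _ _ _ _) (_^*) (_^-1) => x y e; ring.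
Qed.

Lemma h_conformal cc z : D cc z -> h cc z = E cc z *: (a cc z - c cc z).
Proof. by move=> Dz; rewrite randers_aE addrK scalerA mulfV ?E_neq0 // scale1r. Qed.

Lemma hform_c cc z eta zeta : hform (c cc z) eta zeta =
  randers_beta h f W cc z eta * (randers_beta h f W cc z zeta)^*.
Proof.
rewrite /randers_beta conj_sum mulr_suml; apply: eq_bigr => i _.
rewrite mulr_sumr; apply: eq_bigr => j _; rewrite mxE conjM; ring.
Qed.

Lemma randers_form_pair cc : form_pair (a cc) (c cc) (D cc).
Proof.
have hf := h_herm_field cc.
have hc z : selfadj (c cc z) by move=> i j; rewrite !mxE conjM conj_conj mulrC.
have c0 z eta : 0 <= hform (c cc z) eta eta by rewrite hform_c mul_conjC_ge0.
have dc k z i j : D cc z -> wdiff k (fun w => c cc w i j) z.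
  move=> Dz; rewrite (_ : (fun w => _) = (fun w => b cc w i * (b cc w j)^*)).
    exact: wdiffM (wdiff_b k i Dz) (wdiff_conj (wdiff_b k j Dz)).
  by apply/funext => w; rewrite mxE.
split; [exact: (hf_near hf)| |by move=> k z i j; exact: dc| |by move=> z _; exact: hc
  | |by move=> z eta _; exact: c0].
- move=> k z i j Dz.
  rewrite (_ : (fun w => _) = (fun w => (E cc w)^-1 * h cc w i j + c cc w i j)).
    apply: wdiffD (dc _ _ _ _ Dz); apply: wdiffM (hf_diff hf k i j Dz).
    exact: wdiffV (wdiff_E k Dz) (E_neq0 Dz).
  by apply/funext => w; rewrite randers_aE !mxE.
- move=> z Dz i j; rewrite randers_aE 2!mxE [in RHS]mxE [in RHS]mxE.
  by rewrite conjD conjM conjV conj_real -hc -(hf_selfadj hf Dz).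
- move=> z eta Dz e0; rewrite randers_aE hformDm hformZm ltr_pwDl //.
  by rewrite pmulr_rgt0 ?(hf_pos hf) // invr_gt0 ltcR eps_gt0.
Qed.

Lemma randers_fin cc :
  fin_val (randers_finsler h f W) cc = sum_roots (a cc) (c cc).
Proof.
apply/funext => z; apply/funext => eta; rewrite /=/sum_roots; congr (_ + _).
rewrite hform_c cReM cRe_conj cIm_conj; case: (randers_beta _ _ _ _ _ _) => x y /=.
by congr Num.sqrt; ring.
Qed.

Lemma randers_dom cc z eta :
  fin_dom (randers_finsler h f W) cc (z, eta) <-> regular (c cc) (D cc) z eta.
Proof.
by rewrite /= /regular hform_c mulf_eq0 conjC_eq0 orbb.
Qed.

Lemma randers_kernel cc z : D cc z ->
  exists2 k : Cn, k != 0 & forall j, lowr (c cc z) k j = 0.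
Proof.
move=> Dz.
have low (k : Cn) j : lowr (c cc z) k j = randers_beta h f W cc z k * (b cc z j)^*.
  by rewrite /randers_beta mulr_suml; apply: eq_bigr => i _; rewrite mxE; ring.
suff [k k0 bk] : exists2 k : Cn, k != 0 & randers_beta h f W cc z k = 0.
  by exists k => // j; rewrite low bk mul0r.
pose i0 := Ordinal (ltnW n2); pose i1 := Ordinal n2.
have beta_delta (x : C) i : randers_beta h f W cc z (x *: delta_mx 0 i) = b cc z i * x.
  rewrite /randers_beta (bigD1 i) //= !mxE !eqxx mulr1 big1 ?addr0 // => j ji.
  by rewrite !mxE (negPf ji) !mulr0.
have betaD (x y : Cn) : randers_beta h f W cc z (x + y) =
    randers_beta h f W cc z x + randers_beta h f W cc z y.
  by rewrite /randers_beta -big_split; apply: eq_bigr => j _ /=; rewrite mxE mulrDr.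
have [b0|b0] := eqVneq (b cc z i0) 0.
  exists (1 *: delta_mx 0 i0); last by rewrite beta_delta b0 mul0r.
  by apply/negP => /eqP/rowP/(_ i0); rewrite !mxE !eqxx mulr1 => /eqP; rewrite oner_eq0.
(* The standard solution of one linear equation in two unknowns, nonzero because its second entry
   is. *)
exists (b cc z i1 *: delta_mx 0 i0 + (- b cc z i0) *: delta_mx 0 i1).
  apply/negP => /eqP/rowP/(_ i1); rewrite !mxE !eqxx mulr0 mulr1 add0r => /eqP.
  by rewrite oppr_eq0 (negPf b0).
by rewrite betaD !beta_delta; ring.
Qed.

(** Supplies a direction with beta nonzero over every point: beta(W) is the squared [h]-norm of W
    divided by eps, and W has no zeros. *)
Lemma randers_regular cc z : D cc z -> regular (c cc) (D cc) z (W cc z).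
Proof.
move=> Dz; split=> //; rewrite hform_c mulf_eq0 conjC_eq0 orbb.
have -> : randers_beta h f W cc z (W cc z) = (E cc z)^-1 * hform (h cc z) (W cc z) (W cc z).
  rewrite hform_lowl mulr_sumr; apply: eq_bigr => i _.
  by rewrite /randers_b -/(lowl (h cc z) (W cc z) i) /W_low /lowl; ring.
rewrite mulf_neq0 ?invr_neq0 ?E_neq0 // -norm_W_sqr //.
have [_ _ _ /(_ _ _ Dz)[w0 _ _]] := data.
by rewrite lt0r_neq0 // ltcR exprn_gt0.
Qed.

Lemma dzM_conformal cc k z : D cc z -> dzM k (h cc) z =
  dz k (fun w => E cc w) z *: (a cc z - c cc z)
  + E cc z *: (dzM k (a cc) z - dzM k (c cc) z).
Proof.
move=> Dz; have fp := randers_form_pair cc; apply/matrixP => i j; rewrite !mxE.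
rewrite (@dz_near _ _ k _ (fun w => E cc w * (a cc w i j - c cc w i j))).
  have da := fp_da fp k i j Dz; have dc := fp_dc fp k i j Dz.
  rewrite (wirt_dz (wirtM (wdiff_E k Dz) (wirtD da (wirtN dc)))).
  by rewrite !mxE.
apply: near_coordS (near_coord_open k (@coord_dom_open cc) Dz) => w Dw.
by rewrite {1}h_conformal // mxE !mxE.
Qed.

End NavigationFields.

Section HermitianHomogeneity.
Variables (R : realType) (n : nat).
Local Notation C := R[i].
Local Notation Cn := 'rV[C]_n.
Variables (H : Cn -> 'M[C]_n) (D : Cn -> Prop).
Hypothesis hf : herm_field H D.

Lemma herm_spray2_i z eta : D z -> eta != 0 ->
  spray2 (herm_fin H) z ('i *: eta) = - spray2 (herm_fin H) z eta.
Proof.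
move=> Dz e0; rewrite herm_fin_sum_roots.
exact: (spray2_i (herm_form_pair hf) (herm_regular hf Dz e0)).
Qed.

Lemma herm_theta_row_i z eta : D z -> eta != 0 ->
  theta_row (herm_fin H) z ('i *: eta) = theta_row (herm_fin H) z eta.
Proof.
move=> Dz e0; rewrite herm_fin_sum_roots.
exact: (theta_row_i (herm_form_pair hf) (herm_regular hf Dz e0)).
Qed.

End HermitianHomogeneity.

(** Here [x] is alpha, [y] is |beta|, [e] is eps, and [X], [Y] pair the common [spray_bar] with
    [eta] lowered by [a] and by the form of |beta|^2. As the modulus of W_0 is eps y, everything
    reduces to (X - Y) / F - X / x = - (y / F) (X / x + Y / y), where F = x + y. *)
Lemma curvature_algebra (R : realType) (x y X Y : R[i]) (e Fv av hv wv : R) :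
  Fv%:C = x + y -> av%:C = x -> wv%:C = e%:C * y -> x != 0 -> y != 0 -> x + y != 0 -> e%:C != 0 :> R[i] ->
  hv%:C != 0 :> R[i] ->
  - (4 / (Fv ^+ 4)%:C) * ((x + y) * (X / x + Y / y)) =
  ((Fv ^+ 2)%:C * wv%:C)^-1 *
    ((e * av ^+ 3)%:C * (- (4 / (av ^+ 4)%:C) * X)
     - (hv ^+ 4 / Fv)%:C * (- (4 / (hv ^+ 4)%:C) * (e%:C * (X - Y)))).
Proof.
move=> eF ea ew x0 y0 xy0 e0 h0.
rewrite !(rmorphM, fmorphV) /= eF ea ew.
by field; rewrite x0 y0 xy0 e0 h0.
Qed.

(** * Assembly on the manifold *)

Section Assembly.
Variables (R : realType) (n : nat) (M : complexManifold R n).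
Local Notation C := R[i].
Local Notation Cn := 'rV[C]_n.
Local Notation Re := (@complex.Re R).
Local Notation Im := (@complex.Im R).
Variables (h : chart_index M -> Cn -> 'M[C]_n) (f : M -> R)
          (W : chart_index M -> Cn -> Cn).
Hypothesis n2 : (2 <= n)%N.
Hypothesis data : navigation_data h f W.
Implicit Types (cc : chart_index M) (z eta : Cn) (i j k m : 'I_n).

Local Notation E cc z := ((eps_tilde h f W cc z)%:C).
Local Notation a := (randers_a h f W).
Local Notation c := (randers_c h f W).
Local Notation D cc := (coord_dom cc).
Local Notation FF := (randers_finsler h f W).
Local Notation Fh := (hermitian_finsler h).
Local Notation Fa := (hermitian_finsler a).

Let fp cc := randers_form_pair data cc.
Let hfh cc := h_herm_field data cc.
Let hfa cc : herm_field (a cc) (D cc) := form_pair_herm (fp cc).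

Lemma projective_rows (F F' : finsler M) : projectively_related F F' ->
  forall cc z eta, (fin_dom F cc `&` fin_dom F' cc) (z, eta) ->
  exists P : C, spray2 (fin_val F' cc) z eta = spray2 (fin_val F cc) z eta
    + (theta_row (fin_val F' cc) z eta - theta_row (fin_val F cc) z eta)
    + (2 * P) *: eta.
Proof.
move=> [P [_ _ hP]] cc z eta dom; exists (P cc (z, eta)); apply/rowP => i.
have {}hP := hP cc z eta dom i; rewrite !mxE hP.
by move: (spray _ _ _ _) (theta_star _ _ _ _) (theta_star _ _ _ _) => s t t'; field.
Qed.

Section Split.
Variable H : chart_index M -> Cn -> 'M[C]_n.
Hypothesis hfH : forall cc, herm_field (H cc) (D cc).
Hypothesis pr : projectively_related (hermitian_finsler H) FF.

(** Stated for a general Hermitian [H] because it serves both for [a], where the relation is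
    assumed, and for [h]. *)
Lemma projective_hermitian_split cc z eta : regular (c cc) (D cc) z eta ->
  (exists L, spray2 (sum_roots (a cc) (c cc)) z eta
     = spray2 (herm_fin (H cc)) z eta + L *: eta) /\
  (exists L, theta_row (sum_roots (a cc) (c cc)) z eta
     = theta_row (herm_fin (H cc)) z eta + L *: eta).
Proof.
move=> r; have Dz := proj1 r; have e0 := regular_neq0 r.
have dom x : regular (c cc) (D cc) z x ->
    (fin_dom (hermitian_finsler H) cc `&` fin_dom FF cc) (z, x).
  by move=> rx; split; [split=> //=; exact: (regular_neq0 rx) | exact/randers_dom].
have [P hP] := projective_rows pr (dom _ r).
have [Q hQ] := projective_rows pr (dom _ (regular_i r)).
rewrite randers_fin in hP hQ.
have s1 := spray2_i (fp cc) r; have t1 := theta_row_i (fp cc) r.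
have s2 : spray2 (fin_val (hermitian_finsler H) cc) z ('i *: eta) = _ :=
  herm_spray2_i (hfH cc) Dz e0.
have t2 : theta_row (fin_val (hermitian_finsler H) cc) z ('i *: eta) = _ :=
  herm_theta_row_i (hfH cc) Dz e0.
rewrite s1 t1 s2 t2 in hQ.
exact: projective_split hP hQ.
Qed.

End Split.

Lemma eps_chart_indep cc cc' (p : M) :
  chart_dom (charts cc) p -> chart_dom (charts cc') p ->
  eps_tilde h f W cc (chart_map (charts cc) p) =
  eps_tilde h f W cc' (chart_map (charts cc') p).
Proof.
move=> dp dp'; have [[_ _ _ ht] [_ Wt] _ _] := data.
rewrite /eps_tilde /norm_u !chart_mapK //; congr (_ - _ ^+ 2).
set z := chart_map (charts cc) p.
have ov : overlap cc cc' z by exists p.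
have tz : transition cc cc' z = chart_map (charts cc') p by rewrite /transition chart_mapK.
rewrite /norm_W /hnorm -tz (Wt _ _ _ ov) (ht _ _ _ ov); congr (Num.sqrt (Re _)).
(* As a matrix product, the invariance of the form under a change of chart is mere associativity. *)
have hformE (H : 'M[C]_n) (x y : Cn) :
    hform H x y = (x *m H *m (map_mx (@conjc R) y)^T) 0 0.
  rewrite hform_lowr mxE; apply: eq_bigr => j _; rewrite !mxE mulrC; congr (_ * _).
  by apply: eq_bigr => i _; rewrite mulrC.
by rewrite !hformE map_mxM trmx_mul !mulmxA.
Qed.

Lemma eps_constant_of_gradient : connected [set: M] ->
  (forall cc z k, D cc z -> dz k (fun w => E cc w) z = 0) ->
  exists e : R, forall cc z, D cc z -> eps_tilde h f W cc z = e.
Proof.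
move=> Mconn g0.
(* An empty manifold has no base point to take the constant from; any value will do there. *)
have [[p0]|noM] := pselect (inhabited M); last first.
  by exists 0 => cc z [p _ _]; case: noM; constructor.
(* A chart chosen at each point makes eps a function on [M]; the choice is immaterial by
   [eps_chart_indep]. *)
pose g p := eps_tilde h f W (sval (cid (charts_cover p)))
  (chart_map (charts (sval (cid (charts_cover p)))) p).
have gE cc p : chart_dom (charts cc) p ->
    eps_tilde h f W cc (chart_map (charts cc) p) = g p.
  by move=> dp; apply: eps_chart_indep => //; exact: (svalP (cid (charts_cover p))).
have near_const (p : M) : \forall q \near p, g q = g p.
  have [cc dp] := charts_cover p.
  have Dp : D cc (chart_map (charts cc) p) by exists p.
  have [e e0 he] := locally_constant (fun z k => @wdiff_E _ _ _ _ _ _ data k cc z)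
    (g0 cc) (@coord_dom_open _ _ _ cc) Dp.
  have nb := chart_map_continuous dp (nbhs_box (chart_map (charts cc) p) e0).
  have nd : nbhs p (chart_dom (charts cc)).
    by apply: open_nbhs_nbhs; split=> //; exact: chart_dom_open.
  apply: (@filterS2 _ (nbhs p) _ _ _ _ _ nb nd) => q bq dq.
  by rewrite -(gE cc q dq) -(gE cc p dp); exact: he.
(* The level set through [p0] is open and closed, since [g] is locally constant. *)
have gc : [set p | g p = g p0] = [set: M].
  apply: Mconn; first by exists p0.
  - exists [set p | g p = g p0]; last by rewrite setTI.
    rewrite openE => p /= gp; rewrite /interior.
    by apply: filterS (near_const p) => q qp; rewrite /= qp.
  - exists [set p | g p = g p0]; last by rewrite setTI.
    rewrite -openC openE => p /= gp; rewrite /interior.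
    by apply: filterS (near_const p) => q qp; rewrite /= qp.
exists (g p0) => cc z [p dp <-].
by rewrite (gE _ _ dp); have : [set: M] p by []; rewrite -gc.
Qed.

Lemma gradient_of_eps_constant (e : R) :
  (forall cc z, D cc z -> eps_tilde h f W cc z = e) ->
  forall cc z k, D cc z -> dz k (fun w => E cc w) z = 0.
Proof.
move=> he cc z k Dz; rewrite (@dz_near _ _ k _ (fun _ => e%:C)).
  exact: wirt_dz (wirt_cst _ _ _).
by apply: near_coordS (near_coord_open k (@coord_dom_open _ _ _ cc) Dz) => w /he ->.
Qed.

Hypothesis pr : projectively_related Fa FF.

Let srel cc z eta (r : regular (c cc) (D cc) z eta) :=
  proj1 (projective_hermitian_split hfa pr r).
Let trel cc z eta (r : regular (c cc) (D cc) z eta) :=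
  proj2 (projective_hermitian_split hfa pr r).
Let ker cc z := @randers_kernel _ _ _ h f W n2 cc z.

Section AtRegularPoint.
Variables (cc : chart_index M) (z eta : Cn).
Hypothesis r : regular (c cc) (D cc) z eta.
Let Dz := proj1 r.
Let e0 := regular_neq0 r.

Lemma randers_spray : spray2 (sum_roots (a cc) (c cc)) z eta = spray2 (herm_fin (a cc)) z eta.
Proof. exact: (spray_defect_zero (fp cc) (@ker cc) (@srel cc) r).1. Qed.

Lemma randers_theta :
  theta_row (sum_roots (a cc) (c cc)) z eta = theta_row (herm_fin (a cc)) z eta.
Proof. exact: (theta_defect_zero (fp cc) (@ker cc) (@srel cc) (@trel cc) r).1. Qed.

Let Ga := lowr_herm_spray (hfa cc) Dz e0.
Let Gc := (spray_defect_zero (fp cc) (@ker cc) (@srel cc) r).2.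
Let Ta : forall m, _ = tlow eta (fun j => dzM j (a cc) z) m := lowl_herm_theta (hfa cc) Dz e0.
Let Tc := (theta_defect_zero (fp cc) (@ker cc) (@srel cc) (@trel cc) r).2.
Let Gh := lowr_herm_spray (hfh cc) Dz e0.
Let Th : forall m, _ = tlow eta (fun j => dzM j (h cc) z) m := lowl_herm_theta (hfh cc) Dz e0.
Let hE := h_conformal data Dz.
Let E0 := E_neq0 data Dz.
Let dhE j := dzM_conformal data j Dz.
Let hpos (x : Cn) (x0 : x != 0) := lt0r_neq0 (hf_pos (hfh cc) Dz x0).

Lemma h_spray : (forall k, dz k (fun w => E cc w) z = 0) ->
  spray2 (herm_fin (h cc)) z eta = spray2 (herm_fin (a cc)) z eta.
Proof. exact: (conformal_spray hE dhE hpos Ga Gc Gh). Qed.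

Lemma h_theta : (forall k, dz k (fun w => E cc w) z = 0) ->
  theta_row (herm_fin (h cc)) z eta = theta_row (herm_fin (a cc)) z eta.
Proof. exact: (conformal_theta hE dhE hpos Ta Tc Th). Qed.

Lemma h_gradient : projectively_related Fh FF ->
  exists mu, forall m, dz m (fun w => E cc w) z = mu * lowl (h cc z) eta m.
Proof.
move=> prh; have [_ [L hL]] := projective_hermitian_split hfh prh r.
exact: (conformal_gradient hE E0 dhE hpos Ta Tc Th e0 (etrans (esym randers_theta) hL)).
Qed.

End AtRegularPoint.

(** The two directions compared are W and W + k with [k] in the kernel of |beta|^2; both are
    regular, as |beta|^2 takes the same value on them. *)
Lemma gradient_of_projective : projectively_related Fh FF ->
  forall cc z k, D cc z -> dz k (fun w => E cc w) z = 0.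
Proof.
move=> prh cc z m Dz.
have r := randers_regular data Dz; have [k k0 ck] := ker Dz.
have r' := regular_line (fp cc) r ck 1; rewrite scale1r in r'.
have [mu e1] := h_gradient r prh; have [mu' e2] := h_gradient r' prh.
have hpos (x : Cn) (x0 : x != 0) := lt0r_neq0 (hf_pos (hfh cc) Dz x0).
exact: (gradient_zero hpos r.2 k0 ck e1 e2).
Qed.

Section ZeroGradient.
Hypothesis g0 : forall cc z k, D cc z -> dz k (fun w => E cc w) z = 0.

Let spray2_inj (F F' : Cn -> Cn -> R) z eta i :
  spray2 F z eta = spray2 F' z eta -> spray F i z eta = spray F' i z eta.
Proof.
have two : (2 : C) != 0 by rewrite pnatr_eq0.
move=> /rowP/(_ i); rewrite [LHS]mxE [RHS]mxE.
by move: (spray F i z eta) (spray F' i z eta) => s s'; exact: (mulfI two).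
Qed.

Lemma spray_eq cc z eta i : regular (c cc) (D cc) z eta ->
  spray (fin_val Fh cc) i z eta = spray (fin_val FF cc) i z eta.
Proof.
move=> r; rewrite randers_fin.
exact: (spray2_inj i (etrans (h_spray r (fun k => g0 k r.1)) (esym (randers_spray r)))).
Qed.

Lemma spray_a_eq cc z eta i : regular (c cc) (D cc) z eta ->
  spray (fin_val Fa cc) i z eta = spray (fin_val FF cc) i z eta.
Proof.
by move=> r; rewrite randers_fin; exact: (spray2_inj i (esym (randers_spray r))).
Qed.

Lemma theta_eq cc z eta i : regular (c cc) (D cc) z eta ->
  theta_star (fin_val Fh cc) i z eta = theta_star (fin_val FF cc) i z eta.
Proof.
move=> r; rewrite randers_fin.
have /rowP/(_ i) := etrans (h_theta r (fun k => g0 k r.1)) (esym (randers_theta r)).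
by rewrite [LHS]mxE [RHS]mxE.
Qed.

Lemma rderive_iter_zero (V : normedModType C) (vs : seq V) :
  rderive_iter vs (fun _ => 0 : C) = (fun _ => 0).
Proof.
elim: vs => [//|v vs /= ->]; apply/funext => x.
exact: is_rd_rderive (is_rd_cst 0 v x).
Qed.

(** Sprays and thetas coincide, so the projective factor can be taken to be 0. *)
Lemma projective_of_gradient : projectively_related Fh FF.
Proof.
exists (fun _ _ => 0); split=> //.
- move=> cc vs x _; rewrite rderive_iter_zero; split; first exact: cst_continuous.
  by move=> v; exact: is_rd_rderivable (is_rd_cst 0 v x).
- move=> cc z eta [_ /randers_dom r] i.
  by rewrite spray_eq // theta_eq // subrr mulr0 mul0r !addr0.
Qed.

Lemma curvature_formula cc z eta : regular (c cc) (D cc) z eta ->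
  hol_curvature (fin_val FF cc) z eta =
  ((fin_val FF cc z eta ^+ 2)%:C
    * (Num.sqrt (Re (W_zero h W cc z eta * (W_zero h W cc z eta)^*)))%:C)^-1
   * ((eps_tilde h f W cc z * randers_alpha h f W cc z eta ^+ 3)%:C
        * hol_curvature (fin_val Fa cc) z eta
      - (fin_val Fh cc z eta ^+ 4 / fin_val FF cc z eta)%:C
        * hol_curvature (fin_val Fh cc) z eta).
Proof.
move=> r; have Dz := proj1 r; have e0 := regular_neq0 r.
have A0 := regular_a (fp cc) r; have S0 := regular_c (fp cc) r.
pose sb := spray_bar (fin_val FF cc) z eta.
(* The conj z derivative needs equality of the sprays at nearby base points with [eta] fixed, where
   regularity persists. *)
have sba k : spray_bar (fin_val Fa cc) z eta k = sb k.
  apply: spray_bar_near => l.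
  by apply: near_coordS (near_regular_z (fp cc) l r) => w rw; exact: spray_a_eq.
have sbh k : spray_bar (fin_val Fh cc) z eta k = sb k.
  apply: spray_bar_near => l.
  by apply: near_coordS (near_regular_z (fp cc) l r) => w rw; exact: spray_eq.
pose X := \sum_k lowl (a cc z) eta k * sb k.
pose Y := \sum_k lowl (c cc z) eta k * sb k.
have kF : hol_curvature (fin_val FF cc) z eta =
    - (4 / (fin_val FF cc z eta ^+ 4)%:C) * gl (hform (a cc z) eta eta) (hform (c cc z) eta eta) X Y.
  rewrite hol_curvatureE; congr (_ * _).
  rewrite (_ : X = \sum_k sb k * lowl (a cc z) eta k); last by apply: eq_bigr => k _; rewrite mulrC.
  rewrite (_ : Y = \sum_k sb k * lowl (c cc z) eta k); last by apply: eq_bigr => k _; rewrite mulrC.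
  rewrite -gl_sum; apply: eq_bigr => k _; rewrite mulrC; congr (_ * _).
  rewrite randers_fin (fundamentalE (fp cc) r) -[RHS](gfin_euler_conj (fp cc) k r).
  by apply: eq_bigr => m _; rewrite mxE.
have kA := hol_curvature_lowl (herm_fundamental (hfa cc) Dz e0) sba.
have kh := hol_curvature_lowl (herm_fundamental (hfh cc) Dz e0) sbh.
have hX : \sum_k lowl (h cc z) eta k * sb k = E cc z * (X - Y).
  rewrite /X /Y -sumrB mulr_sumr; apply: eq_bigr => k _.
  by rewrite (h_conformal data Dz) lowlZm lowlBm -mulrA mulrBl.
rewrite hX in kh.
have hh0 := hf_pos (hfh cc) Dz e0.
have hsq : (fin_val Fh cc z eta)%:C = rsqrt (hform (h cc z) eta eta) by [].
have wE : (Num.sqrt (Re (W_zero h W cc z eta * (W_zero h W cc z eta)^*)))%:C =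
    E cc z * rsqrt (hform (c cc z) eta eta).
  have ww : W_zero h W cc z eta * (W_zero h W cc z eta)^* =
      (eps_tilde h f W cc z ^+ 2)%:C * hform (c cc z) eta eta.
    rewrite hform_c.
    have -> : W_zero h W cc z eta = E cc z * randers_beta h f W cc z eta.
      rewrite /W_zero /randers_beta mulr_sumr; apply: eq_bigr => i _.
      by rewrite /randers_b mulrA mulrCA mulfV ?mulr1 // (E_neq0 data Dz).
    by rewrite conjM conj_real expr2 rmorphM; ring.
  rewrite ww cReMl sqrtrM ?sqr_ge0 // sqrtr_sqr gtr0_norm ?(eps_gt0 data Dz) //.
  exact: rmorphM.
have FE : (fin_val FF cc z eta)%:C =
    rsqrt (hform (a cc z) eta eta) + rsqrt (hform (c cc z) eta eta).
  by rewrite randers_fin; exact: sum_rootsE.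
rewrite kF; rewrite [hol_curvature (fin_val Fa cc) z eta]kA.
rewrite [hol_curvature (fin_val Fh cc) z eta]kh.
apply: curvature_algebra => //.
- exact: rsqrt_neq0.
- exact: rsqrt_neq0.
- by rewrite lt0r_neq0 // addr_gt0 ?rsqrt_gt0.
- exact: (E_neq0 data Dz).
- by rewrite hsq; exact: rsqrt_neq0.
Qed.

End ZeroGradient.

End Assembly.

Local Open Scope complex_scope.

Theorem theorem4p9 (R : realType) (n : nat) (hn : (2 <= n)%N)
    (M : complexManifold R n) (Mconn : connected [set: M])
    (h : chart_index M -> 'rV[R[i]]_n -> 'M[R[i]]_n) (f : M -> R)
    (W : chart_index M -> 'rV[R[i]]_n -> 'rV[R[i]]_n)
    (data : navigation_data h f W) :
  let FF := randers_finsler h f W in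
  let Fh := hermitian_finsler h in
  let Fa := hermitian_finsler (randers_a h f W) in
  let eps_constant := exists k : R, forall (c : chart_index M) z,
    coord_dom c z -> eps_tilde h f W c z = k in
  projectively_related Fa FF ->
  (projectively_related Fh FF <-> eps_constant) /\
  (projectively_related Fh FF \/ eps_constant ->
   forall (c : chart_index M) z eta, fin_dom FF c (z, eta) ->
     [/\ forall i, spray (fin_val Fh c) i z eta = spray (fin_val FF c) i z eta,
         forall i, theta_star (fin_val Fh c) i z eta
                   = theta_star (fin_val FF c) i z eta
       & hol_curvature (fin_val FF c) z eta =
           ((fin_val FF c z eta ^+ 2)%:C
            * (Num.sqrt (complex.Re (W_zero h W c z eta * (W_zero h W c z eta)^*)))%:C)^-1
           * ((eps_tilde h f W c z * randers_alpha h f W c z eta ^+ 3)%:C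
                * hol_curvature (fin_val Fa c) z eta
              - (fin_val Fh c z eta ^+ 4 / fin_val FF c z eta)%:C
                * hol_curvature (fin_val Fh c) z eta)]).
Proof.
move=> FF Fh Fa eps_constant pr.
have grad_proj := gradient_of_projective hn data pr.
have proj_grad := projective_of_gradient hn data pr.
have const_grad := eps_constant_of_gradient data Mconn.
split; first split.
- by move=> /grad_proj; exact: const_grad.
- by move=> [e /gradient_of_eps_constant ge]; exact: proj_grad.
move=> prc c z eta /randers_dom r.
(* The vanishing gradient of eps is the common consequence of both alternatives, and all three
   conclusions rest on it. *)
have g0 : forall cc z k, coord_dom cc z -> dz k (fun w => (eps_tilde h f W cc w)%:C) z = 0.
  by case: prc => [/grad_proj //|[e /gradient_of_eps_constant]].
split.
- by move=> i; exact: (spray_eq hn data pr g0).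
- by move=> i; exact: (theta_eq hn data pr g0).
- exact: (curvature_formula hn data pr g0).
Qed.
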